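(* Let $\alpha$ be a $k$-adic monotone connective such that $A_\alpha(s)=s$ for some $s\in(0,1)$. There exists a constant $c_\alpha$ such that for all $n>0$, for the growth process $(\mu,\alpha)$ on $n$ variables with $\mu$ uniform on the $n$ projections and with limiting distribution $\pi$: if $i\ge k2^k\log(n)+c_\alpha$, then for all $n$-adic Boolean functions $f$, $|\pi_i(f)-\pi(f)|<2^{-n}$.
   Context: A connective is a $k$-adic Boolean function $\alpha:\{0,1\}^k\to\{0,1\}$. Its characteristic polynomial is $A_\alpha(p)=\Pr[\alpha(X_1,\dots,X_k)=1]=\sum_{j=0}^k\beta_j\binom kj p^j(1-p)^{k-j}$, where the $X_j$ are independent binary variables each equal to 1 with probability $p$, and $\beta_j$ is the fraction of assignments of weight $j$ for which $\alpha$ is true. The growth process $(\mu,\alpha)$ gives distributions $\pi_i$ on $n$-adic Boolean functions: $\pi_0=\mu$, and for $i\ge1$, $\pi_i(f)$ is the probability that $\alpha(g_1,\dots,g_k)=f$ where $g_1,\dots,g_k$ are independent random functions distributed according to $\pi_{i-1}$. The limiting distribution is $\pi=\lim_{i\to\infty}\pi_i$ (pointwise). Logarithms are to base 2. *)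

(* Defs.v *)
From HB Require Import structures.
From mathcomp Require Import all_boot all_order all_algebra.
From mathcomp Require Import all_classical all_reals all_analysis.

Set Implicit Arguments.
Unset Strict Implicit.
Unset Printing Implicit Defensive.

Import Order.TTheory GRing.Theory Num.Theory.
Import numFieldNormedType.Exports.

Local Open Scope ring_scope.

Definition boolfun (n : nat) : finType := {ffun {ffun 'I_n -> bool} -> bool}.

Definition monotone_boolfun (n : nat) (f : boolfun n) : Prop :=
  forall x y : {ffun 'I_n -> bool}, (forall j, x j -> y j) -> f x -> f y.

Definition projection (n : nat) (j : 'I_n) : boolfun n :=
  [ffun x : {ffun 'I_n -> bool} => x j].

Definition compose (k n : nat) (alpha : boolfun k) (g : {ffun 'I_k -> boolfun n}) :
    boolfun n :=
  [ffun x : {ffun 'I_n -> bool} => alpha [ffun j => g j x]].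

(* Probability of the event [E] for [k] independent random elements of [T],
   each with probability mass function [mu]. *)
Definition iid_prob (R : realType) (T : finType) (mu : T -> R) (k : nat)
    (E : pred {ffun 'I_k -> T}) : R :=
  \sum_(x | E x) \prod_(j < k) mu (x j).

Definition characteristic_poly (R : realType) (k : nat) (alpha : boolfun k) (p : R) : R :=
  iid_prob (bernoulli_pmf p) (fun x => alpha x).

Definition weight (k : nat) (x : {ffun 'I_k -> bool}) : nat := #|[set j | x j]|.

Definition true_fraction (R : realType) (k : nat) (alpha : boolfun k) (j : nat) : R :=
  #|[set x | (weight x == j) && alpha x]|%:R / #|[set x : {ffun 'I_k -> bool} | weight x == j]|%:R.

Fixpoint growth (R : realType) (n k : nat) (mu : boolfun n -> R)
    (alpha : boolfun k) (i : nat) : boolfun n -> R :=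
  match i with
  | 0%N => mu
  | i'.+1 => fun f => iid_prob (growth mu alpha i') (fun g => compose alpha g == f)
  end.

(* [limn] is total: this is the limiting distribution only when the sequence
   converges. *)
Definition growth_lim (R : realType) (n k : nat) (mu : boolfun n -> R)
    (alpha : boolfun k) (f : boolfun n) : R :=
  limn (fun i => growth mu alpha i f).

Definition uniform_projections (R : realType) (n : nat) (f : boolfun n) : R :=
  if f \in codom (@projection n) then n%:R^-1 else 0.

Definition log2 (R : realType) (x : R) : R := ln x / ln 2.

Lemma card_weight (k j : nat) :
  #|[set x : {ffun 'I_k -> bool} | weight x == j]| = 'C(k, j).
Proof.
rewrite -[k in RHS]card_ord -card_draws.
rewrite -(card_imset _ (f := fun x : {ffun 'I_k -> bool} => [set i | x i])).
  apply: eq_card => A; rewrite inE; apply/imsetP/idP => [[x]|hA].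
    by rewrite inE => /eqP h ->; rewrite -h.
  exists [ffun i => i \in A].
    by rewrite inE -(eqP hA); apply/eqP/eq_card => i; rewrite inE ffunE.
  by apply/setP => i; rewrite !inE ffunE.
by move=> x y /setP h; apply/ffunP => i; have := h i; rewrite !inE.
Qed.

Lemma characteristic_polyE (R : realType) (k : nat) (alpha : boolfun k) (p : R) :
  characteristic_poly alpha p =
  \sum_(j < k.+1) true_fraction R alpha j * 'C(k, j)%:R
                  * p ^+ j * (1 - p) ^+ (k - j).
Proof.
have wk (x : {ffun 'I_k -> bool}) : (weight x < k.+1)%N.
  by rewrite ltnS -[k in leqRHS]card_ord max_card.
rewrite /characteristic_poly /iid_prob (partition_big (fun x => Ordinal (wk x)) predT) //=.
apply: eq_bigr => j _.
have C0 : 'C(k, j)%:R != 0 :> R by rewrite pnatr_eq0 -lt0n bin_gt0 -ltnS.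
rewrite /true_fraction card_weight divfK // -mulrA mulr_natl -sumr_const.
rewrite (eq_bigl [in [set x | (weight x == j) && alpha x]]); last first.
  by move=> x; rewrite inE andbC.
apply: eq_bigr => x; rewrite inE => /andP[/eqP wx _].
rewrite (bigID [in [set i | x i]]) /=; congr (_ * _).
  rewrite (eq_bigr (fun=> p)) ?prodr_const; first by rewrite -wx.
  by move=> i; rewrite inE /bernoulli_pmf => ->.
rewrite (eq_bigr (fun=> 1 - p)) => [|i]; last first.
  by rewrite inE /bernoulli_pmf => /negbTE ->.
rewrite (eq_bigl [in ~: [set i | x i]]) => [|i]; last by rewrite !inE.
by rewrite prodr_const cardsCs finset.setCK card_ord -wx.
Qed.

(* Main.v *)
(** If [alpha] is a projection, the process is stationary. Otherwise no single input of
    [alpha] forces its value.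

    At a fixed assignment of weight [w], the probability that the random function is
    true follows the orbit of [w / n] under [A_alpha]. If [w / n] differs from [s], this
    orbit goes to 0 or 1: the distance to [s], at least [C / n ^ k] by integrality,
    grows by a factor [1 + 4/3 * 2 ^ -k] per step (the derivative of [A_alpha] at [s]
    exceeds 1 by the spectral weight of [alpha] on degrees at least 2), and the distance
    to 0 or 1 is eventually squared at each step. If no weight is equal to [s n], the
    union bound over all assignments concludes.

    If [w / n = s], reveal the values of the leaf functions of a tree of depth [d] at
    some earlier assignments: the conditional probability [p] of being true at the next
    assignment obeys [p' = A (p_1, ..., p_k)], where [A] is the multiaffine extension of
    [alpha] and the [p_j] are independent copies of [p]. The mean of [p] remains [s], and
    its variance [v] obeys [v' <= v (L + (1 - L) v / (s (1 - s)))], where [L < 1] is the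
    sum of the squares of the influences. Hence either an assignment is determined by
    the earlier ones at all levels, or [p] tends to [s]; convergence follows. For the
    rate, choose about [n ^ 2] assignments of weight [w]: fixed ones and zeros, plus an
    edge of a bipartite graph. At level 1 the function can be the indicator of any given
    edge, so [s (1 - s) - v] is at least of order [n ^ -2] and [v] becomes small after
    [O (log n)] steps; from then on [p - s] is subexponential with a parameter growing
    geometrically. Thus [p] is bounded away from 0 and 1 except with probability
    [2 ^ (- 12 n)], and the probability of any given function, hence also its limit, is
    much less than [2 ^ -n]. The finitely many remaining [n] are absorbed in the
    constant. *)
Require Import Defs.
From HB Require Import structures.
From mathcomp Require Import all_boot all_order all_algebra.
From mathcomp Require Import all_classical all_reals all_analysis.
From mathcomp Require Import ring lra zify.

Import Order.TTheory GRing.Theory Num.Theory.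
Import numFieldNormedType.Exports.

Local Open Scope ring_scope.

Set Implicit Arguments.
Unset Strict Implicit.
Unset Printing Implicit Defensive.

(** * Multiaffine extensions and influences *)

(** The coefficient [k * 2 ^ k] is a budget shared by two regimes. At rate [1 + 1 / N] with
    [N = 3 * 2 ^ (k - 2)], a quantity doubles within [N] steps. Off the fixpoint, the distance to
    [s] must gain a factor of order [n ^ k]; this costs [N * k] steps per unit of [log n], three
    quarters of the budget, and the last quarter pays for the [log n] squarings near 0 or 1. At the
    fixpoint, the deficit of the variance must grow by a factor of order [n ^ 2], then the
    subexponential parameter by a factor of order [n]; this costs [3 * N] steps per unit, within the
    budget because [k >= 3]. The gap proved for the influences is [3 / 2 * 2 ^ -k], whereas the
    count only uses [4 / 3 * 2 ^ -k]: the difference is the room for second-order errors. No Fourier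
    basis is built. Second moments are polynomials in the variance of one argument, defined by
    recursion on the arity ([sq]); the coefficients of these polynomials play the role of the
    weights by degree. *)

Section Multiaffine.
Context {R : realType}.
Implicit Types (f g : seq bool -> R) (p : R) (ps : seq R) (l : seq bool).

Definition mix p f l : R := p * f (true :: l) + (1 - p) * f (false :: l).

Definition diff f l : R := f (true :: l) - f (false :: l).

(** Functions on lists leave the arity implicit: fixing or averaging the first argument stays in the
    same type, so that most statements below go by induction on the number of arguments. *)
Fixpoint ext f ps : R := if ps is p :: ps' then ext (mix p f) ps' else f [::].

Lemma eq_ext f g ps : f =1 g -> ext f ps = ext g ps.
Proof.
by elim: ps f g => [|p ps IH] f g fg /=; [rewrite fg|apply: IH => l; rewrite /mix !fg].
Qed.

Lemma ext_lin (c d : R) f g ps :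
  ext (fun l => c * f l + d * g l) ps = c * ext f ps + d * ext g ps.
Proof.
elim: ps f g => [//|p ps IH] f g /=; rewrite -IH.
by apply: eq_ext => l; rewrite /mix; ring.
Qed.

Lemma ext_cons f p ps :
  ext f (p :: ps) = p * ext (fun l => f (true :: l)) ps
                    + (1 - p) * ext (fun l => f (false :: l)) ps.
Proof. exact: ext_lin. Qed.

(** One step of the Fourier expansion at bias [s]: [mix s f] collects the terms without the first
    coordinate, and [diff f] is the coefficient of its centred part. *)
Lemma ext_cons_diff s f p ps :
  ext f (p :: ps) = ext (mix s f) ps + (p - s) * ext (diff f) ps.
Proof.
rewrite -[ext (mix s f) ps]mul1r -ext_lin /=; apply: eq_ext => l.
by rewrite /mix /diff; ring.
Qed.

Lemma diffE f ps : ext (diff f) ps =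
  ext (fun l => f (true :: l)) ps - ext (fun l => f (false :: l)) ps.
Proof.
rewrite -[X in X - _]mul1r -mulN1r -ext_lin; apply: eq_ext => l; rewrite /diff; ring.
Qed.

Definition in01 p := (0 <= p <= 1).

Lemma mix_homo p f g : in01 p -> (forall l, f l <= g l) -> forall l, mix p f l <= mix p g l.
Proof.
move=> /andP[p0 p1] fg l; rewrite lerD// ler_wpM2l// ?subr_ge0//.
Qed.

Lemma ext_homo f g ps : all in01 ps -> (forall l, f l <= g l) -> ext f ps <= ext g ps.
Proof.
elim: ps f g => [|p ps IH] f g /= ; first by move=> _; apply.
by move=> /andP[p01 ps01] fg; apply: IH => //; apply: mix_homo.
Qed.

Lemma ext_const (c : R) ps : ext (fun=> c) ps = c.
Proof.
elim: ps => //= p ps IH; rewrite -[RHS]IH; apply: eq_ext => l; rewrite /mix; ring.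
Qed.

Lemma ext_le f (c : R) ps : all in01 ps -> (forall l, f l <= c) -> ext f ps <= c.
Proof. by move=> h fc; rewrite -[leRHS](ext_const c ps); apply: ext_homo. Qed.

Lemma ext_ge f (c : R) ps : all in01 ps -> (forall l, c <= f l) -> c <= ext f ps.
Proof. by move=> h fc; rewrite -[leLHS](ext_const c ps); apply: ext_homo. Qed.

(** Lists are compared as if padded with [false], the default that [connective] uses too, so that
    lists of any lengths are comparable. *)
Definition mono f :=
  forall l l', (forall i, nth false l i -> nth false l' i) -> f l <= f l'.

Lemma mono_cons b f : mono f -> mono (fun l => f (b :: l)).
Proof. by move=> fm l l' ll'; apply: fm => -[|i] //=; apply: ll'. Qed.

Lemma mono_diff f : mono f -> forall l, 0 <= diff f l.
Proof. by move=> fm l; rewrite subr_ge0; apply: fm => -[|i]. Qed.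

Lemma mono_mix p f : in01 p -> mono f -> mono (mix p f).
Proof.
move=> /andP[p0 p1] fm l l' ll'; rewrite lerD// ler_wpM2l ?subr_ge0//; exact: mono_cons.
Qed.

Lemma mix01 p f : in01 p -> (forall l, in01 (f l)) -> forall l, in01 (mix p f l).
Proof.
move=> p01 f01 l; rewrite /in01.
have := mix_homo p01 (fun l => (andP (f01 l)).1) l.
have := mix_homo p01 (fun l => (andP (f01 l)).2) l.
by rewrite /mix => h1 h2; apply/andP; split; lra.
Qed.

Definition boolean f := forall l, f l = 0 \/ f l = 1.

Lemma boolean01 f : boolean f -> forall l, in01 (f l).
Proof. by move=> fb l; rewrite /in01; case: (fb l) => ->; rewrite !lexx ler01. Qed.

Lemma boolean_diff f : boolean f -> mono f -> boolean (diff f).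
Proof.
move=> fb /mono_diff/[swap] l /(_ l); rewrite /diff.
by case: (fb (true :: l)) => ->; case: (fb (false :: l)) => ->; rewrite ?subrr ?subr0; lra.
Qed.

(* [sq s V k f] is the second moment of [ext f] at [k] independent arguments of
   mean [s] and variance [V]. *)
Fixpoint sq (s V : R) k f : R :=
  if k is k'.+1 then sq s V k' (mix s f) + V * sq s V k' (diff f) else f [::] ^+ 2.

(* Mean and second moment, at bias [s], of the difference of [f] along coordinate [j];
   they agree when [f] is Boolean and monotone. *)
Fixpoint infl (s : R) k j f : R :=
  match k, j with
  | 0, _ => 0
  | k'.+1, 0 => ext (diff f) (nseq k' s)
  | k'.+1, j'.+1 => infl s k' j' (mix s f)
  end.

Fixpoint infl2 (s : R) k j f : R :=
  match k, j with
  | 0, _ => 0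
  | k'.+1, 0 => sq s (s * (1 - s)) k' (diff f)
  | k'.+1, j'.+1 => infl2 s k' j' (mix s f) + s * (1 - s) * infl2 s k' j' (diff f)
  end.

(** [s * (1 - s) * infl_sq s k f] is the Fourier weight of [f] in degree one at bias [s]. *)
Definition infl_sq s k f : R := \sum_(j < k) infl s k j f ^+ 2.

(** By Russo's formula, the derivative at [s] of the function sending [p] to [ext f (nseq k p)];
    [ext_expansion] is the quantitative form. *)
Definition infl_sum s k f : R := \sum_(j < k) infl s k j f.

Lemma infl_sqS s k f :
  infl_sq s k.+1 f = ext (diff f) (nseq k s) ^+ 2 + infl_sq s k (mix s f).
Proof. by rewrite /infl_sq big_ord_recl. Qed.

Lemma infl_sumS s k f :
  infl_sum s k.+1 f = ext (diff f) (nseq k s) + infl_sum s k (mix s f).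
Proof. by rewrite /infl_sum big_ord_recl. Qed.

Lemma infl_sq_ge0 s k f : 0 <= infl_sq s k f.
Proof. by apply: sumr_ge0 => j _; apply: sqr_ge0. Qed.

Lemma eq_sq s V k f g : f =1 g -> sq s V k f = sq s V k g.
Proof.
elim: k f g => [|k IH] f g fg /=; first by rewrite fg.
by congr (_ + _ * _); apply: IH => l; rewrite /mix /diff !fg.
Qed.

(** [sq] is a quadratic form. The cross term [b] stays existential because only its cancellation
    matters, when [d] is averaged with mean zero. *)
Lemma sq_quad s V k f g : exists b, forall d,
  sq s V k (fun l => f l + d * g l) = sq s V k f + d * b + d ^+ 2 * sq s V k g.
Proof.
elim: k f g => [|k IH] f g /=; first by exists (2 * f [::] * g [::]) => d; ring.
have [b hb] := IH (mix s f) (mix s g); have [c hc] := IH (diff f) (diff g).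
exists (b + V * c) => d.
rewrite (@eq_sq _ _ _ (mix s (fun l => f l + d * g l)) (fun l => mix s f l + d * mix s g l));
    last first.
  by move=> l; rewrite /mix; ring.
rewrite (@eq_sq _ _ _ (diff (fun l => f l + d * g l)) (fun l => diff f l + d * diff g l)); last
    first.
  by move=> l; rewrite /diff; ring.
by rewrite hb hc; ring.
Qed.

Lemma eq_infl2 s k j f g : f =1 g -> infl2 s k j f = infl2 s k j g.
Proof.
elim: k j f g => [|k IH] [|j] f g fg //=.
  by apply: eq_sq => l; rewrite /diff !fg.
by congr (_ + _ * _); apply: IH => l; rewrite /mix /diff !fg.
Qed.

Lemma infl2_quad s k j f g : exists b, forall d,
  infl2 s k j (fun l => f l + d * g l) = infl2 s k j f + d * b + d ^+ 2 * infl2 s k j g.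
Proof.
elim: k j f g => [|k IH] j f g /=; first by exists 0 => d; ring.
case: j => [|j].
  have [b hb] := sq_quad s (s * (1 - s)) k (diff f) (diff g).
  by exists b => d; rewrite -hb; apply: eq_sq => l; rewrite /diff; ring.
have [b hb] := IH j (mix s f) (mix s g); have [c hc] := IH j (diff f) (diff g).
exists (b + s * (1 - s) * c) => d.
rewrite (@eq_infl2 _ _ _ (mix s (fun l => f l + d * g l)) (fun l => mix s f l + d * mix s g l));
    last first.
  by move=> l; rewrite /mix; ring.
rewrite (@eq_infl2 _ _ _ (diff (fun l => f l + d * g l)) (fun l => diff f l + d * diff g l));
    last first.
  by move=> l; rewrite /diff; ring.
by rewrite hb hc; ring.
Qed.

(** [1 - s] and [- s] are the values of a centred Bernoulli variable of bias [s]: averaging over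
    them cancels the cross term of [sq_quad] and leaves the variance [V]. *)
Lemma sq_cons s k f : let V := s * (1 - s) in
  sq s V k.+1 f = s * sq s V k (fun l => f (true :: l))
                  + (1 - s) * sq s V k (fun l => f (false :: l)).
Proof.
move=> V /=; have [b hb] := sq_quad s V k (mix s f) (diff f).
rewrite (@eq_sq _ _ _ (fun l => f (true :: l)) (fun l => mix s f l + (1 - s) * diff f l)); last
    first.
  by move=> l; rewrite /mix /diff; ring.
rewrite (@eq_sq _ _ _ (fun l => f (false :: l)) (fun l => mix s f l + - s * diff f l)); last first.
  by move=> l; rewrite /mix /diff; ring.
by rewrite !hb /V; ring.
Qed.

Lemma infl2_cons s k j f :
  infl2 s k.+1 j.+1 f = s * infl2 s k j (fun l => f (true :: l))
                  + (1 - s) * infl2 s k j (fun l => f (false :: l)).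
Proof.
move=> /=; have [b hb] := infl2_quad s k j (mix s f) (diff f).
rewrite (@eq_infl2 _ _ _ (fun l => f (true :: l)) (fun l => mix s f l + (1 - s) * diff f l));
    last first.
  by move=> l; rewrite /mix /diff; ring.
rewrite (@eq_infl2 _ _ _ (fun l => f (false :: l)) (fun l => mix s f l + - s * diff f l)); last
    first.
  by move=> l; rewrite /mix /diff; ring.
by rewrite !hb; ring.
Qed.

Lemma eq_infl s k j f g : f =1 g -> infl s k j f = infl s k j g.
Proof.
elim: k j f g => [|k IH] [|j] f g fg //=.
  by apply: eq_ext => l; rewrite /diff !fg.
by apply: IH => l; rewrite /mix !fg.
Qed.

Lemma infl_lin s k j (c d : R) f g :
  infl s k j (fun l => c * f l + d * g l) = c * infl s k j f + d * infl s k j g.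
Proof.
elim: k j f g => [|k IH] j f g /=; first by ring.
case: j => [|j]; first by rewrite -ext_lin; apply: eq_ext => l; rewrite /diff; ring.
by rewrite -IH; apply: eq_infl => l; rewrite /mix; ring.
Qed.

Lemma infl_cons s k j f :
  infl s k.+1 j.+1 f = s * infl s k j (fun l => f (true :: l))
                  + (1 - s) * infl s k j (fun l => f (false :: l)).
Proof. by rewrite -infl_lin. Qed.

(** With variance [s * (1 - s)] the arguments may be taken to be Bernoulli variables, and a Boolean
    function equals its square. *)
Lemma sq_boolean s k f : boolean f -> sq s (s * (1 - s)) k f = ext f (nseq k s).
Proof.
elim: k f => [|k IH] f fb.
  by rewrite /=; case: (fb [::]) => ->; rewrite ?expr0n ?expr1n.
by rewrite sq_cons !IH ?[nseq _ _]/= ?ext_cons// => l; apply: fb.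
Qed.

Lemma infl2_boolean s k j f : boolean f -> mono f -> infl2 s k j f = infl s k j f.
Proof.
elim: k j f => [//|k IH] [|j] f fb fm.
  by rewrite /= sq_boolean//; apply: boolean_diff.
rewrite infl2_cons infl_cons !IH//; try exact: mono_cons.
all: by move=> l; apply: fb.
Qed.

(** * Fourier weights at a fixed bias *)

Section Biased.
Variable s : R.
Hypothesis s01 : 0 < s < 1.
Let V := s * (1 - s).

Lemma variance_gt0 : 0 < V.
Proof. by move: s01 => /andP[? ?]; rewrite mulr_gt0 ?subr_gt0. Qed.

(** As a polynomial in [W], the second moment has nonnegative coefficients; the left side keeps
    those of degrees zero and one. *)
Lemma sq_ge W k f : 0 <= W -> ext f (nseq k s) ^+ 2 + W * infl_sq s k f <= sq s W k f.
Proof.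
move=> W0; elim: k f => [|k IH] f.
  by rewrite /infl_sq big_ord0 mulr0 addr0.
rewrite infl_sqS /=.
have h1 := IH (mix s f); have h2 := IH (diff f); have h3 := infl_sq_ge0 s k (diff f).
nra.
Qed.

(** Dividing the variance of the arguments by [1 / c] multiplies the weight in degree [d] by
    [c ^ d], which is at most [c ^ 2] from degree two on. The last bracket is the total weight in
    those degrees. *)
Lemma sq_interp c k f : 0 <= c <= 1 ->
  sq s (c * V) k f <= ext f (nseq k s) ^+ 2 + c * V * infl_sq s k f
     + c ^+ 2 * (sq s V k f - ext f (nseq k s) ^+ 2 - V * infl_sq s k f).
Proof.
move=> /andP[c0 c1]; have V0 := variance_gt0.
elim: k f => [|k IH] f; first by rewrite /infl_sq big_ord0 /=; lra.
rewrite infl_sqS /=.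
have h1 := IH (mix s f); have h2 := IH (diff f).
have h3 := sq_ge k (diff f) (ltW V0).
move: (ext (diff f) _) (sq s V k (diff f)) (infl_sq s k (diff f)) h1 h2 h3
  => a q L h1 h2 h3.
have h4 : sq s (c * V) k (diff f) <= a ^+ 2 + c * (q - a ^+ 2).
    have : 0 <= c * (1 - c) * (q - a ^+ 2 - V * L).
      by rewrite !mulr_ge0 ?subr_ge0//; lra.
    by lra.
have h5 : c * V * sq s (c * V) k (diff f) <= c * V * (a ^+ 2 + c * (q - a ^+ 2)).
  by rewrite ler_wpM2l// mulr_ge0// ltW.
lra.
Qed.

Lemma infl2_ge0 k j f : 0 <= infl2 s k j f.
Proof.
have V0 := ltW variance_gt0.
elim: k j f => [//|k IH] [|j] f /=; last by rewrite addr_ge0// mulr_ge0.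
apply: le_trans (sq_ge k (diff f) V0).
by rewrite addr_ge0 ?sqr_ge0// mulr_ge0// infl_sq_ge0.
Qed.

(** [V * infl2 s k j f] is the Fourier weight of the sets that contain [j]; the square of the mean
    is that of the empty set. *)
Lemma sq_ge_infl2 k j f : ext f (nseq k s) ^+ 2 + V * infl2 s k j f <= sq s V k f.
Proof.
have V0 := variance_gt0.
elim: k j f => [|k IH] j f; first by rewrite /= mulr0 addr0.
case: j => [|j] /=.
  rewrite -/V lerD2r; have := sq_ge k (mix s f) (ltW V0).
  by have := infl_sq_ge0 s k (mix s f); nra.
rewrite -/V; have h1 := IH j (mix s f); have h2 := IH j (diff f).
by have := sqr_ge0 (ext (diff f) (nseq k s)); nra.
Qed.

(** The sets containing [j] and the singletons have only [{j}] in common; subtracting the square of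
    its influence avoids counting it twice. *)
Lemma sq_ge_infl_sq k j f : (j < k)%N ->
  V * (infl_sq s k f - infl s k j f ^+ 2 + infl2 s k j f)
    <= sq s V k f - ext f (nseq k s) ^+ 2.
Proof.
have V0 := variance_gt0.
elim: k j f => [//|k IH] [|j] f jk; rewrite infl_sqS /= -/V.
  by have := sq_ge k (mix s f) (ltW V0); nra.
by have h1 := IH j (mix s f) jk; have h2 := sq_ge_infl2 k j (diff f); nra.
Qed.

(** The sum on the right counts the weight of each set as often as the set has elements: at least
    twice beyond the singletons, which the subtracted term corrects. *)
Lemma infl2_sum_ge k f :
  2 * (sq s V k f - ext f (nseq k s) ^+ 2) - V * infl_sq s k f
    <= V * \sum_(j < k) infl2 s k j f.
Proof.
have V0 := variance_gt0.
(* Poincare's inequality: each nonempty set is counted at least once. *)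
have poincare m g : sq s V m g - ext g (nseq m s) ^+ 2 <= V * \sum_(j < m) infl2 s m j g.
  elim: m g => [|m IH] g; first by rewrite big_ord0 /=; lra.
  rewrite big_ord_recl /= -/V big_split /= mulrDr.
  have : 0 <= V * \sum_(i < m) V * infl2 s m i (diff g).
    apply: mulr_ge0 (ltW V0) _; apply: sumr_ge0 => i _.
    by rewrite mulr_ge0 ?infl2_ge0// ltW.
  by have := IH (mix s g); lra.
elim: k f => [|k IH] f; first by rewrite /infl_sq !big_ord0 /=; lra.
rewrite infl_sqS big_ord_recl /= -/V big_split /= -mulr_sumr.
have h1 := IH (mix s f); have h2 := poincare k (diff f).
move: (\sum_(i < k) infl2 s k i (diff f)) (\sum_(i < k) infl2 s k i (mix s f)) h1 h2 => a b h1 h2.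
have : V * (sq s V k (diff f) - ext (diff f) (nseq k s) ^+ 2) <= V * (V * a).
  by rewrite ler_pM2l.
lra.
Qed.

End Biased.
End Multiaffine.

(** The inequality [3 / 2 * 2 ^ -k <= k^-1 * (1 - k^-1)] with denominators cleared. *)
Lemma three_sq_le k : (2 < k)%N -> (3 * k ^ 2 <= 2 * (k - 1) * 2 ^ k)%N.
Proof.
move=> k3; have [m ->] : exists m, k = m.+3 by exists (k - 3)%N; lia.
elim: m {k3} => [//|m]; rewrite !subn1 /= [(2 ^ m.+4)%N]expnS.
move: (2 ^ _)%N => P; rewrite -!mulnn => IH.
have : (m.+2 * P <= m.+3 * P)%N by rewrite leq_mul2r leqnSn orbT.
nia.
Qed.

(** * Gaps for the influences of a Boolean monotone function *)

Section Influences.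
Context {R : realType}.
Variable s : R.
Hypothesis s01 : 0 < s < 1.
Implicit Types (f g : seq bool -> R) (l : seq bool).

Lemma all_in01_nseq k (p : R) : in01 p -> all in01 (nseq k p).
Proof. by move=> p01; rewrite all_nseq p01 orbT. Qed.

Let s_in01 : in01 s.
Proof. by move: s01 => /andP[/ltW s0 /ltW s1]; rewrite /in01 s0. Qed.

Lemma mono_infl_ge0 k j f : mono f -> 0 <= infl s k j f.
Proof.
elim: k j f => [//|k IH] [|j] f fm /=; last exact/IH/mono_mix.
by apply: ext_ge (mono_diff fm); apply: all_in01_nseq.
Qed.

Lemma infl_le1 k j f : (forall l, in01 (f l)) -> infl s k j f <= 1.
Proof.
elim: k j f => [//|k IH] [|j] f f01 /=; last exact/IH/mix01.
apply: ext_le; first exact: all_in01_nseq.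
by move=> l; rewrite /diff; have := f01 (true :: l); have := f01 (false :: l); rewrite /in01; lra.
Qed.

(** The constant assignment [b] alone has mass [s ^ k] or [(1 - s) ^ k], and contributes nothing
    positive. *)
Lemma ext_nseq_le b k f : (forall l, f l <= 1) -> f (nseq k b) <= 0 ->
  ext f (nseq k s) <= 1 - (if b then s else 1 - s) ^+ k.
Proof.
move: (s01) => /andP[s0 s1].
elim: k f => [|k IH] f f1 fk; first by rewrite /= expr0; lra.
rewrite [nseq k.+1 s]/= ext_cons exprS.
have hk := IH _ (fun l => f1 (b :: l)) fk.
have h c := @ext_le R (fun l => f (c :: l)) 1 _ (all_in01_nseq k s_in01) (fun l => f1 (c :: l)).
by case: b hk {fk IH} => hk; [have := h false|have := h true];
  move: (ext _ _) (ext _ _) (_ ^+ _) hk => x y z hk h1; nra.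
Qed.

Lemma mono_nth0 f l l' : mono f -> (forall i, nth false l i = nth false l' i) -> f l = f l'.
Proof. by move=> fm ll'; apply/eqP; rewrite eq_le !fm// => i; rewrite ll'. Qed.

(** Since [f] is still false when only coordinate [j] is true, [j] is not pivotal when all the
    others are false, an event of probability [(1 - s) ^ k.-1]. [infl_le_atom1] is the dual case. *)
Lemma infl_le_atom0 k j f : boolean f -> mono f -> (j < k)%N ->
  f (rcons (nseq j false) true) = 0 -> infl s k j f <= 1 - (1 - s) ^+ k.-1.
Proof.
elim: k j f => [//|k IH] [|j] f fb fm jk fj.
  apply: (@ext_nseq_le false); first by move=> l; case: (boolean_diff fb fm l) => ->.
  rewrite /diff (@mono_nth0 f (true :: nseq k false) [:: true])//; last first.
    by case=> [|i] //=; rewrite nth_nseq nth_nil if_same.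
  by rewrite [f [:: true]]fj sub0r oppr_le0; case: (fb (false :: nseq k false)) => ->.
rewrite infl_cons; case: k IH jk => [//|k] IH jk.
have h0 := IH j (fun l => f (false :: l)) (fun l => fb _) (mono_cons false fm) jk fj.
have h1 := @infl_le1 k.+1 j (fun l => f (true :: l)) (fun l => boolean01 fb _).
move: (s01) => /andP[s0 s1]; rewrite [k.+2.-1]/= exprS; rewrite [k.+1.-1]/= in h0.
move: (infl _ _ _ _) (infl _ _ _ _) (_ ^+ _) h0 h1 => x y z h0 h1; nra.
Qed.

Lemma infl_le_atom1 k j f : boolean f -> mono f -> (j < k)%N ->
  f (nseq j true ++ false :: nseq (k - j.+1) true) = 1 ->
  infl s k j f <= 1 - s ^+ k.-1.
Proof.
elim: k j f => [//|k IH] [|j] f fb fm jk fj.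
  apply: (@ext_nseq_le true); first by move=> l; case: (boolean_diff fb fm l) => ->.
  move: fj; rewrite /diff subSS subn0 => /= ->.
  by rewrite subr_le0; case: (fb (true :: nseq k true)) => ->.
rewrite infl_cons; case: k IH jk fj => [//|k] IH jk fj.
have h0 := IH j (fun l => f (true :: l)) (fun l => fb _) (mono_cons true fm) jk fj.
have h1 := @infl_le1 k.+1 j (fun l => f (false :: l)) (fun l => boolean01 fb _).
move: (s01) => /andP[s0 s1]; rewrite [k.+2.-1]/= exprS; rewrite [k.+1.-1]/= in h0.
move: (infl _ _ _ _) (infl _ _ _ _) (_ ^+ _) h0 h1 => x y z h0 h1; nra.
Qed.

Section Gap.
Variables (k : nat) (f : seq bool -> R).
Hypothesis k3 : (2 < k)%N.
Hypothesis fb : boolean f.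
Hypothesis fm : mono f.
Hypothesis fs : ext f (nseq k s) = s.
Hypothesis f0 : forall j, (j < k)%N -> f (rcons (nseq j false) true) = 0.
Hypothesis f1 : forall j, (j < k)%N -> f (nseq j true ++ false :: nseq (k - j.+1) true) = 1.

Let h : R := 2^-1 ^+ k.

Let h8 : 0 < h <= 8^-1.
Proof.
rewrite exprn_gt0//=; apply: (@le_trans _ _ (2^-1 ^+ 3)); last by rewrite exprS expr2; lra.
by apply: ler_wiXn2l => //; lra.
Qed.

(** One of [s] and [1 - s] is at least one half, so one of the two excluded atoms has mass at least
    [2^-1 ^ k.-1]. *)
Lemma infl_le_gap j : (j < k)%N -> infl s k j f <= 1 - 2 * h.
Proof.
move=> jk; have -> : 2 * h = 2^-1 ^+ k.-1.
  by rewrite /h -[in LHS](ltn_predK k3) exprS mulrA divff ?mul1r.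
have [s2|s2] := leP s 2^-1.
  apply: le_trans (infl_le_atom0 fb fm jk (f0 jk)) _.
  by rewrite lerD2l lerN2 lerXn2r ?nnegrE; lra.
apply: le_trans (infl_le_atom1 fb fm jk (f1 jk)) _.
by rewrite lerD2l lerN2 lerXn2r ?nnegrE; lra.
Qed.

Let sq_f : sq s (s * (1 - s)) k f - ext f (nseq k s) ^+ 2 = s * (1 - s).
Proof. by rewrite sq_boolean// fs; ring. Qed.

Lemma infl_sq_le j : (j < k)%N -> infl_sq s k f <= 1 - infl s k j f * (1 - infl s k j f).
Proof.
move=> jk; have := sq_ge_infl_sq s01 f jk; rewrite sq_f infl2_boolean//.
have V0 := variance_gt0 s01; rewrite -[leRHS]mulr1 ler_pM2l//; lra.
Qed.

Lemma infl_sum_ge : 2 - infl_sq s k f <= infl_sum s k f.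
Proof.
have := infl2_sum_ge s01 k f; rewrite sq_f.
rewrite (eq_bigr (fun j : 'I_k => infl s k j f)); last by move=> j _; rewrite infl2_boolean.
have V0 := variance_gt0 s01; rewrite -/(infl_sum s k f).
have -> : 2 * (s * (1 - s)) - s * (1 - s) * infl_sq s k f
  = s * (1 - s) * (2 - infl_sq s k f) by ring.
by rewrite ler_pM2l.
Qed.

(** Some influence [I] is neither small nor close to 1, and [infl_sq_le] turns [I * (1 - I)] into a
    gap. *)
Lemma infl_sq_gap : infl_sq s k f <= 1 - 3 / 2 * h.
Proof.
have k0 : 0 < k%:R :> R by rewrite ltr0n; apply: ltn_trans k3.
have G1 : 1 <= infl_sum s k f.
  have /andP[/ltW _ _] := h8; have := infl_sum_ge; have jk : (0 < k)%N := ltnW (ltnW k3).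
  have := infl_sq_le jk; have := mono_infl_ge0 k 0 fm.
  by have := @infl_le1 k 0 f (boolean01 fb); nra.
have [j jk Ij] : exists2 j, (j < k)%N & k%:R^-1 <= infl s k j f.
  apply: contrapT => hn; move: G1; apply/negP; rewrite -ltNge.
  have -> : (1 : R) = \sum_(j < k) k%:R^-1.
    by rewrite sumr_const card_ord -(mulr_natl k%:R^-1) divff ?gt_eqF.
  have : (0 < k)%N := ltnW (ltnW k3).
  case: (k) hn => [//|m] hn _; apply: ltr_sum; first by apply/hasP; exists ord0.
  by move=> j _; rewrite ltNge; apply/negP => hj; apply: hn; exists j.
apply: le_trans (infl_sq_le jk) _; rewrite lerD2l lerN2.
have Ih := infl_le_gap jk; move: (infl s k j f) Ij Ih => I Ij Ih.
(* [I * (1 - I)] is at least the smaller of its values at [k^-1] and [1 - 2 * h]. The second is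
   [2 * h * (1 - 2 * h)], at least [3 / 2 * h] because [h <= 8^-1]: hence the constant. *)
have [I2|I2] := leP I 2^-1; last first.
  by have := h8; nra.
have k3' : 3 <= k%:R :> R by rewrite (ler_nat _ 3).
have hk : 3 / 2 * h <= k%:R^-1 * (1 - k%:R^-1).
  have -> : k%:R^-1 * (1 - k%:R^-1) = (k%:R - 1) / k%:R ^+ 2 :> R by field; rewrite gt_eqF.
  rewrite ler_pdivlMr ?exprn_gt0// /h exprVn.
  rewrite mulrAC ler_pdivrMr ?exprn_gt0//.
  have h2 := three_sq_le k3.
  have : ((3 * k ^ 2)%:R <= (2 * (k - 1) * 2 ^ k)%:R :> R) by rewrite ler_nat.
  by rewrite !natrM !natrX natrB; [lra|exact: ltnW (ltnW k3)].
have ik : k%:R^-1 <= 3^-1 :> R by rewrite lef_pV2// ?posrE; lra.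
nra.
Qed.

Lemma infl_sum_gap : 1 + 3 / 2 * h <= infl_sum s k f.
Proof. by have := infl_sum_ge; have := infl_sq_gap; lra. Qed.

End Gap.
End Influences.

(** * Estimates for multiaffine extensions *)

Section Estimates.
Context {R : realType}.
Variable s : R.
Hypothesis s01 : 0 < s < 1.
Implicit Types (f g : seq bool -> R) (l : seq bool) (p : R) (ps : seq R).

Let s_in01 : in01 s.
Proof. by move: s01 => /andP[/ltW s0 /ltW s1]; rewrite /in01 s0. Qed.

(** The left side is the mean of [f] with coordinate [j] set to [true]. In [ext_infl_ge0] it is set
    to [false]. *)
Lemma ext_infl_le1 k j f : (forall l, f l <= 1) ->
  ext f (nseq k s) + (1 - s) * infl s k j f <= 1.
Proof.
move: (s01) => /andP[s0 s1]; have h g m := @ext_le R g 1 _ (all_in01_nseq m s_in01).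
elim: k j f => [|k IH] j f f1; first by rewrite mulr0 addr0 h.
case: j => [|j] /=.
  rewrite diffE -[ext (mix s f) _]/(ext f (s :: nseq k s)) ext_cons.
  by have := h _ k (fun l => f1 (true :: l)); lra.
by apply: IH => l; rewrite /mix; have := f1 (true :: l); have := f1 (false :: l); nra.
Qed.

Lemma ext_infl_ge0 k j f : (forall l, 0 <= f l) ->
  0 <= ext f (nseq k s) - s * infl s k j f.
Proof.
move: (s01) => /andP[s0 s1]; have h g m := @ext_ge R g 0 _ (all_in01_nseq m s_in01).
elim: k j f => [|k IH] j f f0; first by rewrite mulr0 subr0 h.
case: j => [|j] /=.
  rewrite diffE -[ext (mix s f) _]/(ext f (s :: nseq k s)) ext_cons.
  by have := h _ k (fun l => f0 (false :: l)); lra.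
by apply: IH => l; rewrite /mix; have := f0 (true :: l); have := f0 (false :: l); nra.
Qed.

(* Moving a coordinate from [s] to [p >= s] amounts to setting it to [true] with
   probability [(p - s) / (1 - s)]; a set of [i] coordinates set to [true] raises
   the mean by at most [min (i * r) (2 * r)]. *)
Lemma ext_upper f ps u r : mono f -> (forall l, f l <= 1) -> all in01 ps -> 0 <= r ->
  ext f (nseq (size ps) s) <= u ->
  (forall j, (j < size ps)%N ->
     ext f (nseq (size ps) s) + (1 - s) * infl s (size ps) j f <= u + r) ->
  1 <= u + 2 * r ->
  ext f ps <= u + r / (1 - s) * \sum_(p <- ps) `|p - s|.
Proof.
move: (s01) => /andP[s0 s1]; have s1' : 0 < 1 - s by rewrite subr_gt0.
move=> fm f1 + r0; elim: ps f u fm f1 => [|p ps IH] f u fm f1 /=.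
  by move=> _ fu _ _; rewrite big_nil mulr0 addr0.
move=> /andP[p01 ps01] hu hj hr; rewrite big_cons mulrDr.
have fm' := mono_mix s_in01 fm.
have f1' l : mix s f l <= 1.
  by rewrite /mix; have := f1 (true :: l); have := f1 (false :: l); nra.
have IH1 := IH (mix s f) u fm' f1' ps01 hu (fun j => hj j.+1) hr.
have S0 : 0 <= r / (1 - s) * \sum_(q <- ps) `|q - s|.
  by rewrite mulr_ge0 ?divr_ge0 ?sumr_ge0// ltW.
have [ps'|ps'] := leP p s.
  have : ext (mix p f) ps <= ext (mix s f) ps.
    by apply: ext_homo => // l; have := mono_diff fm l; rewrite /diff /mix; nra.
  have : 0 <= r / (1 - s) * `|p - s| by rewrite mulr_ge0 ?divr_ge0// ltW.
  lra.
(* With the first argument [true], the allowance [u] becomes [u + r]; the condition on single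
   coordinates is then automatic, because [1 <= u + 2 * r]. *)
have IH2 : ext (fun l => f (true :: l)) ps
    <= u + r + r / (1 - s) * \sum_(q <- ps) `|q - s|.
  apply: IH => //; first exact: mono_cons.
  - have := hj 0%N isT; rewrite /= diffE.
    by rewrite -[ext (mix s f) _]/(ext f (s :: nseq (size ps) s)) ext_cons; lra.
  - move=> j jk; apply: (@le_trans _ _ 1); last lra.
    by apply: ext_infl_le1 => l; apply: f1.
  - lra.
rewrite ger0_norm ?subr_ge0; last exact: ltW.
set t := (p - s) / (1 - s).
have t0 : 0 <= t by rewrite divr_ge0 ?subr_ge0// ltW.
have t1 : t <= 1 by rewrite ler_pdivrMr// mul1r lerD2r; case/andP: p01.
have -> : r / (1 - s) * (p - s) = r * t by rewrite /t; ring.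
have -> : ext (mix p f) ps = (1 - t) * ext (mix s f) ps + t * ext (fun l => f (true :: l)) ps.
  rewrite -ext_lin; apply: eq_ext => l; rewrite /mix /t; field; lra.
move: IH1 IH2; move: (ext _ _) (ext _ _) (_ / _ * _) => x y z h1 h2; nra.
Qed.

Lemma ext_lower f ps u r : mono f -> (forall l, 0 <= f l) -> all in01 ps -> 0 <= r ->
  u <= ext f (nseq (size ps) s) ->
  (forall j, (j < size ps)%N ->
     u - r <= ext f (nseq (size ps) s) - s * infl s (size ps) j f) ->
  u - 2 * r <= 0 ->
  u - r / s * \sum_(p <- ps) `|p - s| <= ext f ps.
Proof.
move: (s01) => /andP[s0 s1].
move=> fm f1 + r0; elim: ps f u fm f1 => [|p ps IH] f u fm f1 /=.
  by move=> _ fu _ _; rewrite big_nil mulr0 subr0.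
move=> /andP[p01 ps01] hu hj hr; rewrite big_cons mulrDr.
have fm' := mono_mix s_in01 fm.
have f1' l : 0 <= mix s f l.
  by rewrite /mix; have := f1 (true :: l); have := f1 (false :: l); nra.
have IH1 := IH (mix s f) u fm' f1' ps01 hu (fun j => hj j.+1) hr.
have S0 : 0 <= r / s * \sum_(q <- ps) `|q - s|.
  by rewrite mulr_ge0 ?divr_ge0 ?sumr_ge0// ltW.
have [ps'|ps'] := leP s p.
  have : ext (mix s f) ps <= ext (mix p f) ps.
    by apply: ext_homo => // l; have := mono_diff fm l; rewrite /diff /mix; nra.
  have : 0 <= r / s * `|p - s| by rewrite mulr_ge0 ?divr_ge0// ltW.
  lra.
have IH2 : u - r - r / s * \sum_(q <- ps) `|q - s| <= ext (fun l => f (false :: l)) ps.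
  apply: IH => //; first exact: mono_cons.
  - have := hj 0%N isT; rewrite /= diffE.
    by rewrite -[ext (mix s f) _]/(ext f (s :: nseq (size ps) s)) ext_cons; lra.
  - move=> j jk; apply: (@le_trans _ _ 0); first lra.
    by apply: ext_infl_ge0 => l; apply: f1.
  - lra.
rewrite ler0_norm ?subr_le0; last exact: ltW.
set t := (s - p) / s.
have t0 : 0 <= t by rewrite divr_ge0 ?subr_ge0// ltW.
have t1 : t <= 1 by rewrite ler_pdivrMr// mul1r gerBl; case/andP: p01.
have -> : r / s * - (p - s) = r * t by rewrite /t; ring.
have -> : ext (mix p f) ps = (1 - t) * ext (mix s f) ps + t * ext (fun l => f (false :: l)) ps.
  rewrite -ext_lin; apply: eq_ext => l; rewrite /mix /t; field; lra.
move: IH1 IH2; move: (ext _ _) (ext _ _) (_ / _ * _) => x y z h1 h2; nra.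
Qed.

(** Influences at [s] control small deviations only; this bound holds at any distance, as
    [large_dist_mgf] requires. Forcing one coordinate moves the mean by at most the fraction [rho]
    of the largest possible change, and from two forced coordinates on [1 <= 2 * rho] suffices. *)
Lemma ext_dist_le k f rho ps : mono f -> (forall l, in01 (f l)) -> size ps = k ->
  ext f (nseq k s) = s -> (forall j, (j < k)%N -> infl s k j f <= rho) -> 1 <= 2 * rho ->
  all in01 ps -> `|ext f ps - s| <= rho * \sum_(p <- ps) `|p - s|.
Proof.
move: (s01) => /andP[s0 s1] fm f01 <- fs frho rho2 ps01; rewrite ler_norml; apply/andP; split.
  rewrite lerBrDl -[in leLHS](mulfK (lt0r_neq0 s0) rho).
  apply: ext_lower => //; try by rewrite fs; lra.
  - by move=> l; case/andP: (f01 l).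
  - by nra.
  - by move=> j /frho; rewrite fs; nra.
  - by nra.
have s1' : 1 - s != 0 by rewrite gt_eqF ?subr_gt0.
rewrite lerBlDl -[in leRHS](mulfK s1' rho).
apply: ext_upper => //; try by rewrite fs; lra.
- by move=> l; case/andP: (f01 l).
- by nra.
- by move=> j /frho; rewrite fs; nra.
- by nra.
Qed.

Lemma ext_bounded (M : R) f ps : (forall l, `|f l| <= M) -> all in01 ps -> `|ext f ps| <= M.
Proof.
move=> fM ps01; rewrite ler_norml; apply/andP; split.
  by apply: ext_ge => // l; have := fM l; rewrite ler_norml => /andP[].
by apply: ext_le => // l; have := fM l; rewrite ler_norml => /andP[].
Qed.

Lemma mix_bounded (M : R) p f : in01 p -> (forall l, `|f l| <= M) -> forall l, `|mix p f l| <= M.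
Proof.
move=> /andP[p0 p1] fM l; have := fM (true :: l); have := fM (false :: l).
by rewrite /mix !ler_norml; nra.
Qed.

Lemma diff_bounded (M : R) f : (forall l, `|f l| <= M) -> forall l, `|diff f l| <= 2 * M.
Proof.
move=> fM l; have := fM (true :: l); have := fM (false :: l).
by rewrite /diff !ler_norml; lra.
Qed.

Lemma ext_lipschitz (M : R) k f p : (forall l, `|f l| <= M) -> in01 p ->
  `|ext f (nseq k p) - ext f (nseq k s)| <= 2 * k%:R * M * `|p - s|.
Proof.
move=> fM p01; elim: k f fM => [|k IH] f fM; first by rewrite subrr normr0 !(mulr0, mul0r).
rewrite [nseq k.+1 p]/= (ext_cons_diff s) [nseq k.+1 s]/= /=.
have h1 := IH _ (mix_bounded s_in01 fM).
have h2 := ext_bounded (diff_bounded fM) (all_in01_nseq k p01).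
rewrite addrAC (le_trans (ler_normD _ _))//.
rewrite normrM mulrC -natr1.
have : `|ext (diff f) (nseq k p)| * `|p - s| <= 2 * M * `|p - s| by rewrite ler_wpM2r.
lra.
Qed.

Lemma ext_expansion (M : R) k f p : (forall l, `|f l| <= M) -> in01 p ->
  `|ext f (nseq k p) - ext f (nseq k s) - (p - s) * infl_sum s k f|
    <= 4 * k%:R ^+ 2 * M * `|p - s| ^+ 2.
Proof.
move=> fM p01; have M0 : 0 <= M := le_trans (normr_ge0 _) (fM [::]).
elim: k f fM => [|k IH] f fM.
  by rewrite /infl_sum big_ord0 mulr0 !subr0 subrr normr0 expr0n/= !(mulr0, mul0r).
rewrite [nseq k.+1 p]/= (ext_cons_diff s) [nseq k.+1 s]/= infl_sumS /=.
have h1 := IH _ (mix_bounded s_in01 fM).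
have h2 := ext_lipschitz k (diff_bounded fM) p01.
rewrite (_ : _ - _ = (ext (mix s f) (nseq k p) - ext (mix s f) (nseq k s)
  - (p - s) * infl_sum s k (mix s f))
  + (p - s) * (ext (diff f) (nseq k p) - ext (diff f) (nseq k s))); last by ring.
apply: (le_trans (ler_normD _ _)); rewrite normrM -natr1.
have : `|p - s| * `|ext (diff f) (nseq k p) - ext (diff f) (nseq k s)|
  <= `|p - s| * (2 * k%:R * (2 * M) * `|p - s|) by rewrite ler_wpM2l.
have : 0 <= `|p - s| ^+ 2 * M * (k%:R + 1) by rewrite !mulr_ge0 ?sqr_ge0// addr_ge0.
have : 0 <= `|p - s| ^+ 2 * M by rewrite !mulr_ge0 ?sqr_ge0.
by move: h1; nra.
Qed.

(* With [r] the ratio of the odds of [p] and [s], this says that the odds ratio of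
   [ext f (nseq k p)] and [ext f (nseq k s)] is at most [r]. *)
Lemma ext_odds_le k f p r : boolean f -> mono f -> 0 < r <= 1 ->
  p * (1 - (1 - r) * s) = r * s -> let a := ext f (nseq k s) in
  ext f (nseq k p) * (1 - (1 - r) * a) <= r * a.
Proof.
move=> fb fm /andP[r0 r1] pr /=; move: (s01) => /andP[s0 s1].
have Ds : 0 < 1 - (1 - r) * s by nra.
have [p0 p1] : 0 <= p /\ p <= 1.
  by split; [rewrite -(pmulr_lge0 _ Ds) pr; nra|rewrite -(ler_pM2r Ds) pr; nra].
elim: k f fb fm => [|k IH] f fb fm; first by rewrite /=; case: (fb [::]) => ->; lra.
rewrite [nseq k.+1 p]/= [nseq k.+1 s]/= !ext_cons.
have := IH _ (fun l => fb (true :: l)) (mono_cons true fm).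
have := IH _ (fun l => fb (false :: l)) (mono_cons false fm).
have h b : 0 <= ext (fun l => f (b :: l)) (nseq k s) <= 1.
  by rewrite ext_ge ?ext_le// ?all_in01_nseq// => l; case: (fb (b :: l)) => ->.
have := h true; have := h false.
have : ext (fun l => f (false :: l)) (nseq k s) <= ext (fun l => f (true :: l)) (nseq k s).
  apply: ext_homo; first exact: all_in01_nseq.
  by move=> l; have := mono_diff fm l; rewrite /diff subr_ge0.
move: (ext _ (nseq k s)) (ext _ (nseq k s)) (ext _ (nseq k p)) (ext _ (nseq k p)).
move=> a b x y ba /andP[b0 b1] /andP[a0 a1] yb xa.
have Da : 0 < 1 - (1 - r) * a by nra.
have Db : 0 < 1 - (1 - r) * b by nra.
have Dm : 0 < 1 - (1 - r) * (s * a + (1 - s) * b) by nra.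
rewrite -(ler_pM2r (mulr_gt0 Ds (mulr_gt0 Da Db))).
set D := 1 - (1 - r) * s in Ds pr *; set A := 1 - (1 - r) * a in Da xa *.
set B := 1 - (1 - r) * b in Db yb *; set m := s * a + (1 - s) * b in Dm *.
have -> : (p * x + (1 - p) * y) * (1 - (1 - r) * m) * (D * (A * B))
   = (1 - (1 - r) * m) * (p * D * B * (x * A) + (D - p * D) * A * (y * B)) by ring.
rewrite pr (_ : D - r * s = 1 - s); last by rewrite /D; ring.
have : r * s * B * (x * A) <= r * s * B * (r * a) by apply: ler_wpM2l => //; rewrite !mulr_ge0 ?ltW.
have S1 : 0 <= 1 - s by rewrite subr_ge0 ltW.
have : (1 - s) * A * (y * B) <= (1 - s) * A * (r * b).
  by apply: ler_wpM2l => //; rewrite mulr_ge0// (ltW Da).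
move=> h1 h2.
apply: (@le_trans _ _ ((1 - (1 - r) * m) * (r * s * B * (r * a) + (1 - s) * A * (r * b)))).
  by rewrite ler_pM2l// lerD.
rewrite -subr_ge0.
(* With denominators cleared, the inductive step is this factorization; monotonicity of [f] enters
   through [b <= a]. *)
rewrite (_ : _ - _ = r * ((1 - r) * s * (1 - s) * (a - b) * (1 - a + r * b))).
  have S0 := ltW s0; have R0 := ltW r0; have R1 : 0 <= 1 - r by rewrite subr_ge0.
  have ab : 0 <= a - b by rewrite subr_ge0.
  have : 0 <= 1 - a + r * b by rewrite addr_ge0 ?subr_ge0// mulr_ge0.
  by move=> ?; do !apply: mulr_ge0.
by rewrite /D /A /B /m; ring.
Qed.

End Estimates.

(** * Independent copies of a random parameter *)

Section FfunCons.
Context {R : realType} {T : finType}.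

Definition ffun_cons k (t : T) (x : {ffun 'I_k -> T}) : {ffun 'I_k.+1 -> T} :=
  [ffun j => if unlift ord0 j is Some j' then x j' else t].

Lemma map_ffun_cons k t (x : {ffun 'I_k -> T}) :
  [seq ffun_cons t x j | j <- enum 'I_k.+1] = t :: [seq x j | j <- enum 'I_k].
Proof.
rewrite enum_ordSl /= ffunE unlift_none; congr (_ :: _).
by rewrite -map_comp; apply: eq_map => j /=; rewrite ffunE liftK.
Qed.

Lemma big_ffunS k (G : {ffun 'I_k.+1 -> T} -> R) :
  \sum_x G x = \sum_t \sum_(x : {ffun 'I_k -> T}) G (ffun_cons t x).
Proof.
pose uncons (x : {ffun 'I_k.+1 -> T}) := (x ord0, [ffun j => x (lift ord0 j)]).
rewrite pair_bigA /= (reindex (fun a : T * {ffun 'I_k -> T} => ffun_cons a.1 a.2))//=.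
exists uncons => [[t x] _|x _]; rewrite /ffun_cons /uncons.
  by congr (_, _); [|apply/ffunP => j]; rewrite !ffunE /= ?unlift_none ?liftK.
by apply/ffunP => j; rewrite !ffunE; case: unliftP => [j'|] -> //=; rewrite ffunE.
Qed.

Lemma big_ffun0 (G : {ffun 'I_0 -> T} -> R) x0 : \sum_x G x = G x0.
Proof. by rewrite (big_pred1 x0)// => x; symmetry; apply/eqP/ffunP => -[]. Qed.

End FfunCons.

Section Products.
Context {R : realType} {T : finType}.
Implicit Types (nu : T -> R) (k : nat).

Definition prod_mass k nu (x : {ffun 'I_k -> T}) : R := \prod_(j < k) nu (x j).

Fixpoint iter_sum k nu (F : seq T -> R) : R :=
  if k is k'.+1 then \sum_t nu t * iter_sum k' nu (fun l => F (t :: l)) else F [::].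

Lemma sum_prod_mass k nu (F : seq T -> R) :
  \sum_(x : {ffun 'I_k -> T}) prod_mass nu x * F [seq x j | j <- enum 'I_k] = iter_sum k nu F.
Proof.
elim: k F => [|k IH] F.
  have x0 : {ffun 'I_0 -> T} by apply: finfun => -[].
  by rewrite (big_ffun0 _ x0) /prod_mass big_ord0 mul1r enum_ord0.
rewrite big_ffunS /=; apply: eq_bigr => t _; rewrite -IH mulr_sumr.
apply: eq_bigr => x _; rewrite mulrA map_ffun_cons; congr (_ * _).
rewrite /prod_mass big_ord_recl ffunE unlift_none; congr (_ * _).
by apply: eq_bigr => j _; rewrite ffunE liftK.
Qed.

Lemma eq_iter_sum k nu F G : (forall l, size l = k -> F l = G l) -> iter_sum k nu F = iter_sum k
    nu G.
Proof.
elim: k F G => [|k IH] F G FG /=; first exact: FG.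
by apply: eq_bigr => t _; congr (_ * _); apply: IH => l lk; apply: FG; rewrite /= lk.
Qed.

Lemma le_iter_sum k nu F G : (forall t, 0 <= nu t) ->
  (forall l, size l = k -> F l <= G l) -> iter_sum k nu F <= iter_sum k nu G.
Proof.
move=> nu0; elim: k F G => [|k IH] F G FG /=; first exact: FG.
by apply: ler_sum => t _; rewrite ler_wpM2l//; apply: IH => l lk; apply: FG; rewrite /= lk.
Qed.

Lemma iter_sum_lin k nu (c d : R) F G :
  iter_sum k nu (fun l => c * F l + d * G l) = c * iter_sum k nu F + d * iter_sum k nu G.
Proof.
elim: k F G => [//|k IH] F G /=; rewrite !mulr_sumr -big_split /=.
by apply: eq_bigr => t _; rewrite IH; ring.
Qed.

Lemma iter_sumZ k nu (c : R) F : iter_sum k nu (fun l => c * F l) = c * iter_sum k nu F.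
Proof.
rewrite -[RHS]addr0 -[in RHS](mul0r (iter_sum k nu F)) -iter_sum_lin.
by apply: eq_iter_sum => l _; rewrite mul0r addr0.
Qed.

Lemma iter_sum_prod k nu (h : T -> R) :
  iter_sum k nu (fun l => \prod_(t <- l) h t) = (\sum_t nu t * h t) ^+ k.
Proof.
elim: k => [|k IH] /=; first by rewrite big_nil.
rewrite exprS -IH mulr_suml; apply: eq_bigr => t _.
by rewrite -mulrA -(iter_sumZ _ _ (h t)); congr (_ * _); apply: eq_iter_sum => l _; rewrite
    big_cons.
Qed.

End Products.

Section Step.
Context {R : realType}.
Variable s : R.
Hypothesis s01 : 0 < s < 1.
Implicit Types (f : seq bool -> R) (k : nat).

Let s_in01 : in01 s.
Proof. by move: s01 => /andP[/ltW s0 /ltW s1]; rewrite /in01 s0. Qed.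

Definition biased (T : finType) (nu p : T -> R) :=
  [/\ forall t, 0 <= nu t, \sum_t nu t = 1, forall t, in01 (p t) & \sum_t nu t * p t = s].

Definition variance (T : finType) (nu p : T -> R) : R := \sum_t nu t * (p t - s) ^+ 2.

Definition ext_ffun k f (T : finType) (p : T -> R) (x : {ffun 'I_k -> T}) : R :=
  ext f (map p [seq x j | j <- enum 'I_k]).

Section Law.
Context {T : finType}.
Variables nu p : T -> R.
Hypothesis nup : biased nu p.

Lemma biased_sum (g : R -> R) (h : R) : (forall t, g (p t) = g s + (p t - s) * h) ->
  \sum_t nu t * g (p t) = g s.
Proof.
case: nup => nu0 nu1 p01 nus gE.
under eq_bigr do rewrite gE mulrDr mulrA mulrBr mulrBl.
rewrite !big_split/= sumrN -!mulr_suml nus nu1; ring.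
Qed.

Lemma iter_sum_ext k f : iter_sum k nu (fun l => ext f (map p l)) = ext f (nseq k s).
Proof.
elim: k f => [//|k IH] f /=.
under eq_bigr do rewrite IH.
apply: (@biased_sum (fun q => ext (mix q f) _) (ext (diff f) (nseq k s))) => t.
exact: (ext_cons_diff s f (p t)).
Qed.

Lemma iter_sum_sq k f :
  iter_sum k nu (fun l => ext f (map p l) ^+ 2) = sq s (variance nu p) k f.
Proof.
case: nup => nu0 nu1 p01 nus.
elim: k f => [//|k IH] f /=; set V := variance nu p.
have [b hb] := sq_quad s V k (mix s f) (diff f).
(* The cross term [b] is multiplied by the mean of [p t - s], which is zero. *)
rewrite (eq_bigr (fun t => nu t * sq s V k (mix s f) + b * (nu t * p t) - b * s * nu t
    + sq s V k (diff f) * (nu t * (p t - s) ^+ 2))); last first.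
  move=> t _; rewrite IH -/V (@eq_sq _ _ _ _ _ (fun l => mix s f l + (p t - s) * diff f l)).
    by rewrite hb; ring.
  by move=> l; rewrite /mix /diff; ring.
rewrite !big_split/= sumrN -!mulr_sumr -mulr_suml nu1 nus -/(variance nu p) -/V.
ring.
Qed.

Lemma biased_ext k f : (forall l, in01 (f l)) -> ext f (nseq k s) = s ->
  @biased {ffun 'I_k -> T} (@prod_mass R T k nu) (ext_ffun f p).
Proof.
case: nup => nu0 nu1 p01 nus f01 fs; split.
- by move=> x; apply: prodr_ge0.
- have := sum_prod_mass k nu (fun=> 1); under eq_bigr do rewrite mulr1.
  move=> ->; elim: k {fs} => [//|k IH] /=.
  by under eq_bigr do rewrite IH mulr1.
- move=> x; have a01 : all in01 (map p [seq x j | j <- enum 'I_k]).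
    by rewrite all_map; apply/allP => t _; apply: p01.
  by rewrite /in01 /ext_ffun ext_ge ?ext_le// => l; case/andP: (f01 l).
- by rewrite (sum_prod_mass k nu (fun l => ext f (map p l))) iter_sum_ext.
Qed.

End Law.
End Step.

(** * Subexponential deviations and their propagation through one level *)

Section Subexponential.
Context {R : realType}.
Variable s : R.
Hypothesis s01 : 0 < s < 1.
Implicit Types (f : seq bool -> R) (k : nat).

Let s_in01 : in01 s.
Proof. by move: s01 => /andP[/ltW s0 /ltW s1]; rewrite /in01 s0. Qed.

(** One parameter [K] governs both the size of the moment bound and its range, so progress is
    measured by [K] with [w] fixed. The variance is bounded separately because the exponential
    moments alone give only [2 * w / K], too weak for small [th] in [subexp_step]. *)
Definition subexp (T : finType) (w K : R) (nu p : T -> R) :=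
  variance s nu p <= w / K /\
  forall th : R, `|th| <= K -> \sum_t nu t * expR (th * (p t - s)) <= expR (w * th ^+ 2 / K).

Lemma biased_dist (T : finType) (nu p : T -> R) t : biased s nu p -> `|p t - s| <= 1.
Proof.
case=> _ _ /(_ t) /andP[p0 p1] _; move: s01 => /andP[s0 s1].
by rewrite ler_norml; apply/andP; split; lra.
Qed.

Lemma infl_bounded (M : R) k j f : (forall l, `|f l| <= M) -> `|infl s k j f| <= 2 * M.
Proof.
move=> fM; have M0 : 0 <= M := le_trans (normr_ge0 _) (fM [::]).
elim: k j f fM => [|k IH] [|j] f fM /=; rewrite ?normr0 ?mulr_ge0//.
  by apply: ext_bounded (diff_bounded fM) _; apply: all_in01_nseq.
exact/IH/mix_bounded.
Qed.

Lemma in01_bounded f : (forall l, in01 (f l)) -> forall l, `|f l| <= 1.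
Proof. by move=> f01 l; case/andP: (f01 l) => f0 f1; rewrite ger0_norm. Qed.

Lemma in01_diff_bounded f : (forall l, in01 (f l)) -> forall l, `|diff f l| <= 1.
Proof.
move=> f01 l; case/andP: (f01 (true :: l)) => ? ?; case/andP: (f01 (false :: l)) => ? ?.
by rewrite ler_norml /diff; apply/andP; split; lra.
Qed.

Lemma in01_infl_bounded k j f : (forall l, in01 (f l)) -> `|infl s k j f| <= 1.
Proof.
move=> f01; elim: k j f f01 => [|k IH] [|j] f f01 /=; rewrite ?normr0//.
  by apply: ext_bounded (in01_diff_bounded f01) _; apply: all_in01_nseq.
exact/IH/mix01.
Qed.

Section Law.
Context {T : finType}.
Variables (nu p : T -> R) (w K : R).
Hypothesis nup : biased s nu p.
Hypothesis w0 : 0 <= w.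
Hypothesis K0 : 0 < K.
Hypothesis nupK : subexp w K nu p.

(** This is [sq_interp] with [c] the fraction reached of the maximal variance [s * (1 - s)], which
    is also the total weight of a Boolean [f] of mean [s]. *)
Lemma variance_step k f (c := variance s nu p / (s * (1 - s))) :
  boolean f -> mono f -> ext f (nseq k s) = s -> c <= 1 ->
  variance s (@prod_mass R T k nu) (ext_ffun f p)
    <= variance s nu p * (infl_sq s k f + (1 - infl_sq s k f) * c).
Proof.
move=> fb fm fs c1; have V0 := variance_gt0 s01.
have nup' := biased_ext nup (boolean01 fb) fs.
have W0 : 0 <= variance s nu p.
  by case: nup => nu0 _ _ _; apply: sumr_ge0 => t _; rewrite mulr_ge0 ?sqr_ge0.
have c01 : 0 <= c <= 1 by rewrite c1 andbT divr_ge0// ltW.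
have -> : variance s (@prod_mass R T k nu) (ext_ffun f p)
    = sq s (variance s nu p) k f - s ^+ 2.
  rewrite -(iter_sum_sq nup) -(sum_prod_mass k nu (fun l => ext f (map p l) ^+ 2)).
  case: nup' => _ n1 _ ns.
  rewrite /variance (eq_bigr (fun x => prod_mass nu x * ext f [seq p i | i <- [seq x j | j <-
      enum 'I_k]] ^+ 2
     - 2 * s * (prod_mass nu x * ext_ffun f p x) + s ^+ 2 * prod_mass nu x)); last first.
    by move=> x _; rewrite /ext_ffun; ring.
  by rewrite !big_split/= sumrN -!mulr_sumr n1 ns; ring.
have := sq_interp s01 k f c01; rewrite fs sq_boolean// fs.
rewrite -[variance s nu p](divfK (lt0r_neq0 V0)) -/c.
by move: (sq s _ k f) => q; nra.
Qed.

(** Arguments are integrated out one at a time. Replacing one by a value within [u] of [s] changes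
    each remaining influence by at most [2 * u], hence its square by at most [8 * u]; these errors
    add up to the last term. *)
Lemma small_dist_mgf k f (u th : R) (small := fun t => `|p t - s| <= u) :
  (forall l, in01 (f l)) -> 0 <= u <= 1 ->
  (forall j, (j < k)%N -> `|th| * (`|infl s k j f| + 2 * k%:R * u) <= K) ->
  iter_sum k nu (fun l => (all small l)%:R * expR (th * (ext f (map p l) - ext f (nseq k s))))
    <= expR (w * th ^+ 2 / K * (infl_sq s k f + 8 * k%:R ^+ 2 * u)).
Proof.
move=> f01 /andP[u0 u1]; case: (nup) => nu0 nu1 p01 nus.
set X := w * th ^+ 2 / K; have X0 : 0 <= X by apply: divr_ge0 (ltW K0); rewrite mulr_ge0 ?sqr_ge0.
elim: k f f01 => [|k IH] f f01 hK.
  by rewrite /= subrr mulr0 expR0 mulr1 -expR0 ler_expR /infl_sq big_ord0 expr0n/= mulr0 mul0r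
      addr0 mulr0.
set a := ext (diff f) (nseq k s).
set B := infl_sq s k (mix s f) + 8 * k%:R * u + 8 * k%:R ^+ 2 * u.
have mixE t : mix (p t) f =1 (fun l => 1 * mix s f l + (p t - s) * diff f l).
  by move=> l; rewrite /mix /diff; ring.
have step t : iter_sum k nu (fun l => (all small (t :: l))%:R *
      expR (th * (ext f (map p (t :: l)) - ext f (nseq k.+1 s))))
    <= expR (th * a * (p t - s)) * expR (X * B).
  (* Outside the small event the left side vanishes, so the bound holds for every [t] and can be
     averaged over the whole law. *)
  case: (boolP (small t)) => tu; last first.
    rewrite (@eq_iter_sum _ _ _ _ _ (fun l => 0 * 1)); last by move=> l _; rewrite /= (negbTE
        tu) !mul0r.
    by rewrite iter_sumZ mul0r mulr_ge0 ?expR_ge0.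
  have inflE j : infl s k j (mix (p t) f) = infl s k j (mix s f) + (p t - s) * infl s k j (diff f).
    by rewrite (eq_infl _ _ _ (mixE t)) infl_lin mul1r.
  have dinfl j : `|(p t - s) * infl s k j (diff f)| <= 2 * u.
    rewrite normrM mulrC ler_pM//.
    by apply: le_trans (infl_bounded _ _ (in01_diff_bounded f01)) _; rewrite mulr1.
  rewrite (@eq_iter_sum _ _ _ _ _ (fun l => expR (th * a * (p t - s)) *
     ((all small l)%:R * expR (th * (ext (mix (p t) f) (map p l) - ext (mix (p t) f) (nseq k
         s)))))).
    rewrite iter_sumZ ler_wpM2l ?expR_ge0//.
    apply: le_trans (IH _ (mix01 (p01 t) f01) _) _.
      move=> j jk; apply: le_trans (hK j.+1 jk); rewrite ler_wpM2l// inflE /=.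
      have := ler_normD (infl s k j (mix s f)) ((p t - s) * infl s k j (diff f)).
      by have := dinfl j; rewrite -natr1; lra.
    rewrite ler_expR ler_wpM2l// /B lerD2r /infl_sq.
    have -> : 8 * k%:R * u = \sum_(j < k) 8 * u.
      by rewrite sumr_const card_ord -(mulr_natl (8 * u)); ring.
    rewrite -big_split/=; apply: ler_sum => j _; rewrite inflE.
    have h1 := in01_infl_bounded k j (mix01 s_in01 f01); have h2 := dinfl j.
    move: (infl _ _ _ _) (_ * _) h1 h2 => x y; rewrite !ler_norml => /andP[? ?] /andP[? ?].
    nra.
  move=> l _; rewrite [all _ _]/= tu mulrCA -expRD; congr (_ * expR _).
  have -> : ext (mix (p t) f) (nseq k s) = ext (mix s f) (nseq k s) + (p t - s) * a.
    by rewrite (eq_ext _ (mixE t)) ext_lin mul1r.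
  by rewrite /=; ring.
apply: le_trans (ler_sum _ (fun t _ => ler_wpM2l (nu0 t) (step t))) _.
under eq_bigr do rewrite mulrA.
rewrite -mulr_suml.
have hI : `|th * a| <= K.
  apply: le_trans (hK 0%N isT); rewrite normrM /= -/a ler_wpM2l// lerDl.
  by rewrite !mulr_ge0.
have [_ /(_ _ hI) h] := nupK.
apply: le_trans (ler_wpM2r (expR_ge0 _) h) _.
rewrite -expRD ler_expR infl_sqS -/a /B -[k.+1%:R]natr1.
have -> : w * (th * a) ^+ 2 / K = X * a ^+ 2 by rewrite /X; ring.
rewrite -mulrDr ler_wpM2l//.
have : 0 <= k%:R * u by rewrite mulr_ge0.
lra.
Qed.

(** By [ext_dist_le] the exponent is at most [(1 - e) * K * S], where [S] is the sum of the
    deviations. Since [S >= u] on this event, it is at most [K * S - e * K * u], and the mean of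
    [expR (K * S)] is a product over the copies. *)
Lemma large_dist_mgf k f (u e rho th : R) (small := fun t => `|p t - s| <= u) :
  mono f -> (forall l, in01 (f l)) -> ext f (nseq k s) = s ->
  (forall j, (j < k)%N -> infl s k j f <= rho) -> 1 <= 2 * rho ->
  `|th| * rho <= (1 - e) * K -> 0 <= u -> 0 <= e ->
  iter_sum k nu (fun l => (~~ all small l)%:R * expR (th * (ext f (map p l) - s)))
    <= expR (- (e * K * u)) * (2 * expR (w * K)) ^+ k.
Proof.
move=> fm f01 fs frho rho2 hth u0 e0; case: (nup) => nu0 nu1 p01 nus.
have : \sum_t nu t * expR (K * `|p t - s|) <= 2 * expR (w * K).
  have [_ h] := nupK.
  have h1 : \sum_t nu t * expR (K * (p t - s)) <= expR (w * K).
    apply: le_trans (h K _) _; first by rewrite gtr0_norm.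
    by rewrite expr2 mulrA mulfK// gt_eqF.
  have h2 : \sum_t nu t * expR (- K * (p t - s)) <= expR (w * K).
    apply: le_trans (h (- K) _) _; first by rewrite normrN gtr0_norm.
    by rewrite sqrrN expr2 mulrA mulfK// gt_eqF.
  apply: (@le_trans _ _ (\sum_t (nu t * expR (K * (p t - s)) + nu t * expR (- K * (p t - s))))).
    apply: ler_sum => t _; rewrite -mulrDr ler_wpM2l//.
    by case: (ger0P (p t - s)) => _; rewrite ?lerDl ?mulrN ?mulNr ?lerDr ?expR_ge0.
  by rewrite big_split /= mulr_natl mulr2n lerD.
move=> hS.
have hS0 : 0 <= \sum_t nu t * expR (K * `|p t - s|).
  by apply: sumr_ge0 => t _; rewrite mulr_ge0 ?expR_ge0.
apply: (@le_trans _ _ (expR (- (e * K * u)) * (\sum_t nu t * expR (K * `|p t - s|)) ^+ k)); last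
    first.
  rewrite ler_wpM2l ?expR_ge0//; apply: lerXn2r; rewrite ?nnegrE// mulr_ge0 ?expR_ge0.
rewrite -iter_sum_prod -iter_sumZ; apply: le_iter_sum => // l lk.
have prod_exp (c : R) : \prod_(t <- l) expR (c * `|p t - s|) = expR (c * \sum_(t <- l) `|p t - s|).
  by elim: (l) => [|t l' IH]; rewrite ?big_nil ?mulr0 ?expR0// !big_cons IH mulrDr expRD.
rewrite prod_exp -expRD; set S := \sum_(t <- l) _.
case: (boolP (all small l)) => [_|]; first by rewrite mul0r expR_ge0.
rewrite mul1r -has_predC => /hasP[t tl]; rewrite /= -ltNge => tu.
have uS : u <= S.
  rewrite /S (big_rem t)//=; apply: (le_trans (ltW tu)); rewrite lerDl.
  by apply: sumr_ge0.
rewrite ler_expR; apply: (@le_trans _ _ (`|th| * `|ext f (map p l) - s|)).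
  by rewrite -normrM ler_norm.
have hd : `|ext f (map p l) - s| <= rho * S.
  rewrite /S -(big_map p predT (fun q => `|q - s|)).
  apply: (ext_dist_le s01 fm f01 _ fs frho) => //; first by rewrite size_map.
  by rewrite all_map; apply/allP => t' _; apply: p01.
apply: le_trans (ler_wpM2l (normr_ge0 _) hd) _; rewrite mulrA.
have S0 : 0 <= S by apply: le_trans uS.
apply: le_trans (ler_wpM2r S0 hth) _.
have : e * K * u <= e * K * S by rewrite ler_wpM2l// mulr_ge0// ltW.
lra.
Qed.

End Law.

Lemma expR_le_quad (x : R) : `|x| <= 4^-1 -> expR x <= 1 + x + x ^+ 2.
Proof.
rewrite ler_norml => /andP[x1 x2].
have h : 1 - x / 2 <= expR (- (x / 2)) by have := expR_ge1Dx (- (x / 2)).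
have -> : expR x = (expR (- (x / 2)))^-1 ^+ 2.
  by rewrite -expRN opprK expr2 -expRD; congr expR; lra.
have h0 : 0 < 1 - x / 2 by lra.
apply: (@le_trans _ _ ((1 - x / 2)^-1 ^+ 2)).
  apply: lerXn2r; rewrite ?nnegrE ?invr_ge0 ?expR_ge0 ?(ltW h0)//.
  by rewrite lef_pV2 ?posrE ?expR_gt0.
rewrite exprVn -[leLHS]div1r ler_pdivrMr ?exprn_gt0//; nra.
Qed.

End Subexponential.

Section SubexpStep.
Context {R : realType}.
Variable s : R.
Hypothesis s01 : 0 < s < 1.
Variables (k : nat) (f : seq bool -> R) (y rho : R).
Hypothesis fb : boolean f.
Hypothesis fm : mono f.
Hypothesis fs : ext f (nseq k s) = s.
Hypothesis y0 : 0 < y.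
Hypothesis infl_rho : forall j, (j < k)%N -> infl s k j f <= rho.
Hypothesis rho2 : 1 <= 2 * rho.
Hypothesis y_rho : (1 + y) * rho < 1.
Hypothesis y_sq : (1 + y) * infl_sq s k f < 1.

Let e : R := 1 - (1 + y) * rho.
Let b : R := (1 + y)^-1 - infl_sq s k f.

Let e0 : 0 < e. Proof. by rewrite subr_gt0. Qed.

Let y1 : 0 < 1 + y. Proof. by move: y0; lra. Qed.

Let b0 : 0 < b.
Proof. by rewrite subr_gt0 -div1r ltr_pdivlMr// mulrC. Qed.

(** The slacks [b] and [e] left by [y_sq] and [y_rho] must absorb the errors of [small_dist_mgf];
    half of [b] is kept for the large deviations. *)
Lemma small_radius : exists u : R,
  [/\ 0 < u <= 1, 8 * k%:R ^+ 2 * u <= b / 2 & 2 * k%:R * u * (1 + y) <= e].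
Proof.
pose M : R := 16 * k%:R ^+ 2 + 2 * k%:R * (1 + y) + 1.
have k0 : 0 <= k%:R :> R by [].
have M1 : 1 <= M.
  have := sqr_ge0 (k%:R : R); have : 0 <= k%:R * (1 + y) by rewrite mulr_ge0 ?(ltW y1).
  by rewrite /M; lra.
have m0 : 0 < Num.min (Num.min b e) 1 by rewrite !lt_min b0 e0 ltr01.
exists (Num.min (Num.min b e) 1 / M).
set m := Num.min _ _ in m0 *.
have mb : m <= b by rewrite /m !ge_min lexx.
have me : m <= e by rewrite /m !ge_min lexx orbT.
have m1 : m <= 1 by rewrite /m !ge_min lexx orbT.
have M0 : 0 < M by lra.
have u0 : 0 < m / M by rewrite divr_gt0.
have uM : m / M * M = m by rewrite divfK ?gt_eqF.
move: (m / M) u0 uM => u u0 uM.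
have h : 0 <= k%:R ^+ 2 * u by rewrite mulr_ge0 ?sqr_ge0 ?(ltW u0).
have h' : 0 <= k%:R * u * (1 + y) by rewrite !mulr_ge0 ?(ltW u0) ?(ltW y1).
rewrite u0; move: uM; rewrite /M => uM.
by split; nra.
Qed.

(** Small [w] lets the decay [expR (- (e * K * u))] of the large deviations win over the factor
    [expR (w * K)] of each copy; large [K] then makes what remains negligible. *)
Lemma subexp_step : exists2 w0 : R, 0 < w0 & forall w : R, 0 < w <= w0 ->
  exists2 K0 : R, 0 < K0 & forall K : R, K0 <= K ->
  forall (T : finType) (nu p : T -> R), biased s nu p -> subexp s w K nu p ->
  subexp s w ((1 + y) * K) (@prod_mass R T k nu) (ext_ffun f p).
Proof.
have [u [/andP[u0 u1] ub ue]] := small_radius; have V0 := variance_gt0 s01.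
have k0 : 0 <= k%:R :> R by [].
pose tau : R := e * u / 2.
have tau0 : 0 < tau by rewrite divr_gt0 ?mulr_gt0.
exists (tau / (k%:R + 1)); first by rewrite divr_gt0//; lra.
move=> w /andP[w0]; rewrite ler_pdivlMr; last lra; move=> wk.
pose C : R := 2 ^+ k.
have C0 : 0 < C by rewrite exprn_gt0.
(* The terms ensure in turn [1 <= K], a variance ratio at most 1, the same ratio at most [b], and
   the absorption of the large deviations. *)
pose K0 : R := 1 + w / (s * (1 - s)) + w / (s * (1 - s) * b) + C * 128 / (tau ^+ 2 * b * w).
have t1 : 0 <= w / (s * (1 - s)) by rewrite divr_ge0 ?(ltW V0) ?(ltW w0).
have t2 : 0 <= w / (s * (1 - s) * b) by rewrite divr_ge0 ?(ltW w0)// mulr_ge0 ?(ltW V0) ?(ltW b0).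
have t3 : 0 <= C * 128 / (tau ^+ 2 * b * w).
  apply: divr_ge0; first by rewrite mulr_ge0 ?(ltW C0).
  by rewrite (mulr_ge0 (mulr_ge0 (sqr_ge0 _) (ltW b0)) (ltW w0)).
exists K0; first by rewrite /K0; lra.
move=> K KK0 T nu p nup nupK.
have K1 : 1 <= K by rewrite /K0 in KK0; lra.
have Kpos : 0 < K by lra.
have KV : w / K <= s * (1 - s).
  by rewrite ler_pdivrMr// -ler_pdivrMl// mulrC; rewrite /K0 in KK0; lra.
have KVb : w / K / (s * (1 - s)) <= b.
  rewrite ler_pdivrMr// ler_pdivrMr// mulrC -ler_pdivrMr ?(mulr_gt0 b0 V0)//.
  by rewrite [b * _]mulrC; rewrite /K0 in KK0; lra.
have KC : C * 128 <= K * (tau ^+ 2 * b * w).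
  by rewrite -ler_pdivrMr ?(mulr_gt0 (mulr_gt0 (exprn_gt0 2 tau0) b0) w0)//; rewrite /K0 in KK0;
      lra.
case: (nupK) => nuV nuM.
have nup' := biased_ext nup (boolean01 fb) fs (k := k).
have varle : variance s (@prod_mass R T k nu) (ext_ffun f p) <= w / ((1 + y) * K).
  have c1 : variance s nu p / (s * (1 - s)) <= 1.
    by rewrite ler_pdivrMr// mul1r (le_trans nuV).
  apply: le_trans (variance_step s01 nup fb fm fs c1) _.
  have -> : w / ((1 + y) * K) = w / K * (1 + y)^-1 by rewrite invfM [(1 + y)^-1 * _]mulrC mulrA.
  have W0 : 0 <= variance s nu p.
    by case: nup => nu0 _ _ _; apply: sumr_ge0 => t _; rewrite mulr_ge0 ?sqr_ge0.
  have L0 := infl_sq_ge0 s k f.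
  have c0 : variance s nu p / (s * (1 - s)) <= b.
    by apply: le_trans KVb; rewrite ler_pM2r ?invr_gt0.
  have L1 : infl_sq s k f < 1.
    have : 0 <= y * infl_sq s k f by rewrite mulr_ge0 ?(ltW y0).
    by move: y_sq; lra.
  have c0' : 0 <= variance s nu p / (s * (1 - s)) by rewrite divr_ge0 ?(ltW V0).
  apply: ler_pM => //.
    by rewrite addr_ge0// mulr_ge0// subr_ge0 ltW.
  have : (1 - infl_sq s k f) * (variance s nu p / (s * (1 - s))) <= b.
    by apply: le_trans c0; rewrite ler_piMl//; lra.
  by rewrite /b; lra.
split=> // th hth.
(* For small [th] the target is too close to 1 to absorb an additive error, so the bound on the
   variance is used instead. *)
have [th4|th4] := leP `|th| 4^-1.
  case: (nup') => nu0' nu1' p01' nus'.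
  apply: (@le_trans _ _ (\sum_x (prod_mass nu x + th * (prod_mass nu x * ext_ffun f p x)
      - th * s * prod_mass nu x + th ^+ 2 * (prod_mass nu x * (ext_ffun f p x - s) ^+ 2)))).
    apply: ler_sum => x _.
    have : expR (th * (ext_ffun f p x - s))
       <= 1 + th * (ext_ffun f p x - s) + (th * (ext_ffun f p x - s)) ^+ 2.
      apply: expR_le_quad; rewrite normrM (le_trans _ th4)//.
      by rewrite ler_piMr// (biased_dist s01 x nup').
    move=> h; apply: le_trans (ler_wpM2l (nu0' x) h) _.
    by rewrite le_eqVlt; apply/orP; left; apply/eqP; ring.
  rewrite !big_split/= sumrN -!mulr_sumr nu1' nus' -/(variance s _ _).
  apply: le_trans (expR_ge1Dx _).
  have := ler_wpM2l (sqr_ge0 th) varle.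
  have -> : w * th ^+ 2 / ((1 + y) * K) = th ^+ 2 * (w / ((1 + y) * K)) by ring.
  lra.
have -> : w * th ^+ 2 / ((1 + y) * K) = w * th ^+ 2 / K * (1 + y)^-1.
  by rewrite invfM [(1 + y)^-1 * _]mulrC mulrA.
set X := w * th ^+ 2 / K; set small := fun t => `|p t - s| <= u.
have X0 : 0 <= X by apply: divr_ge0 (ltW Kpos); rewrite mulr_ge0 ?sqr_ge0 ?(ltW w0).
rewrite (sum_prod_mass k nu (fun l => expR (th * (ext f (map p l) - s)))).
rewrite (@eq_iter_sum _ _ _ _ _ (fun l =>
    1 * ((all small l)%:R * expR (th * (ext f (map p l) - ext f (nseq k s))))
  + 1 * ((~~ all small l)%:R * expR (th * (ext f (map p l) - s))))); last first.
  by move=> l _; rewrite fs; case: (all _ _); rewrite /= ?mul0r ?mul1r ?addr0 ?add0r.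
rewrite iter_sum_lin !mul1r.
have h1 : iter_sum k nu (fun l => (all small l)%:R *
      expR (th * (ext f (map p l) - ext f (nseq k s)))) <= expR (X * (infl_sq s k f + b / 2)).
  apply: le_trans (small_dist_mgf s01 nup (ltW w0) Kpos nupK (boolean01 fb) _ _) _.
  - by rewrite (ltW u0).
  - move=> j jk; rewrite [`|infl _ _ _ _|]ger0_norm ?mono_infl_ge0//.
    have := infl_rho jk => hj.
    apply: (@le_trans _ _ ((1 + y) * K * (rho + 2 * k%:R * u))).
      apply: ler_pM => //; last by rewrite lerD2r.
      by rewrite addr_ge0 ?mono_infl_ge0// !mulr_ge0 ?(ltW u0).
    rewrite mulrAC -[leRHS]mul1r ler_pM2r// mulrDr.
    by move: ue; rewrite /e; lra.
  by rewrite ler_expR ler_wpM2l// lerD2l.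
have h2 : iter_sum k nu (fun l => (~~ all small l)%:R * expR (th * (ext f (map p l) - s)))
    <= expR (- (K * tau)) * C.
  have hth' : `|th| * rho <= (1 - e) * K.
    by rewrite /e subKr mulrAC; apply: ler_wpM2r => //; move: rho2; lra.
  apply: le_trans (large_dist_mgf s01 nup Kpos nupK fm (boolean01 fb) fs infl_rho rho2
    hth' (ltW u0) (ltW e0)) _.
  rewrite exprMn -/C mulrCA mulrC ler_pM2r//.
  rewrite -expRM_natl -expRD ler_expR /tau.
  have : k%:R * w * K <= e * u / 2 * K.
    by rewrite ler_pM2r//; move: wk w0; rewrite /tau; lra.
  lra.
apply: le_trans (lerD h1 h2) _.
(* As [|th|] exceeds [4^-1], [X] is at least [w / (16 * K)], while the left side is exponentially
   small in [K]. *)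
have h3 : expR (- (K * tau)) * C <= X * (b / 2).
  have hx : w / (16 * K) <= X.
    rewrite /X invfM mulrA ler_pM2r ?invr_gt0// ler_pM2l//.
    by rewrite -[th ^+ 2]ger0_norm ?sqr_ge0// normrX; nra.
  apply: (@le_trans _ _ (w / (16 * K) * (b / 2))); last first.
    by rewrite ler_pM2r ?divr_gt0.
  have -> : expR (- (K * tau)) = (expR (K * tau / 2) ^+ 2)^-1.
    by rewrite expr2 -expRD -expRN; congr expR; lra.
  have z0 : 0 < K * tau / 2 by rewrite divr_gt0 ?(mulr_gt0 Kpos tau0).
  have hexp : (K * tau / 2) ^+ 2 <= expR (K * tau / 2) ^+ 2.
    apply: lerXn2r; rewrite ?nnegrE ?expR_ge0 ?(ltW z0)//.
    by apply: le_trans (expR_ge1Dx _); rewrite lerDr.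
  have hp : 0 < (K * tau / 2) ^+ 2 by rewrite exprn_gt0.
  apply: (@le_trans _ _ (((K * tau / 2) ^+ 2)^-1 * C)).
    by rewrite ler_pM2r// lef_pV2 ?posrE// (lt_le_trans hp).
  rewrite mulrC ler_pdivrMr//.
  have -> : w / (16 * K) * (b / 2) * (K * tau / 2) ^+ 2 = K * (tau ^+ 2 * b * w) / 128.
    by field; lra.
  by rewrite ler_pdivlMr.
have -> : X * (1 + y)^-1 = X * (infl_sq s k f + b / 2) + X * (b / 2).
  by rewrite -mulrDr /b; congr (X * _); lra.
rewrite expRD; set E := expR (X * _).
have E1 : 1 <= E.
  rewrite -expR0 ler_expR mulr_ge0// addr_ge0 ?infl_sq_ge0// divr_ge0// ltW//.
have := expR_ge1Dx (X * (b / 2)); have : 0 <= X * (b / 2).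
  by rewrite mulr_ge0// divr_ge0 ?(ltW b0).
nra.
Qed.

End SubexpStep.

(** * The growth process *)

Lemma nseq_enum_ord (T : Type) k (p : T) : nseq k p = [seq p | _ <- enum 'I_k].
Proof. by rewrite -[in LHS](size_enum_ord k); elim: (enum 'I_k) => //= j l <-. Qed.

Section Growth.
Context {R : realType}.
Variables (k : nat) (alpha : boolfun k).

Definition connective (l : seq bool) : R := (alpha [ffun j : 'I_k => nth false l j])%:R.

Lemma connective_boolean : boolean connective.
Proof. by move=> l; rewrite /connective; case: (alpha _); [right|left]. Qed.

Lemma connectiveE (x : {ffun 'I_k -> bool}) : connective [seq x j | j <- enum 'I_k] = (alpha x)%:R.
Proof.
rewrite /connective; congr (alpha _)%:R; apply/ffunP => j.
by rewrite ffunE (nth_map j) ?size_enum_ord// nth_ord_enum.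
Qed.

Lemma sum_bernoulli m (q : 'I_m -> R) (F : seq bool -> R) :
  \sum_(x : {ffun 'I_m -> bool}) (\prod_(j < m) bernoulli_pmf (q j) (x j)) * F [seq x j | j <-
      enum 'I_m]
  = ext F [seq q j | j <- enum 'I_m].
Proof.
elim: m q F => [|m IH] q F.
  have x0 : {ffun 'I_0 -> bool} by apply: finfun => -[].
  by rewrite (big_ffun0 _ x0) big_ord0 mul1r enum_ord0.
rewrite big_ffunS big_bool [in RHS]enum_ordSl [RHS]/= -map_comp -[ext (mix _ _) _]/(ext F (_ ::
    _)) ext_cons -!(IH (q \o lift ord0)) !mulr_sumr.
congr (_ + _); apply: eq_bigr => x _; rewrite map_ffun_cons mulrA; congr (_ * _);
  rewrite big_ord_recl ffunE unlift_none; congr (_ * _);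
  by apply: eq_bigr => j _; rewrite ffunE liftK.
Qed.

Lemma characteristic_poly_ext p : characteristic_poly alpha p = ext connective (nseq k p).
Proof.
rewrite nseq_enum_ord -(sum_bernoulli (fun=> p)) /characteristic_poly /iid_prob big_mkcond.
by apply: eq_bigr => x _; rewrite connectiveE; case: (alpha x); rewrite ?mulr1 ?mulr0.
Qed.

Lemma iid_prob_push (T U : finType) (w : T -> R) (r : T -> U) (E : pred {ffun 'I_k -> U}) :
  iid_prob w (fun x => E [ffun j => r (x j)])
  = iid_prob (fun v => \sum_(t | r t == v) w t) E.
Proof.
rewrite /iid_prob (partition_big (fun x : {ffun 'I_k -> T} => [ffun j => r (x j)]) E)//=.
apply: eq_bigr => z Ez; rewrite bigA_distr_big_dep; apply: eq_bigl => x.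
apply/andP/familyP => [[_ /eqP <-] j|h].
  by apply/eqP; rewrite ffunE.
have -> : [ffun j => r (x j)] = z by apply/ffunP => j; rewrite ffunE; apply/eqP/h.
by rewrite Ez.
Qed.

Lemma eq_iid_prob (T : finType) (w w' : T -> R) (E E' : pred {ffun 'I_k -> T}) :
  w =1 w' -> E =1 E' -> iid_prob w E = iid_prob w' E'.
Proof.
move=> ww EE; rewrite /iid_prob (eq_bigl _ _ EE).
by apply: eq_bigr => x _; apply: eq_bigr => j _.
Qed.

Section Process.
Variables (n : nat) (mu : boolfun n -> R).
Hypothesis mu0 : forall f, 0 <= mu f.
Hypothesis mu1 : \sum_f mu f = 1.

Definition growth_prob i (P : pred (boolfun n)) : R := \sum_(f | P f) growth mu alpha i f.

Lemma growth_probS i P : growth_prob i.+1 P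
  = iid_prob (growth mu alpha i) (fun g => P (compose alpha g)).
Proof.
rewrite /growth_prob /= /iid_prob.
rewrite [RHS](partition_big (fun g => compose alpha g) P)//=.
by apply: eq_bigr => f Pf; apply: eq_bigl => g; case: eqP => [->|]; rewrite ?Pf ?andbF.
Qed.

Lemma growth_ge0 i f : 0 <= growth mu alpha i f.
Proof. by elim: i f => [//|i IH] f /=; apply: sumr_ge0 => x _; apply: prodr_ge0. Qed.

Lemma growth_sum1 i : \sum_f growth mu alpha i f = 1.
Proof.
elim: i => [//|i IH].
rewrite -[LHS]/(growth_prob i.+1 predT) growth_probS /iid_prob.
transitivity (\prod_(j < k) \sum_f growth mu alpha i f).
  by rewrite bigA_distr_bigA.
by rewrite big1.
Qed.

Lemma growth_prob_ge0 i P : 0 <= growth_prob i P.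
Proof. by apply: sumr_ge0 => f _; apply: growth_ge0. Qed.

Lemma growth_probC i (P : pred (boolfun n)) : growth_prob i P + growth_prob i (predC P) = 1.
Proof. by rewrite -(growth_sum1 i) [RHS](bigID P). Qed.

Lemma growth_prob_sub i (P Q : pred (boolfun n)) : (forall f, P f -> Q f) -> growth_prob i P <=
    growth_prob i Q.
Proof.
move=> PQ; rewrite /growth_prob big_mkcond [leRHS]big_mkcond /=.
apply: ler_sum => f _; case: ifP => [/PQ ->//|_].
by case: ifP => // _; apply: growth_ge0.
Qed.

Lemma growth_prob_le1 i P : growth_prob i P <= 1.
Proof. by rewrite -(growth_probC i P) lerDl growth_prob_ge0. Qed.

Lemma growth_probU i (P Q : pred (boolfun n)) :
  growth_prob i (fun f => P f || Q f) <= growth_prob i P + growth_prob i Q.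
Proof.
rewrite /growth_prob big_mkcond [X in _ <= X + _]big_mkcond [X in _ <= _ + X]big_mkcond.
rewrite -big_split; apply: ler_sum => f _ /=; have := growth_ge0 i f.
by case: (P f); case: (Q f) => /=; lra.
Qed.

Definition point_prob i (x : {ffun 'I_n -> bool}) : R := growth_prob i (fun f => f x).

Lemma point_prob01 i x : in01 (point_prob i x).
Proof. by rewrite /in01 growth_prob_ge0 growth_prob_le1. Qed.

Lemma point_probS i x : point_prob i.+1 x = characteristic_poly alpha (point_prob i x).
Proof.
rewrite /point_prob growth_probS.
rewrite (eq_iid_prob (w' := growth mu alpha i) (E' := fun g => alpha [ffun j => g j x]))//; last
    first.
  by move=> g; rewrite ffunE.
rewrite (iid_prob_push _ (fun f : boolfun n => f x) (fun z => alpha z)).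
apply: eq_iid_prob => // -[]; rewrite /bernoulli_pmf.
  by apply: eq_bigl => f; rewrite eqb_id.
rewrite -(growth_probC i (fun f => f x)) addrC addKr.
by apply: eq_bigl => f; rewrite /= eqbF_neg.
Qed.

End Process.
End Growth.

(** * Joint law of the values at several assignments *)

Section Representation.
Context {R : realType}.
Variables (k n : nat) (alpha : boolfun k) (mu : boolfun n -> R).
Hypothesis mu0 : forall f, 0 <= mu f.
Hypothesis mu1 : \sum_f mu f = 1.
Hypothesis alpha0 : alpha [ffun=> false] = false.
Implicit Types (S : {set {ffun 'I_n -> bool}}) (x : {ffun 'I_n -> bool}) (i : nat).

(** Being false off [S] keeps the type [boolfun n]; as [alpha] maps constant false to false,
    restriction commutes with composition. *)
Definition restr S (f : boolfun n) : boolfun n := [ffun x => (x \in S) && f x].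

Lemma restr_compose S (g : {ffun 'I_k -> boolfun n}) :
  restr S (compose alpha g) = compose alpha [ffun j => restr S (g j)].
Proof.
apply/ffunP => x; rewrite !ffunE; case: (boolP (x \in S)) => xS /=.
  by congr (alpha _); apply/ffunP => j; rewrite !ffunE xS.
by rewrite -alpha0; congr (alpha _); apply/ffunP => j; rewrite !ffunE (negbTE xS).
Qed.

(* A finite probability space on which [u] has the law of the restriction to [S] of
   the random function of level [i], and on which, conditionally, the value of that
   function at [x] is a Bernoulli variable of parameter [p]. *)
Definition represents i S x (T : finType) (nu p : T -> R) (u : T -> boolfun n) :=
  forall b c, growth_prob alpha mu i (fun f => (restr S f == b) && (f x == c))
    = \sum_(t | u t == b) nu t * bernoulli_pmf (p t) c.

Lemma represents_total i S x T nu p u : @represents i S x T nu p u ->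
  forall b, growth_prob alpha mu i (fun f => restr S f == b) = \sum_(t | u t == b) nu t.
Proof.
move=> h b; have E := h b true; have F := h b false.
transitivity (growth_prob alpha mu i (fun f => (restr S f == b) && (f x == true))
   + growth_prob alpha mu i (fun f => (restr S f == b) && (f x == false))).
  rewrite /growth_prob [LHS](bigID (fun f : boolfun n => f x)) /=; congr (_ + _).
    by apply: eq_bigl => f; rewrite eqb_id.
  by apply: eq_bigl => f; rewrite eqbF_neg.
by rewrite E F -big_split /=; apply: eq_bigr => t _; rewrite /bernoulli_pmf; ring.
Qed.

Lemma represents_mean i S x T nu p u : @represents i S x T nu p u ->
  \sum_t nu t * p t = point_prob alpha mu i x.
Proof.
move=> h; rewrite /point_prob /growth_prob.
rewrite (partition_big (restr S) predT)//= [LHS](partition_big u predT)//=.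
apply: eq_bigr => b _; rewrite -(h b true).
by apply: eq_bigl => f; rewrite eqb_id andbC.
Qed.

(** Given only the restriction of the composed function, its [k] arguments are no longer
    independent. The new space therefore keeps the information on each argument separately: given
    it, their values at [x] are independent Bernoulli variables, and [alpha] is true with
    probability [ext]. *)
Lemma represents_step i S x T nu p u : @represents i S x T nu p u ->
  represents i.+1 S x (@prod_mass R T k nu) (ext_ffun (connective alpha) p)
    (fun g => compose alpha [ffun j => u (g j)]).
Proof.
move=> h b c.
pose r1 (f : boolfun n) := (restr S f, f x).
pose r2 (t : T * bool) := (u t.1, t.2).
pose E (z : {ffun 'I_k -> boolfun n * bool}) :=
  (compose alpha [ffun j => (z j).1] == b) && (alpha [ffun j => (z j).2] == c).
rewrite growth_probS (eq_iid_prob (w' := growth mu alpha i) (E' := fun g => E [ffun j => r1 (g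
    j)]))//; last first.
  move=> g; rewrite restr_compose /E /=; congr (_ && _).
    by congr (compose alpha _ == b); apply/ffunP => j; rewrite !ffunE.
  by rewrite ffunE; congr (alpha _ == c); apply/ffunP => j; rewrite !ffunE.
rewrite iid_prob_push.
rewrite (eq_iid_prob (w' := fun v => \sum_(t | r2 t == v) nu t.1 * bernoulli_pmf (p t.1) t.2)
    (E' := E))//; last first.
  move=> [b' c']; rewrite -[LHS]/(growth_prob _ _ _ _) (h b' c').
  transitivity (\sum_(c'' | c'' == c') \sum_(t | u t == b') nu t * bernoulli_pmf (p t) c'').
    by rewrite big_pred1_eq.
  by rewrite exchange_big pair_big; apply: eq_bigl => t.
rewrite -iid_prob_push /iid_prob.
pose split (a : {ffun 'I_k -> T} * {ffun 'I_k -> bool}) : {ffun 'I_k -> T * bool} :=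
  [ffun j => (a.1 j, a.2 j)].
rewrite (reindex split) /=; last first.
  exists (fun z => ([ffun j => (z j).1], [ffun j => (z j).2])) => [[g y] _|z _]; rewrite /split /=.
    by congr (_, _); apply/ffunP => j; rewrite !ffunE.
  by apply/ffunP => j; rewrite !ffunE; case: (z j).
rewrite (eq_bigl (fun a : {ffun 'I_k -> T} * {ffun 'I_k -> bool} =>
    (compose alpha [ffun j => u (a.1 j)] == b) && (alpha a.2 == c))); last first.
  move=> a; rewrite /E; congr (_ && _).
    by congr (compose alpha _ == b); apply/ffunP => j; rewrite !ffunE.
  by congr (alpha _ == c); apply/ffunP => j; rewrite !ffunE.
rewrite -(pair_big (fun g : {ffun 'I_k -> T} => compose alpha [ffun j => u (g j)] == b) (fun y
    => alpha y == c)
   (fun g (y : {ffun 'I_k -> bool}) => \prod_(j < k) (nu (split (g, y) j).1 * bernoulli_pmf (p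
       (split (g, y) j).1) (split (g, y) j).2))) /=.
apply: eq_bigr => g _; rewrite /ext_ffun -map_comp.
have cE : bernoulli_pmf (ext (connective alpha) [seq (p \o g) j | j <- enum 'I_k]) c
   = \sum_(y | alpha y == c) \prod_(j < k) bernoulli_pmf (p (g j)) (y j).
  transitivity (ext (fun l => (~~ c)%:R * 1 + (if c then 1 else -1) * connective alpha l)
      [seq (p \o g) j | j <- enum 'I_k]).
    rewrite ext_lin ext_const /bernoulli_pmf; case: (c) => /=; ring.
  rewrite -(sum_bernoulli (p \o g)) [RHS]big_mkcond; apply: eq_bigr => y _ /=.
  rewrite connectiveE; case: (alpha y); case: (c) => /=; ring.
rewrite cE mulr_sumr; apply: eq_bigr => y _.
rewrite /prod_mass -big_split /=; apply: eq_bigr => j _.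
by rewrite !ffunE.
Qed.

(** Where the restriction of [f] has probability zero, the quotient is 0 by convention; such [f]
    carry no mass. *)
Definition cond_prob i S x (f : boolfun n) : R :=
  growth_prob alpha mu i (fun g => (restr S g == restr S f) && g x)
  / growth_prob alpha mu i (fun g => restr S g == restr S f).

Lemma cond_prob01 i S x f : in01 (cond_prob i S x f).
Proof.
have h := growth_prob_ge0 alpha mu0 i.
rewrite /in01 /cond_prob divr_ge0 ?h//=.
have := growth_prob_sub alpha mu0 i (P := fun g => (restr S g == restr S f) && g x)
  (Q := fun g => restr S g == restr S f) (fun g gP => (andP gP).1).
have := h (fun g => restr S g == restr S f).
rewrite le_eqVlt => /orP[/eqP <-|D0]; first by rewrite invr0 mulr0.
by rewrite ler_pdivrMr// mul1r.
Qed.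

Lemma represents_cond_prob i S x :
  represents i S x (growth mu alpha i) (cond_prob i S x) (restr S).
Proof.
have h := growth_prob_ge0 alpha mu0 i.
move=> b c; set N := fun c => growth_prob alpha mu i (fun f => (restr S f == b) && (f x == c)).
set D := growth_prob alpha mu i (fun f => restr S f == b).
have ND : N true + N false = D.
  rewrite /D /N /growth_prob [RHS](bigID (fun f : boolfun n => f x)) /=; congr (_ + _).
    by apply: eq_bigl => f; rewrite eqb_id.
  by apply: eq_bigl => f; rewrite eqbF_neg.
have pE f : restr S f == b -> cond_prob i S x f = N true / D.
  move=> /eqP fb; rewrite /cond_prob fb /D /N; congr (_ / _).
  by apply: eq_bigl => g; rewrite eqb_id.
rewrite (eq_bigr (fun f => growth mu alpha i f * bernoulli_pmf (N true / D) c)); last first.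
  by move=> f /pE ->.
rewrite -mulr_suml -/(growth_prob alpha mu i _) -/D -/(N c).
have N0 c' : 0 <= N c' by apply: h.
have [D0|D0] := eqVneq D 0.
  rewrite D0 mul0r; apply/eqP; rewrite eq_le N0 andbT -D0 -ND.
  by case: c; rewrite ?lerDl ?lerDr N0.
have DN : D * (N true / D) = N true by rewrite mulrC divfK.
by rewrite /bernoulli_pmf; case: c; rewrite ?mulrBr DN// mulr1 -ND addrC addKr.
Qed.

Lemma biased_cond_prob i S x :
  biased (point_prob alpha mu i x) (growth mu alpha i) (cond_prob i S x).
Proof.
split; first exact: growth_ge0.
- exact: growth_sum1.
- exact: cond_prob01.
- exact: represents_mean (represents_cond_prob i S x).
Qed.

(** The deficit of the variance is the mean of [p * (1 - p)]. The restriction [b] alone contributes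
    [N * M / (N + M)], where [N] and [M] are the probabilities of [b] with the value true or false
    at [x]. *)
Lemma variance_cond_prob i S x (E1 E2 : pred (boolfun n)) b (s := point_prob alpha mu i x) :
  (forall f, E1 f -> restr S f = b /\ f x) ->
  (forall f, E2 f -> restr S f = b /\ ~~ f x) ->
  variance s (growth mu alpha i) (cond_prob i S x)
    <= s * (1 - s) - growth_prob alpha mu i E1 * growth_prob alpha mu i E2.
Proof.
move=> hE1 hE2; have [nu0 nu1 p01 nus] := biased_cond_prob i S x.
set nu := growth mu alpha i in nu0 nu1 nus *; set p := cond_prob i S x in p01 nus *.
have -> : variance s nu p = s * (1 - s) - \sum_f nu f * (p f * (1 - p f)).
  rewrite /variance (eq_bigr (fun f => nu f * p f - 2 * s * (nu f * p f) + s ^+ 2 * nu f - nu f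
      * (p f * (1 - p f)))); last first.
    by move=> f _; ring.
  by rewrite !big_split/= !sumrN -!mulr_sumr nu1 nus -/s; ring.
rewrite lerD2l lerN2.
set N := growth_prob alpha mu i (fun f => (restr S f == b) && f x).
set M := growth_prob alpha mu i (fun f => (restr S f == b) && ~~ f x).
have e1 : growth_prob alpha mu i E1 <= N.
  by apply: growth_prob_sub => // f /hE1[-> ->]; rewrite eqxx.
have e2 : growth_prob alpha mu i E2 <= M.
  by apply: growth_prob_sub => // f /hE2[-> ->]; rewrite eqxx.
have g0 := growth_prob_ge0 alpha mu0 i.
apply: (@le_trans _ _ (N * M)); first by rewrite ler_pM.
set D := growth_prob alpha mu i (fun f => restr S f == b).
have NMD : D = N + M by rewrite /D /growth_prob [LHS](bigID (fun f : boolfun n => f x)).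
have D1 : D <= 1 by apply: growth_prob_le1.
apply: (@le_trans _ _ (\sum_(f | restr S f == b) nu f * (p f * (1 - p f)))); last first.
  rewrite [leRHS](bigID (fun f => restr S f == b)) /= lerDl; apply: sumr_ge0 => f _.
  by case/andP: (p01 f) => ? ?; rewrite mulr_ge0 ?nu0// mulr_ge0// subr_ge0.
rewrite (eq_bigr (fun f => nu f * (N / D * (1 - N / D)))); last first.
  by move=> f /eqP fb; rewrite /p /cond_prob fb.
rewrite -mulr_suml -/(growth_prob alpha mu i _) -/D.
have [D0|D0] := eqVneq D 0.
  have N0 : N = 0 by have := g0 (fun f => (restr S f == b) && f x); have := g0 (fun f => (restr
      S f == b) && ~~ f x); rewrite -/N -/M; lra.
  by rewrite N0 D0 !mul0r.
have Dp : 0 < D by rewrite lt_neqAle eq_sym D0 g0.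
have -> : D * (N / D * (1 - N / D)) = N * M / D by rewrite NMD in D0 *; field.
by rewrite ler_pdivlMr// ler_piMr// mulr_ge0 ?g0.
Qed.

End Representation.

(** * Monotone connectives that are not projections *)

Section Connective.
Context {R : realType}.
Variables (k : nat) (alpha : boolfun k).
Hypothesis alpha_mono : monotone_boolfun alpha.
Implicit Types (x : {ffun 'I_k -> bool}) (s p : R).

Lemma connective_mono : mono (connective (R := R) alpha).
Proof.
move=> l l' ll'; rewrite /connective ler_nat.
case e : (alpha [ffun j : 'I_k => nth false l j]) => //.
by rewrite (alpha_mono _ e)// => j; rewrite !ffunE; apply: ll'.
Qed.

Lemma ext_nth k' j s : (j < k')%N ->
  ext (fun l => (nth false l j)%:R) (nseq k' s) = s.
Proof.
elim: k' j => [//|k' IH] [|j] jk; rewrite [nseq _ _]/= ext_cons /=.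
  by rewrite !ext_const; ring.
by rewrite IH//; ring.
Qed.

(** [alpha] and the coordinate [j] have the same mean [s] under a product measure of full support;
    if one dominates the other, they coincide. *)
Lemma connective_eq_proj s j : 0 < s < 1 -> ext (connective alpha) (nseq k s) = s ->
  (forall x, x j -> alpha x) \/ (forall x, alpha x -> x j) -> alpha = projection j.
Proof.
move=> /andP[s0 s1] fs h.
pose w x : R := \prod_(i < k) bernoulli_pmf s (x i).
have w0 x : 0 < w x.
  by apply: prodr_gt0 => i _; rewrite /bernoulli_pmf; case: (x i); rewrite ?subr_gt0.
have e1 : \sum_x w x * ((alpha x)%:R - (x j)%:R) = 0.
  under eq_bigr do rewrite mulrBr; rewrite sumrB.
  under eq_bigr do rewrite -connectiveE.
  rewrite (sum_bernoulli (fun=> s)) -nseq_enum_ord fs.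
  rewrite (eq_bigr (fun x => w x * (nth false [seq x i | i <- enum 'I_k] j)%:R)); last first.
    by move=> x _; rewrite (nth_map j) ?size_enum_ord// nth_ord_enum.
  by rewrite (sum_bernoulli (fun=> s) (fun l => (nth false l j)%:R)) -nseq_enum_ord ext_nth// subrr.
have key (F : {ffun 'I_k -> bool} -> R) : (forall x, 0 <= F x) ->
    \sum_x w x * F x = 0 -> forall x, F x = 0.
  move=> F0 e x; have /eqP := psumr_eq0P (fun y _ => mulr_ge0 (ltW (w0 y)) (F0 y)) e (i := x) isT.
  by rewrite mulf_eq0 gt_eqF//= => /eqP.
apply/ffunP => x; rewrite [RHS]ffunE; apply/eqP; case: h => h.
  have : (alpha x)%:R - (x j)%:R = 0 :> R.
    apply: (key (fun x => (alpha x)%:R - (x j)%:R)) e1 x => y; rewrite subr_ge0 ler_nat.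
    by case e : (y j) => //; rewrite h.
  by move/eqP; rewrite subr_eq0 eqr_nat; case: (alpha x) (x j) => [] [].
have e2 : \sum_x w x * ((x j)%:R - (alpha x)%:R) = 0.
  transitivity (- \sum_x w x * ((alpha x)%:R - (x j)%:R)); last by rewrite e1 oppr0.
  by rewrite -sumrN; apply: eq_bigr => y _; ring.
have : (x j)%:R - (alpha x)%:R = 0 :> R.
  apply: (key (fun x => (x j)%:R - (alpha x)%:R)) e2 x => y; rewrite subr_ge0 ler_nat.
  by case e : (alpha y) => //; rewrite h.
by move/eqP; rewrite subr_eq0 eqr_nat; case: (alpha x) (x j) => [] [].
Qed.

Definition single j : {ffun 'I_k -> bool} := [ffun i => i == j].
Definition cosingle j : {ffun 'I_k -> bool} := [ffun i => i != j].

Section NonProjection.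
Variable s : R.
Hypothesis s01 : 0 < s < 1.
Hypothesis fs : ext (connective alpha) (nseq k s) = s.
Hypothesis nproj : forall j, alpha <> projection j.

Lemma alpha_single j : alpha (single j) = false.
Proof.
apply/negP => h; apply: (nproj (j := j)); apply: connective_eq_proj s01 fs _; left=> x xj.
by apply: (alpha_mono _ h) => i; rewrite ffunE => /eqP ->.
Qed.

Lemma alpha_cosingle j : alpha (cosingle j) = true.
Proof.
apply: contrapT => h; apply: (nproj (j := j)); apply: connective_eq_proj s01 fs _; right=> x ax.
apply: contrapT => xj; apply: h; apply: (alpha_mono _ ax) => i xi; rewrite ffunE.
by apply/eqP => ij; apply: xj; rewrite -ij.
Qed.

(** With at most two inputs, [cosingle j0] lies below some [single j1], although [alpha] is true at
    the former and false at the latter. *)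
Lemma arity_gt2 : (2 < k)%N.
Proof.
rewrite ltnNge; apply/negP => k2.
have k0 : (0 < k)%N.
  rewrite lt0n; apply/eqP => k0; move: fs s01; have -> : nseq k s = [::] by rewrite k0.
  by rewrite /=; case: (connective_boolean (R := R) alpha [::]) => -> <-; rewrite ltxx ?andbF.
pose j0 := Ordinal k0.
have [j1 hj1] : exists j1 : 'I_k, forall i, i != j0 -> i == j1.
  have k1 : (k.-1 < k)%N by rewrite prednK.
  exists (Ordinal k1) => i; rewrite -!val_eqE /= => i0.
  rewrite eqn_leq -ltnS prednK// ltn_ord /=.
  by apply: leq_trans (_ : 1 <= _)%N; rewrite ?lt0n// -ltnS prednK.
have := alpha_single j1; rewrite (alpha_mono _ (alpha_cosingle j0))// => i.
by rewrite !ffunE; apply: hj1.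
Qed.

Let k_gt0 : (0 < k)%N := ltnW (ltnW arity_gt2).

Lemma alpha_false : alpha [ffun=> false] = false.
Proof.
apply/negP => h; have := alpha_single (Ordinal k_gt0); rewrite (alpha_mono _ h)// => i.
by rewrite ffunE.
Qed.

Lemma alpha_true : alpha [ffun=> true] = true.
Proof. by apply: (alpha_mono _ (alpha_cosingle (Ordinal k_gt0))) => i; rewrite !ffunE. Qed.

Lemma connective_single j : (j < k)%N -> connective alpha (rcons (nseq j false) true) = 0 :> R.
Proof.
move=> jk; rewrite /connective (_ : [ffun _ => _] = single (Ordinal jk)) ?alpha_single//.
apply/ffunP => i; rewrite !ffunE nth_rcons size_nseq nth_nseq if_same -val_eqE /=.
by case: ltngtP.
Qed.

Lemma connective_cosingle j : (j < k)%N ->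
  connective alpha (nseq j true ++ false :: nseq (k - j.+1) true) = 1 :> R.
Proof.
move=> jk; rewrite /connective (_ : [ffun _ => _] = cosingle (Ordinal jk)) ?alpha_cosingle//.
apply/ffunP => i; rewrite !ffunE nth_cat size_nseq nth_nseq -val_eqE /=.
case: (ltngtP i j) => // [ij|->]; last by rewrite subnn.
rewrite -[(i - j)%N]prednK ?subn_gt0//= nth_nseq.
by have -> : ((i - j).-1 < k - j.+1)%N by move: (ltn_ord i) ij; clear; lia.
Qed.

Let fb := connective_boolean (R := R) alpha.
Let fm := connective_mono.

Lemma connective_infl j : (j < k)%N -> infl s k j (connective alpha) <= 1 - 2 * 2^-1 ^+ k.
Proof.
exact: (infl_le_gap s01 arity_gt2 fb fm connective_single connective_cosingle).
Qed.

Lemma connective_infl_sq : infl_sq s k (connective alpha) <= 1 - 3 / 2 * 2^-1 ^+ k.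
Proof.
exact: (infl_sq_gap s01 arity_gt2 fb fm fs connective_single connective_cosingle).
Qed.

Lemma connective_infl_sum : 1 + 3 / 2 * 2^-1 ^+ k <= infl_sum s k (connective alpha).
Proof.
exact: (infl_sum_gap s01 arity_gt2 fb fm fs connective_single connective_cosingle).
Qed.

(** Each of the at most [2 ^ k] true assignments has two ones, hence probability at most [p ^ 2].
    This gives the final squaring near 0. *)
Lemma connective_le_sq p : in01 p -> ext (connective alpha) (nseq k p) <= 2 ^+ k * p ^+ 2.
Proof.
move=> /andP[p0 p1]; rewrite -characteristic_poly_ext /characteristic_poly /iid_prob.
have -> : 2 ^+ k * p ^+ 2 = \sum_(x : {ffun 'I_k -> bool}) p ^+ 2.
  by rewrite sumr_const card_ffun card_bool card_ord -[RHS]mulr_natl natrX.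
rewrite big_mkcond; apply: ler_sum => x _; case: ifPn => [ax|_]; last exact: sqr_ge0.
have [j1 xj1] : exists j, x j.
  apply: contrapT => nx; have := alpha_false; rewrite (alpha_mono _ ax)// => j xj.
  by exfalso; apply: nx; exists j.
have [j2 j21 xj2] : exists2 j, j != j1 & x j.
  apply: contrapT => nx; have := alpha_single j1; rewrite (alpha_mono _ ax)// => j xj.
  by rewrite ffunE; apply: contrapT => /negP jj; apply: nx; exists j.
rewrite (bigD1 j1)//= (bigD1 j2)//= /bernoulli_pmf xj1 xj2 mulrA -expr2.
rewrite ler_piMr ?sqr_ge0//; apply: prodr_ile1 => j _.
by case: (x j); rewrite ?p0 ?p1//; apply/andP; split; lra.
Qed.

End NonProjection.

Lemma ext_nseq_homo f p q m : mono f -> in01 p -> in01 q -> p <= q ->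
  ext f (nseq m p) <= ext f (nseq m q).
Proof.
move=> fm p01 q01 pq; elim: m f fm => [//|m IH] f fm /=.
apply: le_trans (IH _ (mono_mix p01 fm)) _.
apply: ext_homo; first exact: all_in01_nseq.
by move=> l; have := mono_diff fm l; rewrite /diff /mix; nra.
Qed.

Lemma ext_nseq_cvg f (u : nat -> R) (L : R) m : (u @ \oo --> L)%classic ->
  ((fun i => ext f (nseq m (u i))) @ \oo --> ext f (nseq m L))%classic.
Proof.
move=> uL; elim: m f => [|m IH] f; first exact: cvg_cst.
rewrite [nseq _ _]/= ext_cons.
under eq_fun do rewrite [nseq _ _]/= ext_cons.
apply: cvgD; apply: cvgM => //; apply: cvgB => //; exact: cvg_cst.
Qed.

End Connective.

(** * Orbits of the characteristic polynomial *)

Section BelowFixpoint.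
Local Open Scope classical_set_scope.
Context {R : realType}.
Variables (k : nat) (alpha : boolfun k) (s : R).
Hypothesis alpha_mono : monotone_boolfun alpha.
Hypothesis s01 : 0 < s < 1.
Hypothesis nproj : forall j, alpha <> projection j.
Let f := connective (R := R) alpha.
Hypothesis fs : ext f (nseq k s) = s.
Let A p := ext f (nseq k p).

Let fb : boolean f := connective_boolean alpha.
Let fm : mono f := connective_mono alpha_mono.

Lemma in01_open (p : R) : 0 < p < 1 -> in01 p.
Proof. by move=> /andP[/ltW p0 /ltW p1]; rewrite /in01 p0. Qed.

Lemma fixpoint_expansion t p : 0 < t < 1 -> A t = t -> in01 p ->
  `|A p - t - (p - t) * infl_sum t k f| <= 4 * k%:R ^+ 2 * `|p - t| ^+ 2.
Proof.
move=> t01 ft p01; have := ext_expansion t01 k (in01_bounded (boolean01 fb)) p01.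
by rewrite -/(A p) -/(A t) ft mulr1.
Qed.

(** With [r] the ratio of the odds of [p] to those of [s], [ext_odds_le] bounds the odds of [A p] by
    [r] times those of [s], that is by those of [p]. *)
Lemma iterate_le p : 0 < p < s -> A p <= p.
Proof.
move=> /andP[p0 ps]; move: (s01) => /andP[s0 s1].
pose r := p * (1 - s) / (s * (1 - p)).
have D0 : 0 < s * (1 - p) by rewrite mulr_gt0// subr_gt0 (lt_trans ps).
have r0 : 0 < r by rewrite divr_gt0// mulr_gt0// subr_gt0.
have r1 : r <= 1 by rewrite ler_pdivrMr// mul1r; lra.
have rD : r * (s * (1 - p)) = p * (1 - s) by rewrite divfK ?gt_eqF.
have pr : p * (1 - (1 - r) * s) = r * s by move: rD; lra.
have := ext_odds_le s01 k fb fm (p := p) (r := r); rewrite r0 r1 => /(_ isT pr) /=.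
rewrite fs -pr ler_pM2r//; nra.
Qed.

(** A fixpoint [p] below [s] would itself have slope greater than 1 by the gap at bias [p], so that
    [A] would exceed the identity just above [p], against [iterate_le]. *)
Lemma iterate_lt p : 0 < p < s -> A p < p.
Proof.
move=> ps; rewrite lt_neqAle iterate_le// andbT; apply/eqP => Ap.
move: (ps) (s01) => /andP[p0 p1] /andP[s0 s1].
have p01 : 0 < p < 1 by rewrite p0 (lt_trans p1).
have G := connective_infl_sum alpha_mono p01 Ap nproj.
set h : R := 3 / 2 * 2^-1 ^+ k in G.
have h0 : 0 < h by rewrite mulr_gt0// exprn_gt0.
pose M : R := 4 * k%:R ^+ 2 + 1.
have M1 : 1 <= M by rewrite /M lerDr mulr_ge0// sqr_ge0.
have [d [d0 dh ds]] : exists d : R, [/\ 0 < d, M * d < h & d < s - p].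
  pose m := Num.min h (s - p).
  have m0 : 0 < m by rewrite lt_min h0 subr_gt0.
  exists (m / (2 * M)); split; first by rewrite divr_gt0// mulr_gt0//; lra.
    have -> : M * (m / (2 * M)) = m / 2 by field; lra.
    have : m <= h by rewrite ge_min lexx.
    lra.
  have : m <= s - p by rewrite ge_min lexx orbT.
  rewrite ltr_pdivrMr; last lra.
  nra.
have q01 : in01 (p + d) by apply/andP; split; lra.
have := fixpoint_expansion p01 Ap q01; rewrite [p + d - p]addrAC subrr add0r (gtr0_norm d0)//.
rewrite ler_norml => /andP[+ _].
have qs : 0 < p + d < s by apply/andP; split; lra.
have := iterate_le qs; move: (A _) (infl_sum _ _ _) G => a g G h1.
have : d * (1 + h) <= d * g by rewrite ler_pM2l.
have : d * (M * d) < d * h by rewrite ltr_pM2l.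
by rewrite /M; nra.
Qed.

Lemma iterate0 : A 0 = 0.
Proof.
have := connective_le_sq alpha_mono s01 fs nproj (p := 0); rewrite expr0n/= mulr0 -/f -/(A 0).
rewrite /in01 lexx ler01 => /(_ isT) h; apply/eqP; rewrite eq_le h/=.
by apply: ext_ge => [|l]; [apply: all_in01_nseq; rewrite /in01 lexx ler01|case: (fb l) => ->].
Qed.

Lemma iterate_decr p : 0 <= p < s -> 0 <= A p <= p.
Proof.
move=> /andP[p0 ps]; have p01 : in01 p.
  by rewrite /in01 p0; move: s01 => /andP[_ /ltW]; apply: le_trans (ltW ps).
apply/andP; split.
  by apply: ext_ge => [|l]; [exact: all_in01_nseq|case: (fb l) => ->].
move: p0; rewrite le_eqVlt => /orP[/eqP <-|p0]; first by rewrite iterate0.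
by apply: iterate_le; rewrite p0.
Qed.

Section Orbit.
Variable z : nat -> R.
Hypothesis zS : forall i, z i.+1 = A (z i).
Hypothesis z0 : 0 <= z 0%N < s.

Lemma orbit_bounds i : 0 <= z i < s.
Proof.
elim: i => [//|i IH]; rewrite zS; have /andP[-> h] := iterate_decr IH.
by case/andP: IH => _; apply: le_lt_trans.
Qed.

Lemma orbit_decr i j : (i <= j)%N -> z j <= z i.
Proof.
move=> /subnK <-; elim: (j - i)%N => [//|m IH]; apply: le_trans IH.
by rewrite addSn zS; case/andP: (iterate_decr (orbit_bounds (m + i))).
Qed.

Lemma orbit_cvg0 : z @ \oo --> 0.
Proof.
have zc : cvgn z.
  apply: nonincreasing_is_cvgn; first by apply/nonincreasing_seqP => i; exact: orbit_decr.
  by exists 0 => _ [i _ <-]; case/andP: (orbit_bounds i).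
have h1 : (fun i => z i.+1) @ \oo --> limn z by rewrite cvg_shiftS.
have h2 : (fun i => z i.+1) @ \oo --> A (limn z).
  by under eq_fun do rewrite zS; apply: ext_nseq_cvg.
have fix_lim : A (limn z) = limn z by apply: cvg_unique h2 h1.
have L0 : 0 <= limn z by apply: limr_ge => //; near=> i; case/andP: (orbit_bounds i).
have L1 : limn z < s.
  case/andP: z0 => _; apply: le_lt_trans.
  by apply: limr_le => //; near=> i; apply: orbit_decr.
suff -> : 0 = limn z by [].
move: L0; rewrite le_eqVlt => /orP[/eqP//|L0].
by have := iterate_lt (p := limn z); rewrite L0 L1 fix_lim ltxx => /(_ isT).
Unshelve. all: by end_near.
Qed.

End Orbit.

Let h : R := 2^-1 ^+ k.

(** The strict inequality on [y] leaves room for the quadratic error of [fixpoint_expansion] near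
    [s]. *)
Lemma iterate_escape (y : R) : y < 3 / 2 * h -> exists2 e : R, 0 < e < s &
  forall p, 0 <= p < s -> s - p <= e -> (1 + y) * (s - p) <= s - A p.
Proof.
move=> yh; move: (s01) => /andP[s0 s1].
have G := connective_infl_sum alpha_mono s01 fs nproj; rewrite -/h -/f in G.
pose M : R := 4 * k%:R ^+ 2 + 1.
have M1 : 1 <= M by rewrite /M lerDr mulr_ge0// sqr_ge0.
pose m := Num.min (3 / 2 * h - y) s.
have m0 : 0 < m by rewrite lt_min subr_gt0 yh.
have mh : m <= 3 / 2 * h - y by rewrite ge_min lexx.
have ms : m <= s by rewrite ge_min lexx orbT.
exists (m / (2 * M)).
  rewrite divr_gt0 ?mulr_gt0//=; last lra.
  rewrite ltr_pdivrMr; last lra.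
  nra.
move=> p /andP[p0 ps]; rewrite ler_pdivlMr; last lra.
move=> pe; have p01 : in01 p by apply/andP; split; lra.
have := fixpoint_expansion s01 fs p01; rewrite [`|p - s|]distrC (gtr0_norm (x := s - p))
    ?subr_gt0//.
rewrite ler_norml => /andP[_].
set d := s - p in pe *; have d0 : 0 < d by rewrite subr_gt0.
have -> : p - s = - d by rewrite /d; ring.
move: (A p) (infl_sum _ _ _) G => a g G hyp.
have : d * (1 + 3 / 2 * h) <= d * g by rewrite ler_pM2l.
have : d * (d * (2 * M)) <= d * (3 / 2 * h - y).
  by rewrite ler_pM2l// (le_trans pe).
by rewrite /M in hyp *; move: hyp; nra.
Qed.

(** By Bernoulli's inequality, [N] steps at rate [1 + 1 / N] at least double; all step counts rest
    on this. *)
Lemma bernoulli_pow (N M : nat) : (0 < N)%N -> 2 ^+ M <= (1 + N%:R^-1) ^+ (N * M) :> R.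
Proof.
move=> N0; rewrite exprM; apply: lerXn2r; rewrite ?nnegrE ?exprn_ge0 ?addr_ge0//.
have : forall m, 1 + m%:R * N%:R^-1 <= (1 + N%:R^-1) ^+ m :> R.
  elim=> [|m IH]; first by rewrite mul0r addr0 expr0.
  rewrite exprS -natr1; have : 0 <= N%:R^-1 :> R by [].
  have : 0 <= m%:R * N%:R^-1 ^+ 2 :> R by rewrite mulr_ge0// sqr_ge0.
  nra.
by move=> /(_ N); rewrite divff ?pnatr_eq0 -?lt0n.
Qed.

(** Three phases: [N * (k * M + c1)] steps until the distance to [s] reaches [e], then [c2] steps to
    come near 0, then [M + 1] squarings. *)
Lemma escape_rate (N : nat) (C : R) : (0 < N)%N -> N%:R^-1 < 3 / 2 * h -> 0 < C ->
  exists c, forall M (z : nat -> R), (forall i, z i.+1 = A (z i)) ->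
    0 <= z 0%N -> z 0%N <= s - C * 2^-1 ^+ (k * M) ->
    forall i, (N * (k * M) + M + c <= i)%N -> 0 <= z i <= 2^-1 ^+ (2 ^ M.+2).
Proof.
move=> N0 Nh C0; have [e /andP[e0 es] he] := iterate_escape Nh.
have [c1 hc1] : exists c1 : nat, e <= C * 2 ^+ c1.
  have [c1 hc1] : exists c1 : nat, e / C <= c1%:R.
    by exists (Num.bound (e / C)); apply/ltW/archi_boundP; rewrite divr_ge0// ltW.
  exists c1; rewrite mulrC -ler_pdivrMr//; apply: le_trans hc1 _.
  by rewrite -natrX ler_nat ltnW// ltn_expl.
(* The orbit of [s - e] dominates every orbit that has reached [s - e], so one waiting time [c2]
   serves them all. *)
pose w := fix w i : R := if i is i'.+1 then A (w i') else s - e.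
have w0 : 0 <= w 0%N < s by rewrite /= subr_ge0 (ltW es) gtrBl.
have wc := orbit_cvg0 (fun=> erefl) w0.
pose q : R := 4^-1 * h.
have h0 : 0 < h by rewrite exprn_gt0.
have h1 : h <= 1 by rewrite exprn_ile1 ?invr_ge0 ?invf_le1 ?ler1n.
have q0 : 0 < q by rewrite mulr_gt0.
have [c2 hc2] : exists c2, w c2 <= q.
  have [c2 _ hc2] := cvgr_le _ wc _ q0; exists c2; apply: hc2; exact: leqnn.
exists (N * c1 + c2 + 1)%N; move=> M z zS z0 zM i hi.
have C1 : 0 < C * 2^-1 ^+ (k * M) by rewrite mulr_gt0// exprn_gt0.
have z0s : 0 <= z 0%N < s by rewrite z0; lra.
have zb := orbit_bounds zS z0s; have zd := orbit_decr zS z0s.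
set i1 := (N * (k * M + c1))%N.
have z1 : z i1 <= s - e.
  rewrite lerBrDl -lerBrDr.
  have : forall m, e <= s - z m \/ (1 + N%:R^-1) ^+ m * (C * 2^-1 ^+ (k * M)) <= s - z m.
    elim=> [|m [IH|IH]]; first by right; rewrite expr0 mul1r; lra.
      by left; apply: le_trans IH _; rewrite lerD2l lerN2 zd.
    have [em|em] := leP e (s - z m).
      by left; apply: le_trans em _; rewrite lerD2l lerN2 zd.
    right; rewrite exprS -mulrA; apply: le_trans (_ : (1 + N%:R^-1) * (s - z m) <= _).
      by rewrite ler_pM2l// ltr_pwDl.
    by rewrite zS; apply: he => //; apply: ltW.
  move=> /(_ i1) [//|]; apply: le_trans.
  apply: (@le_trans _ _ (2 ^+ (k * M + c1) * (C * 2^-1 ^+ (k * M)))); last first.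
    by rewrite ler_pM2r// bernoulli_pow.
  have P0 : 2 ^+ (k * M) != 0 :> R by rewrite expf_neq0.
  suff -> : 2 ^+ (k * M + c1) * (C * 2^-1 ^+ (k * M)) = C * 2 ^+ c1 :> R by [].
  by rewrite exprD exprVn; field.
have zw m : z (m + i1)%N <= w m.
  elim: m => [//|m IH]; rewrite addSn zS /=; apply: ext_nseq_homo => //.
    by case/andP: (zb (m + i1)%N) => a b; rewrite /in01 a ltW// (lt_trans b)//; case/andP: s01.
  case/andP: (orbit_bounds (fun=> erefl) w0 m) => a b.
  by rewrite /in01 a ltW// (lt_trans b)//; case/andP: s01.
(* By [connective_le_sq] the next value of [h^-1 * z] is at most its square; the choice of [q] makes
   it start at 1/4 or less. *)
have zq m : h^-1 * z (m + (c2 + i1))%N <= 2^-1 ^+ (2 ^ m.+1).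
  elim: m => [|m IH].
    rewrite add0n ler_pdivrMl//; apply: le_trans (zw c2) _; apply: le_trans hc2 _.
    by rewrite /q expn1 expr2; lra.
  rewrite addSn zS expnS mulnC exprM.
  set v := z _ in IH *; case/andP: (zb (m + (c2 + i1))%N) => v0 vs.
  have v01 : in01 v by rewrite /in01 v0 ltW// (lt_trans vs)//; case/andP: s01.
  have := connective_le_sq alpha_mono s01 fs nproj v01; rewrite -/f -/(A v).
  have -> : 2 ^+ k = h^-1 :> R by rewrite /h exprVn invrK.
  move=> hA; apply: (@le_trans _ _ ((h^-1 * v) ^+ 2)).
    have -> : (h^-1 * v) ^+ 2 = h^-1 * (h^-1 * v ^+ 2) by ring.
    by rewrite ler_pM2l ?invr_gt0.
  by apply: lerXn2r; rewrite ?nnegrE ?exprn_ge0// mulr_ge0 ?invr_ge0 ?(ltW h0).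
case/andP: (zb i) => zi _; rewrite zi /=.
apply: (@le_trans _ _ (z (M.+1 + (c2 + i1))%N)).
  by apply: zd; rewrite /i1; move: hi; clear; nia.
apply: le_trans (zq M.+1); rewrite ler_peMl//; first by case/andP: (zb (M.+1 + (c2 + i1))%N).
by rewrite invf_ge1.
Qed.

End BelowFixpoint.

(** * De Morgan duality, which carries estimates below the fixpoint to estimates above it *)

Section Dual.
Context {R : realType}.
Variables (k : nat) (alpha : boolfun k).

Definition negb_ffun (x : {ffun 'I_k -> bool}) : {ffun 'I_k -> bool} := [ffun j => ~~ x j].

Lemma negb_ffunK : involutive negb_ffun.
Proof. by move=> x; apply/ffunP => j; rewrite !ffunE negbK. Qed.

Definition dual : boolfun k := [ffun x => ~~ alpha (negb_ffun x)].

Lemma dual_mono : monotone_boolfun alpha -> monotone_boolfun dual.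
Proof.
move=> am x y xy; rewrite !ffunE; apply: contraNN; apply: am => j.
by rewrite !ffunE; apply: contraNN; apply: xy.
Qed.

Lemma dual_nproj : (forall j, alpha <> projection j) -> forall j, dual <> projection j.
Proof.
move=> np j dj; apply: (np j); apply/ffunP => x.
have := congr1 (fun g : boolfun k => g (negb_ffun x)) dj.
by rewrite !ffunE negb_ffunK => /(congr1 negb); rewrite !negbK.
Qed.

Lemma ext_dual (p : R) :
  ext (connective dual) (nseq k (1 - p)) = 1 - ext (connective alpha) (nseq k p).
Proof.
rewrite -[1 in RHS](ext_const 1 (nseq k p)) !nseq_enum_ord.
rewrite -(sum_bernoulli (fun=> 1 - p)) -!(sum_bernoulli (fun=> p)) -sumrB.
rewrite (reindex_inj (inv_inj negb_ffunK)) /=; apply: eq_bigr => x _.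
rewrite !connectiveE ffunE negb_ffunK -mulrBr; congr (_ * _); last first.
  by case: (alpha x); rewrite ?subrr ?subr0.
by apply: eq_bigr => j _; rewrite ffunE /bernoulli_pmf; case: (x j) => //=; ring.
Qed.

End Dual.

Section Orbits.
Local Open Scope classical_set_scope.
Context {R : realType}.
Variables (k : nat) (alpha : boolfun k) (s : R).
Hypothesis alpha_mono : monotone_boolfun alpha.
Hypothesis s01 : 0 < s < 1.
Hypothesis nproj : forall j, alpha <> projection j.
Let f := connective (R := R) alpha.
Hypothesis fs : ext f (nseq k s) = s.
Let A p := ext f (nseq k p).

Let s01' : 0 < 1 - s < 1.
Proof. by move: s01; lra. Qed.

Let fs' : ext (connective (R := R) (dual alpha)) (nseq k (1 - s)) = 1 - s.
Proof. by rewrite ext_dual fs. Qed.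

Variable z : nat -> R.
Hypothesis zS : forall i, z i.+1 = A (z i).
Hypothesis z01 : in01 (z 0%N).
Hypothesis z0s : z 0%N != s.

Let dual_orbit i : 1 - z i.+1 = ext (connective (dual alpha)) (nseq k (1 - z i)).
Proof. by rewrite ext_dual zS. Qed.

Lemma orbit_cvg : z @ \oo --> ((s < z 0%N)%R%:R : R).
Proof.
move: z01 z0s => /andP[z0 z1]; rewrite neq_lt => /orP[zs|sz].
  by rewrite ltNge ltW//=; apply: (orbit_cvg0 alpha_mono s01 nproj fs zS); rewrite z0.
rewrite sz; have h : (fun i => 1 - z i) @ \oo --> (0 : R).
  apply: (orbit_cvg0 (dual_mono alpha_mono) s01' (dual_nproj nproj) fs' dual_orbit).
  by rewrite subr_ge0 z1 ltrD2l ltrN2.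
have -> : z = (fun i => 1 - (1 - z i)) by apply/funext => i; ring.
rewrite -[X in _ --> X]subr0; apply: cvgB => //; exact: cvg_cst.
Qed.

Lemma iterate_neq p : 0 < p < 1 -> p != s -> A p != p.
Proof.
move=> /andP[p0 p1]; rewrite neq_lt => /orP[ps|sp].
  by rewrite lt_eqF// (iterate_lt alpha_mono s01 nproj fs)// p0.
have := iterate_lt (dual_mono alpha_mono) s01' (dual_nproj nproj) fs' (p := 1 - p).
by rewrite subr_gt0 p1 ltrD2l ltrN2 sp ext_dual => /(_ isT); rewrite ltrD2l ltrN2 => /gt_eqF ->.
Qed.

End Orbits.

Lemma natr_dist_ge1 (R : realType) (a b : nat) : a != b -> 1 <= `|a%:R - b%:R : R|.
Proof.
by rewrite neq_ltn => /orP[h|h]; [rewrite distrC|]; rewrite -natrB ?(ltnW h)// normr_nat ler1n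
    subn_gt0.
Qed.

Section OrbitRate.
Context {R : realType}.
Variables (k : nat) (alpha : boolfun k) (s : R).
Hypothesis alpha_mono : monotone_boolfun alpha.
Hypothesis s01 : 0 < s < 1.
Hypothesis nproj : forall j, alpha <> projection j.
Let f := connective (R := R) alpha.
Hypothesis fs : ext f (nseq k s) = s.
Let A p := ext f (nseq k p).

(* [n ^ k * (A (w / n) - w / n)] is an integer, and does not vanish. *)
Lemma fixpoint_separation : exists2 C : R, 0 < C & forall n w : nat, (w <= n)%N -> (0 < n)%N ->
  w%:R / n%:R != s -> C / n%:R ^+ k <= `|w%:R / n%:R - s|.
Proof.
have k3 := arity_gt2 alpha_mono s01 fs nproj.
move: (s01) => /andP[s0 s1].
(* [2 * k + 1] is a Lipschitz bound for [A p - p] around [s]. The other two terms serve the weights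
   0 and [n]: their quotients are fixpoints of [A], where integrality gives nothing. *)
pose C : R := Num.min (2 * k%:R + 1)^-1 (Num.min s (1 - s)).
have k0 : 0 < 2 * k%:R + 1 :> R by rewrite ltr_wpDl.
have C0 : 0 < C by rewrite !lt_min invr_gt0 k0 s0 subr_gt0.
have C1 : C <= (2 * k%:R + 1)^-1 by rewrite ge_min lexx.
have C2 : C <= s by rewrite !ge_min lexx orbT.
have C3 : C <= 1 - s by rewrite !ge_min lexx !orbT.
exists C => // n w wn n0 ws; have nR : 0 < n%:R :> R by rewrite ltr0n.
have nk : 1 <= n%:R ^+ k :> R by rewrite exprn_ege1// ler1n.
have Cn : C / n%:R ^+ k <= C by rewrite ler_pdivrMr ?exprn_gt0// ler_peMr// ltW.
have [->|w0] := eqVneq w 0%N.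
  by rewrite mul0r sub0r normrN gtr0_norm// (le_trans Cn).
have [->|wn'] := eqVneq w n.
  by rewrite divff ?gt_eqF// gtr0_norm ?subr_gt0// (le_trans Cn).
set p := w%:R / n%:R in ws *.
have p01 : 0 < p < 1.
  apply/andP; split; first by rewrite divr_gt0// ltr0n lt0n.
  by rewrite ltr_pdivrMr// mul1r ltr_nat ltn_neqAle wn' wn.
have [m hm] : exists m : nat, A p * n%:R ^+ k = m%:R.
  rewrite /A; have := connective_boolean (R := R) alpha; rewrite -/f.
  elim: (k) (f) => [|k' IH] g gb.
    by rewrite /= expr0 mulr1; case: (gb [::]) => ->; [exists 0%N|exists 1%N].
  have [m1 hm1] := IH _ (fun l => gb (true :: l)).
  have [m0 hm0] := IH _ (fun l => gb (false :: l)).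
  exists (w * m1 + (n - w) * m0)%N; rewrite [nseq _ _]/= ext_cons exprS.
  rewrite natrD !natrM natrB// -hm1 -hm0 /p; field; exact: lt0r_neq0.
have hAp := iterate_neq alpha_mono s01 nproj fs p01 ws.
have pE : p * n%:R ^+ k = (w * n ^ k.-1)%:R.
  rewrite -[in LHS](prednK (ltnW (ltnW k3))) exprS natrM natrX mulrA divfK//.
  exact: lt0r_neq0.
have h1 : 1 <= `|A p - p| * n%:R ^+ k.
  rewrite -[X in _ * X]ger0_norm ?exprn_ge0// -normrM mulrBl hm pE.
  apply: natr_dist_ge1; apply: contra hAp => /eqP E.
  by rewrite -(inj_eq (mulIf (lt0r_neq0 (lt_le_trans ltr01 nk)))) hm pE E.
have h2 : `|A p - p| <= (2 * k%:R + 1) * `|p - s|.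
  have := ext_lipschitz s01 k (in01_bounded (boolean01 (connective_boolean (R := R) alpha)))
      (in01_open p01).
  rewrite -/f fs -/(A p) mulr1 => hl.
  have -> : A p - p = (A p - s) - (p - s) by ring.
  by apply: le_trans (ler_normB _ _) _; lra.
rewrite ler_pdivrMr ?exprn_gt0//; apply: le_trans C1 _.
rewrite -[leLHS]mul1r ler_pdivrMr// (le_trans h1)//.
by rewrite mulrAC ler_pM2r ?exprn_gt0// mulrC.
Qed.

Lemma orbit_rate (N : nat) : (0 < N)%N -> N%:R^-1 < 3 / 2 * 2^-1 ^+ k :> R ->
  exists c : nat, forall n w M (z : nat -> R), (0 < n)%N -> (w <= n)%N -> (n <= 2 ^ M)%N ->
  (forall i, z i.+1 = A (z i)) -> z 0%N = w%:R / n%:R -> z 0%N != s ->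
  forall i, (N * (k * M) + M + c <= i)%N ->
    `|z i - (s < z 0%N)%R%:R| <= 2^-1 ^+ (2 ^ M.+2).
Proof.
move=> N0 Nk; have [C C0 hC] := fixpoint_separation.
have s01' : 0 < 1 - s < 1 by move: s01; lra.
have fs' : ext (connective (R := R) (dual alpha)) (nseq k (1 - s)) = 1 - s.
  by rewrite ext_dual fs.
have [c1 hc1] := escape_rate alpha_mono s01 nproj fs N0 Nk C0.
have [c2 hc2] := escape_rate (dual_mono alpha_mono) s01' (dual_nproj nproj) fs' N0 Nk C0.
exists (c1 + c2)%N => n w M z n0 wn nM zS z0 zs i hi.
have z01 : 0 <= z 0%N <= 1.
  by rewrite z0 divr_ge0//= ler_pdivrMr ?ltr0n// mul1r ler_nat.
have hd : C * 2^-1 ^+ (k * M) <= `|z 0%N - s|.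
  rewrite z0 in zs *; apply: le_trans (hC n w wn n0 zs).
  rewrite ler_pM2l// exprVn lef_pV2 ?posrE ?exprn_gt0 ?ltr0n//.
  by rewrite mulnC exprM lerXn2r ?nnegrE ?exprn_ge0// -natrX ler_nat.
have hi1 : (N * (k * M) + M + c1 <= i)%N by move: hi; clear; lia.
have hi2 : (N * (k * M) + M + c2 <= i)%N by move: hi; clear; lia.
case/andP: z01 => zge zle; move: zs; rewrite neq_lt => /orP[zs|sz].
  rewrite ler0_norm ?subr_le0 ?(ltW zs)// in hd.
  have z1 : z 0%N <= s - C * 2^-1 ^+ (k * M) by move: hd; lra.
  have /andP[h0 h1] := hc1 M z zS zge z1 i hi1.
  by rewrite ltNge (ltW zs) subr0 ger0_norm.
rewrite gtr0_norm ?subr_gt0// in hd.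
have z1 : 1 - z 0%N <= 1 - s - C * 2^-1 ^+ (k * M) by move: hd; lra.
have z2 : 0 <= 1 - z 0%N by rewrite subr_ge0.
have zS' j : 1 - z j.+1 = ext (connective (dual alpha)) (nseq k (1 - z j)).
  by rewrite ext_dual zS.
have /andP[h0 h1] := hc2 M (fun i => 1 - z i) zS' z2 z1 i hi2.
by rewrite sz distrC ger0_norm.
Qed.

End OrbitRate.

(** * Convergence of the growth process *)

Section Convergence.
Local Open Scope classical_set_scope.
Context {R : realType}.
Variables (k n : nat) (alpha : boolfun k) (mu : boolfun n -> R) (s : R).
Hypothesis mu0 : forall f, 0 <= mu f.
Hypothesis mu1 : \sum_f mu f = 1.
Hypothesis alpha_mono : monotone_boolfun alpha.
Hypothesis s01 : 0 < s < 1.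
Hypothesis nproj : forall j, alpha <> projection j.
Let f := connective (R := R) alpha.
Hypothesis fs : ext f (nseq k s) = s.
Implicit Types (b : boolfun n) (x : {ffun 'I_n -> bool}) (l : seq {ffun 'I_n -> bool}).

Let fb : boolean f := connective_boolean alpha.
Let fm : mono f := connective_mono alpha_mono.
Let alpha0 := alpha_false alpha_mono s01 fs nproj.
Let V := s * (1 - s).
Let V0 : 0 < V := variance_gt0 s01.
Let P := growth_prob alpha mu.

Definition sset l : {set {ffun 'I_n -> bool}} := finset (fun x => x \in l).

Definition agree b l : pred (boolfun n) := fun g => all (fun x => g x == b x) l.

Lemma agreeE b l g : agree b l g = (restr (sset l) g == restr (sset l) b).
Proof.
apply/allP/eqP => [h|h x xl].
  by apply/ffunP => x; rewrite !ffunE inE; case: (boolP (x \in l)) => // /h /eqP ->.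
by have := congr1 (fun h : boolfun n => h x) h; rewrite /= !ffunE inE xl => /= ->.
Qed.

Lemma represents_agree i x l b (T : finType) nu p (u : T -> boolfun n) :
  represents alpha mu i (sset l) x nu p u ->
  P i (agree b l) = \sum_(t | u t == restr (sset l) b) nu t /\
  P i (agree b (x :: l)) = \sum_(t | u t == restr (sset l) b) nu t * bernoulli_pmf (p t) (b x).
Proof.
move=> h; split.
  rewrite -(represents_total h); apply: eq_bigl => g; exact: agreeE.
by rewrite -h; apply: eq_bigl => g; rewrite /agree /= -/(agree b l g) agreeE andbC.
Qed.

(** The elementary bound [d <= e + d ^ 2 / e] replaces the Cauchy-Schwarz inequality. *)
Lemma represents_agree_dist i x l b (T : finType) nu p (u : T -> boolfun n) (e : R) :
  represents alpha mu i (sset l) x nu p u -> biased s nu p -> 0 < e ->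
  variance s nu p <= e ^+ 2 ->
  `|P i (agree b (x :: l)) - bernoulli_pmf s (b x) * P i (agree b l)| <= 2 * e.
Proof.
move=> h [nu0 nu1 p01 nus] e0 ve; have [-> ->] := represents_agree b h.
rewrite mulr_sumr -sumrB; apply: le_trans (ler_norm_sum _ _ _) _.
apply: (@le_trans _ _ (\sum_t (e * nu t + e^-1 * (nu t * (p t - s) ^+ 2)))); last first.
  rewrite big_split/= -!mulr_sumr nu1 -/(variance s nu p).
  have : e^-1 * variance s nu p <= e by rewrite ler_pdivrMl// -expr2.
  lra.
rewrite big_mkcond; apply: ler_sum => t _.
have h0 : 0 <= e * nu t + e^-1 * (nu t * (p t - s) ^+ 2).
  rewrite addr_ge0//; first by rewrite mulr_ge0 ?nu0 ?(ltW e0).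
  by rewrite mulr_ge0 ?invr_ge0 ?(ltW e0)// mulr_ge0 ?nu0 ?sqr_ge0.
case: ifP => // _.
have -> : nu t * bernoulli_pmf (p t) (b x) - bernoulli_pmf s (b x) * nu t
    = nu t * (bernoulli_pmf (p t) (b x) - bernoulli_pmf s (b x)) by ring.
rewrite normrM ger0_norm// mulrCA [e * _]mulrC -mulrDr ler_wpM2l//.
have -> : `|bernoulli_pmf (p t) (b x) - bernoulli_pmf s (b x)| = `|p t - s|.
  by rewrite /bernoulli_pmf; case: (b x) => //; rewrite -normrN; congr `|_|; ring.
rewrite -[(p t - s) ^+ 2]ger0_norm ?sqr_ge0// normrX.
move: `|p t - s| (normr_ge0 (p t - s)) => d d0.
have -> : e + e^-1 * d ^+ 2 = d + e^-1 * ((d - e) ^+ 2 + e * d) by field; rewrite gt_eqF.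
by rewrite lerDl mulr_ge0 ?invr_ge0 ?(ltW e0)// addr_ge0 ?sqr_ge0// mulr_ge0// ltW.
Qed.

(** The space is existential because each step replaces it by a power of itself. *)
Definition low_variance i x l (v : R) := exists (T : finType) (nu p : T -> R) (u : T -> boolfun n),
  [/\ represents alpha mu i (sset l) x nu p u, biased s nu p & variance s nu p <= v].

Lemma low_variance_step i x l v : v <= V -> low_variance i x l v ->
  low_variance i.+1 x l (v * (infl_sq s k f + (1 - infl_sq s k f) * (v / V))).
Proof.
move=> vV [T [nu [p [u [h nup hv]]]]].
exists {ffun 'I_k -> T}, (@prod_mass R T k nu), (ext_ffun f p),
  (fun g : {ffun 'I_k -> T} => compose alpha [ffun j => u (g j)]); split.
- exact: represents_step.
- exact: (biased_ext nup (boolean01 fb) fs).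
have hv1 : variance s nu p / V <= 1 by rewrite ler_pdivrMr// mul1r (le_trans hv).
apply: le_trans (variance_step s01 nup fb fm fs hv1) _.
have v0 : 0 <= variance s nu p.
  by case: nup => nu0 _ _ _; apply: sumr_ge0 => t _; rewrite mulr_ge0 ?sqr_ge0.
have L0 := infl_sq_ge0 s k f.
have L1 : 0 <= 1 - infl_sq s k f.
  have := connective_infl_sq alpha_mono s01 fs nproj; rewrite -/f.
  have : 0 < 2^-1 ^+ k :> R by rewrite exprn_gt0.
  lra.
apply: ler_pM => //; first by rewrite addr_ge0// mulr_ge0// divr_ge0// ltW.
by rewrite lerD2l ler_wpM2l// ler_pM2r ?invr_gt0.
Qed.

Lemma low_variance_decay v (th := infl_sq s k f + (1 - infl_sq s k f) * (v / V)) :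
  0 <= v -> v < V -> 0 <= th < 1 /\
    forall i x l j, low_variance i x l v -> low_variance (i + j) x l (v * th ^+ j).
Proof.
move=> v0 vV; rewrite /th; set L := infl_sq s k f.
have L0 : 0 <= L := infl_sq_ge0 s k f.
have L1 : L < 1.
  have := connective_infl_sq alpha_mono s01 fs nproj; rewrite -/f -/L.
  have : 0 < 2^-1 ^+ k :> R by rewrite exprn_gt0.
  lra.
have c0 : 0 <= v / V by rewrite divr_ge0 ?(ltW V0).
have c1 : v / V < 1 by rewrite ltr_pdivrMr// mul1r.
have th01 : 0 <= L + (1 - L) * (v / V) < 1.
  apply/andP; split; first by rewrite addr_ge0// mulr_ge0// subr_ge0 ltW.
  by nra.
split=> // i x l j hv; rewrite -/L -/th in th01 *; elim: j => [|j IH]; first by rewrite addn0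
    expr0 mulr1.
have vj : v * th ^+ j <= v.
  by case/andP: th01 => t0 t1; rewrite ler_piMr// exprn_ile1// ltW.
have [T [nu [p [u [h nup hv']]]]] := low_variance_step (le_trans vj (ltW vV)) IH.
rewrite addnS; exists T, nu, p, u; split => //; apply: le_trans hv' _.
rewrite exprSr [leRHS]mulrA ler_wpM2l//.
  by case/andP: th01 => t0 _; rewrite mulr_ge0// exprn_ge0.
by rewrite /th lerD2l ler_wpM2l ?subr_ge0 ?(ltW L1)// ler_pM2r ?invr_gt0.
Qed.

(** [alpha] is true on constant true and false on constant false, so composing it with [k] copies of
    [g] gives [g] back. *)
Lemma growth_support i j g : (i <= j)%N -> 0 < growth mu alpha i g -> 0 < growth mu alpha j g.
Proof.
move=> /subnK <-; elim: (j - i)%N => [//|m IH] h; rewrite addSn /= /iid_prob.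
have ag : compose alpha [ffun=> g] == g.
  apply/eqP/ffunP => x; rewrite ffunE; case e : (g x).
    rewrite -(alpha_true alpha_mono s01 fs nproj); congr (alpha _).
    by apply/ffunP => j'; rewrite !ffunE.
  by rewrite -alpha0; congr (alpha _); apply/ffunP => j'; rewrite !ffunE.
rewrite (bigD1 [ffun=> g])//= ltr_pwDl//.
  by apply: prodr_gt0 => j' _; rewrite ffunE IH.
by apply: sumr_ge0 => y _; apply: prodr_ge0 => j' _; apply: growth_ge0.
Qed.

Lemma growth_prob_eq i (E E' : pred (boolfun n)) :
  (forall g, 0 < growth mu alpha i g -> E g = E' g) -> P i E = P i E'.
Proof.
move=> h; rewrite /P /growth_prob big_mkcond [RHS]big_mkcond; apply: eq_bigr => g _.
have := growth_ge0 alpha mu0 i g; rewrite le_eqVlt => /orP[/eqP <-|/h ->//].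
by rewrite !if_same.
Qed.

Lemma point_prob_orbit x i : point_prob alpha mu i.+1 x = ext f (nseq k (point_prob alpha mu i x)).
Proof. by rewrite point_probS// characteristic_poly_ext. Qed.

Lemma point_prob_fixed x i : point_prob alpha mu 0 x = s -> point_prob alpha mu i x = s.
Proof. by move=> h; elim: i => [//|i IH]; rewrite point_prob_orbit IH. Qed.

(** Assignments are added one at a time. If the initial probability at [x] is not [s], the value at
    [x] becomes almost surely constant, so the new probability has the same limit as the old one or
    tends to 0. *)
Lemma cvg_agree b l : cvgn (fun i => P i (agree b l)).
Proof.
elim: l => [|x l /cvg_ex[B hB]].
  apply/cvg_ex; exists 1; rewrite (_ : (fun i => P i (agree b [::])) = (fun=> 1)); first exact:
      cvg_cst.
  by apply/funext => i; rewrite /P /growth_prob growth_sum1.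
pose z i := point_prob alpha mu i x.
have [zs|zs] := eqVneq (z 0%N) s; last first.
  have zc := orbit_cvg alpha_mono s01 nproj fs (point_prob_orbit x) (point_prob01 alpha mu0 mu1
      0 x) zs.
  set v : bool := (s < point_prob alpha mu 0 x)%R in zc.
  have hP i : P i (agree b l) - (if b x then 1 - z i else z i) <= P i (agree b (x :: l)) <= P i
      (agree b l).
    apply/andP; split; last by apply: growth_prob_sub => // g /andP[].
    have -> : (if b x then 1 - z i else z i) = P i (fun g => g x != b x).
      rewrite /z /point_prob; case: (b x).
        rewrite -(growth_probC alpha mu1 i (fun g => g x)) addrC addKr.
        by apply: eq_bigl => g; rewrite /= eqb_id.
      by apply: eq_bigl => g; rewrite eqbF_neg negbK.
    rewrite lerBlDr; apply: le_trans (growth_probU _ _ _ _ _) => //.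
    by apply: growth_prob_sub => // g h /=; rewrite /agree /= -/(agree b l g) h andbT; case: (g
        x == b x).
  have hQ i : 0 <= P i (agree b (x :: l)) <= (if b x then z i else 1 - z i).
    rewrite growth_prob_ge0//=.
    have -> : (if b x then z i else 1 - z i) = P i (fun g => g x == b x).
      rewrite /z /point_prob; case: (b x).
        by apply: eq_bigl => g; rewrite eqb_id.
      rewrite -(growth_probC alpha mu1 i (fun g => g x)) addrC addKr.
      by apply: eq_bigl => g; rewrite /= eqbF_neg.
    by apply: growth_prob_sub => // g /andP[].
  have zc' : (fun i => 1 - z i) @ \oo --> (1 - v%:R : R) by apply: cvgB => //; exact: cvg_cst.
  have [bv|bv] := eqVneq (b x) v.
    apply/cvg_ex; exists B.
    apply: (squeeze_cvgr (nearW _ hP)) => //.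
    rewrite -[X in _ --> X]subr0; apply: cvgB => //.
    by case: v zc zc' bv => zc zc' -> //; rewrite subrr in zc'.
  apply/cvg_ex; exists 0.
  apply: (squeeze_cvgr (nearW _ hQ)); first exact: cvg_cst.
  by case: (b x) v zc zc' bv => [] [] //= zc zc' _; rewrite subrr in zc'.
have zi i : z i = s := point_prob_fixed i zs.
(* Either the values on [l] leave the value at [x] open at some level, and from there on the
   variance decays geometrically, or they fix it at every level. *)
have [[i0 [g1 [g2 [p1 p2 g12 gx]]]]|det] := pselect (exists i g1 g2,
   [/\ 0 < growth mu alpha i g1, 0 < growth mu alpha i g2, agree g1 l g2 & g1 x && ~~ g2 x]).
  have [v [v0 vV hv]] : exists v, [/\ 0 <= v, v < V & low_variance i0 x l v].
    exists (variance s (growth mu alpha i0) (cond_prob alpha mu i0 (sset l) x)).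
    have nup := biased_cond_prob alpha mu0 mu1 i0 (sset l) x.
    have rep := represents_cond_prob alpha mu0 i0 (sset l) x.
    rewrite -/(z i0) zi in nup; split.
    - by apply: sumr_ge0 => t _; rewrite mulr_ge0 ?sqr_ge0// growth_ge0.
    - move: gx => /andP[g1x g2x].
      have := @variance_cond_prob R k n alpha mu mu0 mu1 i0 (sset l) x (pred1 g1) (pred1 g2)
        (restr (sset l) g1).
      rewrite -/(z i0) zi; rewrite agreeE in g12.
      rewrite /growth_prob !big_pred1_eq => h.
      apply: le_lt_trans (h _ _) _.
      + by move=> g /eqP ->.
      + by move=> g /eqP ->; rewrite (eqP g12).
      by rewrite -/V gtrBl mulr_gt0.
    by exists (boolfun n), (growth mu alpha i0), (cond_prob alpha mu i0 (sset l) x), (restr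
        (sset l)).
  move: (low_variance_decay v0 vV); set th := (X in 0 <= X < 1) => -[/andP[th0 th1] hth].
  apply/cvg_ex; exists (bernoulli_pmf s (b x) * B).
  rewrite (_ : (fun i => P i (agree b (x :: l))) = (fun i => bernoulli_pmf s (b x) * P i (agree
      b l) +
    (P i (agree b (x :: l)) - bernoulli_pmf s (b x) * P i (agree b l)))); last first.
    by apply/funext => i; ring.
  rewrite -[X in _ --> X]addr0; apply: cvgD; first by apply: cvgM => //; exact: cvg_cst.
  apply/cvgrPdist_le => e e0.
  have tc : (fun j => v * th ^+ j) @ \oo --> (0 : R).
    rewrite -[X in _ --> X](mulr0 v); apply: cvgM; first exact: cvg_cst.
    by apply: cvg_expr; rewrite ger0_norm.
  have e2 : 0 < (e / 2) ^+ 2 :> R by rewrite exprn_gt0// divr_gt0.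
  have [j0 _ hj0] := cvgr_le _ tc _ e2.
  exists (i0 + j0)%N => // i /= hi; rewrite sub0r normrN.
  have [T [nu [p [u [h nup hv']]]]] := hth _ _ _ (i - i0)%N hv.
  rewrite subnKC in h; last exact: leq_trans (leq_addr _ _) hi.
  apply: le_trans (represents_agree_dist b h nup (e := e / 2) _ _) _.
  - by rewrite divr_gt0.
  - by apply: le_trans hv' _; apply: hj0; rewrite /= leq_subRL// (leq_trans (leq_addr _ _) hi).
  - lra.
(* By [growth_support], functions of different levels can be compared at the higher one, so the
   values on [l] determine the value at [x] in the same way at all levels. *)
have det' i j g1 g2 : 0 < growth mu alpha i g1 -> 0 < growth mu alpha j g2 ->
    agree g1 l g2 -> g1 x = g2 x.
  move=> h1 h2 h12; apply/eqP/negPn/negP => gx; apply: det.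
  have h1' := growth_support (leq_maxl i j) h1; have h2' := growth_support (leq_maxr i j) h2.
  exists (maxn i j); case e1 : (g1 x) gx; case e2 : (g2 x) => // _.
    by exists g1, g2; split; rewrite ?e1 ?e2.
  exists g2, g1; split; rewrite ?e1 ?e2//.
  by apply/allP => y /(allP h12); rewrite eq_sym.
have [[i0 [g0 g0p g0l]]|none] := pselect (exists i, exists2 g, 0 < growth mu alpha i g & agree b
    l g).
  have hg i g : 0 < growth mu alpha i g -> agree b l g -> g x = g0 x.
    move=> gp gl; apply/esym/(det' i0 i) => //; apply/allP => y yl.
    by rewrite (eqP (allP gl y yl)) (eqP (allP g0l y yl)).
  have [gb|gb] := eqVneq (g0 x) (b x).
    apply/cvg_ex; exists B; rewrite (_ : (fun i => _) = (fun i => P i (agree b l)))//.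
    apply/funext => i; apply: growth_prob_eq => g gp; rewrite /agree /= -/(agree b l g).
    by case: (boolP (agree b l g)) => [gl|]; rewrite ?andbF// (hg i g)// gb eqxx.
  apply/cvg_ex; exists 0; rewrite (_ : (fun i => _) = (fun=> 0)); first exact: cvg_cst.
  apply/funext => i; rewrite (growth_prob_eq (E' := pred0)) /P /growth_prob ?big_pred0// => g gp.
  rewrite /agree /= -/(agree b l g).
  by case: (boolP (agree b l g)) => [gl|]; rewrite ?andbF// (hg i g)// (negbTE gb).
apply/cvg_ex; exists 0; rewrite (_ : (fun i => _) = (fun=> 0)); first exact: cvg_cst.
apply/funext => i; rewrite (growth_prob_eq (E' := pred0)) /P /growth_prob ?big_pred0// => g gp.
rewrite /agree /= -/(agree b l g); apply/negP => /andP[_ gl]; apply: none.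
by exists i, g.
Qed.

Lemma growth_cvg g : cvgn (fun i => growth mu alpha i g).
Proof.
rewrite (_ : (fun i => _) = (fun i => P i (agree g (enum {: {ffun 'I_n -> bool}}))));
  first exact: cvg_agree.
apply/funext => i; rewrite /P /growth_prob (big_pred1 g)// => h.
apply/allP/eqP => [hg|->//]; apply/ffunP => x; apply/eqP/hg; exact: mem_enum.
Qed.

End Convergence.

(** * Concentration of the conditional probabilities *)

Section Concentration.
Context {R : realType}.
Variables (k : nat) (alpha : boolfun k) (s : R).
Hypothesis alpha_mono : monotone_boolfun alpha.
Hypothesis s01 : 0 < s < 1.
Hypothesis nproj : forall j, alpha <> projection j.
Let f := connective (R := R) alpha.
Hypothesis fs : ext f (nseq k s) = s.
Variable N : nat.
Hypothesis N0 : (0 < N)%N.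
Let h : R := 2^-1 ^+ k.
Let y : R := N%:R^-1.
Hypothesis yh : y <= 4 / 3 * h.

Let fb : boolean f := connective_boolean alpha.
Let fm : mono f := connective_mono alpha_mono.
Let V := s * (1 - s).
Let V0 : 0 < V := variance_gt0 s01.
Let y0 : 0 < y. Proof. by rewrite invr_gt0 ltr0n. Qed.
Let h0 : 0 < h. Proof. by rewrite exprn_gt0. Qed.
Let L := infl_sq s k f.
Let L_gap : L <= 1 - 3 / 2 * h := connective_infl_sq alpha_mono s01 fs nproj.
Let L0 : 0 <= L := infl_sq_ge0 s k f.

Let h8 : h <= 8^-1.
Proof.
have k3 := arity_gt2 alpha_mono s01 fs nproj.
apply: (@le_trans _ _ (2^-1 ^+ 3)); last by rewrite exprS expr2; lra.
by apply: ler_wiXn2l => //; lra.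
Qed.

Lemma low_variance_le n (mu : boolfun n -> R) i x l v w :
  v <= w -> low_variance alpha mu s i x l v -> low_variance alpha mu s i x l w.
Proof.
move=> vw [T [nu [p [u [? ? hv]]]]]; exists T, nu, p, u; split => //; exact: le_trans vw.
Qed.

Lemma exists_pow2_ge (x : R) : exists c : nat, x <= 2 ^+ c.
Proof.
have [x0|x0] := leP x 0; first by exists 0%N; rewrite expr0 (le_trans x0).
exists (Num.bound x); apply: (@le_trans _ _ (Num.bound x)%:R).
  exact/ltW/archi_boundP/ltW.
by rewrite -natrX ler_nat ltnW// ltn_expl.
Qed.

Lemma exists_pow_le (q x : R) : 0 <= q < 1 -> 0 < x -> exists c : nat, q ^+ c <= x.
Proof.
move=> /andP[q0 q1] x0.
have hc : ((fun j => q ^+ j) @ \oo --> (0 : R))%classic by apply: cvg_expr; rewrite ger0_norm.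
have [c _ hc'] := cvgr_le _ hc _ x0; exists c; apply: hc'; exact: leqnn.
Qed.

(** For [t = 1 - v / V] the variance step is the logistic growth [t + (1 - L) * t * (1 - t)]. While
    [t < 9^-1], its rate is at least [3 / 2 * h * (8 / 9) = 4 / 3 * h]: hence the threshold. *)
Lemma variance_escape (C : R) : 0 < C -> exists c : nat,
  forall n (mu : boolfun n -> R) i x l M, low_variance alpha mu s i x l (V * (1 - C * 2^-1 ^+ (2
      * M))) ->
  C * 2^-1 ^+ (2 * M) <= 1 ->
  low_variance alpha mu s (i + N * (2 * M + c)) x l (V * (8 / 9)).
Proof.
move=> C0; have [c hc] := exists_pow2_ge (C^-1); exists c => n mu i x l M hv C1.
set t0 := C * _ in hv C1; have t00 : 0 < t0 by rewrite mulr_gt0// exprn_gt0.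
have step m : exists t, [/\ 0 <= t <= 1, 9^-1 <= t \/ (1 + y) ^+ m * t0 <= t &
    low_variance alpha mu s (i + m) x l (V * (1 - t))].
  elim: m => [|m [t [/andP[tge tle] ht lt]]].
    by exists t0; rewrite expr0 mul1r addn0 (ltW t00); split => //; right.
  have vV : V * (1 - t) <= V by rewrite ler_piMr ?(ltW V0)// gerBl.
  have lt' := low_variance_step alpha_mono s01 nproj fs vV lt.
  have G : 0 <= (1 - L) * t * (1 - t).
    rewrite mulr_ge0 ?subr_ge0// mulr_ge0// subr_ge0.
    by move: L_gap h0; lra.
  exists (t + (1 - L) * t * (1 - t)); rewrite addnS; split.
  - apply/andP; split; first by rewrite addr_ge0.
    have -> : t + (1 - L) * t * (1 - t) = 1 - (1 - t) * (1 - (1 - L) * t) by ring.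
    rewrite gerBl mulr_ge0 ?subr_ge0//.
    have : 0 <= L * t by rewrite mulr_ge0.
    by move: tle; lra.
  - have [t9|t9] := leP 9^-1 t; first by left; rewrite (le_trans t9)// lerDl.
    case: ht => [|ht]; first by rewrite leNgt t9.
    right; rewrite exprS -mulrA; apply: (@le_trans _ _ ((1 + y) * t)).
      by rewrite ler_wpM2l// addr_ge0// ltW.
    have : y <= (1 - L) * (1 - t).
      apply: le_trans yh _; have : 3 / 2 * h * (8 / 9) <= (1 - L) * (1 - t).
        by apply: ler_pM; move: L_gap h0; lra.
      by lra.
    move=> yt; have : t * y <= t * ((1 - L) * (1 - t)) by rewrite ler_wpM2l.
    lra.
  - apply: low_variance_le lt'.
    have -> : V * (1 - t) / V = 1 - t by rewrite mulrAC divff ?mul1r// gt_eqF.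
    by rewrite le_eqVlt; apply/orP; left; apply/eqP; rewrite -/f -/L; ring.
have [t [/andP[tge tle] ht lt]] := step (N * (2 * M + c))%N.
apply: low_variance_le lt; rewrite ler_pM2l//.
suff : 9^-1 <= t by lra.
case: ht => // ht; apply: le_trans ht.
apply: (@le_trans _ _ (2 ^+ (2 * M + c) * t0)); last by rewrite ler_pM2r// bernoulli_pow.
have P0 : 2 ^+ (2 * M) != 0 :> R by rewrite expf_neq0.
have -> : 2 ^+ (2 * M + c) * t0 = 2 ^+ c * C by rewrite /t0 exprD exprVn; field.
apply: (@le_trans _ _ 1); first by lra.
by rewrite mulrC -ler_pdivrMl// mulr1.
Qed.

Lemma expR_le_taylor (x : R) : expR x <= 1 + x + x ^+ 2 * expR `|x|.
Proof.
have h1 := expR_ge1Dx (- x); have h2 := expR_ge1Dx x.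
have e0 := expR_gt0 x; have : expR x * expR (- x) = 1 by rewrite -expRD subrr expR0.
case: (ger0P x) => x0 E.
  have h3 : expR x - 1 <= x * expR x by move: E h1 e0; nra.
  have : x * (expR x - 1) <= x * (x * expR x) by rewrite ler_wpM2l.
  lra.
have : 0 <= x ^+ 2 * (expR (- x) - 1).
  by rewrite mulr_ge0 ?sqr_ge0// subr_ge0 -expR0 ler_expR oppr_ge0 ltW.
have : 0 <= - x * (expR x - 1 - x) by apply: mulr_ge0; lra.
have h3 : expR x - 1 <= x * expR x by move: E h1 e0; nra.
lra.
Qed.

(** A Taylor bound with the crude remainder factor [expR K]: enough to enter the subexponential
    regime at one fixed [K] once the variance is small. *)
Lemma subexp_of_variance (T : finType) (nu p : T -> R) (w K : R) : biased s nu p ->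
  0 < K -> variance s nu p * expR K <= w / K -> subexp s w K nu p.
Proof.
move=> nup K0 hv; have [nu0 nu1 p01 nus] := nup.
have v0 : 0 <= variance s nu p by apply: sumr_ge0 => t _; rewrite mulr_ge0 ?sqr_ge0.
split.
  by apply: le_trans hv; rewrite ler_peMr// -expR0 ler_expR ltW.
move=> th thK; apply: (@le_trans _ _ (1 + th ^+ 2 * (variance s nu p * expR K))); last first.
  apply: le_trans (expR_ge1Dx _); rewrite lerD2l.
  have -> : w * th ^+ 2 / K = th ^+ 2 * (w / K) by ring.
  by rewrite ler_wpM2l ?sqr_ge0.
apply: (@le_trans _ _ (\sum_t (nu t + th * (nu t * p t) - th * s * nu t
    + th ^+ 2 * expR K * (nu t * (p t - s) ^+ 2)))).
  apply: ler_sum => t _.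
  have : expR (th * (p t - s)) <= 1 + th * (p t - s) + (th * (p t - s)) ^+ 2 * expR K.
    apply: le_trans (expR_le_taylor _) _; rewrite lerD2l ler_wpM2l ?sqr_ge0// ler_expR normrM.
    by apply: le_trans thK; rewrite ler_piMr// (biased_dist s01 t nup).
  move=> H; apply: le_trans (ler_wpM2l (nu0 t) H) _.
  by rewrite le_eqVlt; apply/orP; left; apply/eqP; ring.
rewrite !big_split/= sumrN -!mulr_sumr nu1 nus -/(variance s nu p); lra.
Qed.

Definition low_subexp n (mu : boolfun n -> R) (w K : R) i x l :=
  exists (T : finType) (nu p : T -> R) (u : T -> boolfun n),
  [/\ represents alpha mu i (sset l) x nu p u, biased s nu p & subexp s w K nu p].

(** Of the [3 * M] doublings, [2 * M] go to [variance_escape] and [M] raise [K] from a constant to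
    order [2 ^ M]; in between, the variance becomes small enough in a constant number of steps. *)
Lemma low_subexp_rate (w1 : R) : 0 < w1 -> exists2 w : R, 0 < w <= w1 &
  forall C D : R, 0 < C -> exists c : nat,
  forall n (mu : boolfun n -> R) i0 x l M, low_variance alpha mu s i0 x l (V * (1 - C * 2^-1 ^+
      (2 * M))) ->
  C * 2^-1 ^+ (2 * M) <= 1 ->
  forall i, (i0 + N * (3 * M) + c <= i)%N ->
  exists2 K, D * 2 ^+ M <= K & low_subexp mu w K i x l.
Proof.
(* [1 - 2 * h] bounds the influences and [2^-1] is required by [ext_dist_le]. With [y <= 4 / 3 * h],
   both [(1 + y) * rho] and [(1 + y) * L] stay below 1. *)
move=> w10; pose rho := Num.max 2^-1 (1 - 2 * h) : R.
have rho2 : 1 <= 2 * rho.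
  have : 2^-1 <= rho by rewrite le_max lexx.
  lra.
have infl_rho j : (j < k)%N -> infl s k j f <= rho.
  move=> jk; rewrite le_max; apply/orP; right.
  exact: (connective_infl alpha_mono s01 fs nproj jk).
have y_rho : (1 + y) * rho < 1.
  rewrite /rho maxr_pMr; last by rewrite addr_ge0// ltW.
  rewrite gt_max; apply/andP; split; first by move: yh h8; lra.
  by move: yh h0 y0; nra.
have y_sq : (1 + y) * L < 1.
  apply: (@le_lt_trans _ _ ((1 + y) * (1 - 3 / 2 * h))).
    by rewrite ler_wpM2l// addr_ge0// ltW.
  by move: yh h0 y0; nra.
have [w0 w00 hw] := subexp_step s01 fb fm fs y0 infl_rho rho2 y_rho y_sq.
pose w := Num.min w0 w1; exists w; first by rewrite lt_min w00 w10 ge_min lexx orbT.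
have wpos : 0 < w by rewrite lt_min w00.
have [|K0 K00 hK] := hw w; first by rewrite wpos ge_min lexx.
move=> C D C0; have [c1 hc1] := variance_escape C0.
have V89 : V * (8 / 9) < V by move: V0; lra.
have V89' : 0 <= V * (8 / 9) by move: V0; lra.
pose v1 := w / K0 / expR K0.
have v10 : 0 < v1 by rewrite !divr_gt0 ?expR_gt0.
have [/andP[th0 th1] hth] : 0 <= L + (1 - L) * (8 / 9) < 1 /\ forall n (mu : boolfun n -> R) i x
    l j,
    low_variance alpha mu s i x l (V * (8 / 9)) ->
    low_variance alpha mu s (i + j) x l (V * (8 / 9) * (L + (1 - L) * (8 / 9)) ^+ j).
  have e : V * (8 / 9) / V = 8 / 9 by rewrite mulrAC divff ?mul1r// gt_eqF.
  split=> [|n mu].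
    have [+ _] := low_variance_decay (fun=> 0 : R) alpha_mono s01 nproj fs V89' V89 (n := 0).
    by rewrite e.
  have [_ +] := low_variance_decay mu alpha_mono s01 nproj fs V89' V89.
  by rewrite e.
set th := L + _ in th0 th1 hth.
have th01 : 0 <= th < 1 by rewrite th0.
have [c2 hc2] := exists_pow_le th01 (divr_gt0 v10 (mulr_gt0 V0 (divr_gt0 (ltr0n R 8) (ltr0n R 9)))).
have [c3 hc3] := exists_pow2_ge (D / K0).
exists (N * c1 + c2 + N * c3)%N => n mu i0 x l M hv C1 i hi.
have [K [K0K DK hsub]] : exists K, [/\ K0 <= K, (1 + y) ^+ (i - (i0 + N * (2 * M + c1) + c2)) *
    K0 <= K
   & low_subexp mu w K i x l].
  have -> : i = (i0 + N * (2 * M + c1) + c2 + (i - (i0 + N * (2 * M + c1) + c2)))%N.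
    by rewrite subnKC//; move: hi; clear; nia.
  rewrite addKn; elim: (i - _)%N => [|m [K [K0K DK [T [nu [p [u [r nup nuK]]]]]]]].
    exists K0; rewrite expr0 mul1r addn0; split => //.
    have [T [nu [p [u [r nup nuV]]]]] := hth _ _ _ _ _ c2 (hc1 _ _ _ _ _ _ hv C1).
    exists T, nu, p, u; split => //; apply: subexp_of_variance => //.
    rewrite -ler_pdivlMr ?expR_gt0// -/v1; apply: le_trans nuV _.
    rewrite mulrC -ler_pdivlMr//; by rewrite mulr_gt0.
  have K0' : 0 < K by apply: lt_le_trans K0K.
  exists ((1 + y) * K); split.
  - by apply: le_trans K0K _; rewrite ler_peMl ?(ltW K0')// lerDl ltW.
  - by rewrite exprS -mulrA ler_wpM2l// addr_ge0// ltW.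
  rewrite addnS; exists {ffun 'I_k -> T}, (@prod_mass R T k nu), (ext_ffun f p),
    (fun g : {ffun 'I_k -> T} => compose alpha [ffun j => u (g j)]); split.
  - by apply: represents_step r; apply: alpha_false s01 fs nproj.
  - exact: (biased_ext nup (boolean01 fb) fs).
  - exact: hK.
exists K => //; apply: le_trans DK.
rewrite -ler_pdivrMr// mulrAC; apply: (@le_trans _ _ (2 ^+ (M + c3))).
  by rewrite exprD mulrC ler_pM2l// exprn_gt0.
apply: le_trans (@bernoulli_pow R N (M + c3) N0) _.
apply: ler_weXn2l; first by rewrite lerDl ltW.
by move: hi; clear; nia.
Qed.

(** Chernoff's bound at [K] and [- K] controls the event where [p] is farther than [u] from [s].
    Elsewhere both values at [x] have conditional probability at most [1 - u], as [2 * u] is at most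
    [s] and [1 - s]. *)
Lemma represents_agree_le n (mu : boolfun n -> R) (w K u : R) i x l b :
  (forall g, 0 <= mu g) -> \sum_g mu g = 1 ->
  0 < K -> 2 * u <= s -> 2 * u <= 1 - s -> 0 < w -> 2 * w <= u -> low_subexp mu w K i x l ->
  growth_prob alpha mu i (agree b (x :: l)) <=
    (1 - u) * growth_prob alpha mu i (agree b l) + 2 * expR (- (K * u / 2)).
Proof.
move=> mu0 mu1 K0 us us' w0 wu [T [nu [p [v [r nup [_ hK]]]]]].
have [nu0 nu1 p01 nus] := nup; have [-> ->] := represents_agree b r.
have h1 : \sum_t nu t * expR (K * (p t - s)) <= expR (w * K).
  apply: le_trans (hK K _) _; first by rewrite gtr0_norm.
  by rewrite expr2 mulrA mulfK// gt_eqF.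
have h2 : \sum_t nu t * expR (- K * (p t - s)) <= expR (w * K).
  apply: le_trans (hK (- K) _) _; first by rewrite normrN gtr0_norm.
  by rewrite sqrrN expr2 mulrA mulfK// gt_eqF.
pose B t := expR (- (K * u)) * (nu t * expR (K * (p t - s)) + nu t * expR (- K * (p t - s))).
have B0 t : 0 <= B t by rewrite mulr_ge0 ?expR_ge0// addr_ge0// mulr_ge0 ?expR_ge0.
have hB : \sum_t B t <= 2 * expR (- (K * u / 2)).
  rewrite -mulr_sumr big_split /=.
  apply: (@le_trans _ _ (expR (- (K * u)) * (2 * expR (w * K)))).
    by rewrite ler_wpM2l ?expR_ge0// mulr_natl mulr2n lerD.
  rewrite mulrCA -expRD ler_pM2l// ler_expR.
  have : 2 * w * K <= u * K by rewrite ler_pM2r.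
  lra.
apply: (@le_trans _ _ (\sum_(t | v t == restr (sset l) b) ((1 - u) * nu t + B t))).
  apply: ler_sum => t _; have [pu|pu] := leP `|p t - s| u.
    rewrite mulrC; apply: (@le_trans _ _ ((1 - u) * nu t)); last by rewrite lerDl.
    rewrite ler_wpM2r//; move: pu; rewrite ler_norml => /andP[? ?].
    by rewrite /bernoulli_pmf; case: (b x); lra.
  have u0 : 0 <= (1 - u) * nu t.
    by rewrite mulr_ge0//; case/andP: s01 => ? ?; lra.
  apply: (@le_trans _ _ (nu t)).
    rewrite ler_piMr//; case/andP: (p01 t) => ? ?.
    by rewrite /bernoulli_pmf; case: (b x); lra.
  rewrite -[leLHS]add0r lerD//.
  rewrite /B -mulrDr mulrCA ler_peMr// mulrDr -!expRD.
  move: pu; case: (ger0P (p t - s)) => _ pu.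
    apply: (@le_trans _ _ (expR (- (K * u) + K * (p t - s)))).
      rewrite -expR0 ler_expR addrC subr_ge0 ler_pM2l//; exact: ltW.
    by rewrite lerDl expR_ge0.
  apply: (@le_trans _ _ (expR (- (K * u) + - K * (p t - s)))).
    rewrite -expR0 ler_expR addrC mulNr -mulrN subr_ge0 ler_pM2l//; exact: ltW.
  by rewrite lerDr expR_ge0.
rewrite big_split /= -mulr_sumr lerD2l; apply: le_trans hB.
rewrite [leRHS](bigID (fun t => v t == restr (sset l) b)) /= lerDl.
by apply: sumr_ge0.
Qed.

End Concentration.

(** * Many assignments of the same weight *)

Section UniformProjections.
Context {R : realType}.
Variable n : nat.
Hypothesis n0 : (0 < n)%N.
Let mu := @uniform_projections R n.

Lemma projection_inj : injective (@projection n).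
Proof.
move=> i j /ffunP /(_ [ffun i' => i' == i]); rewrite !ffunE eqxx => /esym.
by move=> h; have /eqP := h.
Qed.

Lemma sum_uniform_projections (P : pred (boolfun n)) :
  \sum_(f | P f) mu f = \sum_(j | P (projection j)) n%:R^-1.
Proof.
rewrite (partition_big (@projection n) P)//=.
apply: eq_bigr => f Pf; rewrite /mu /uniform_projections.
case: ifPn => [/codomP[j fj]|fc].
  rewrite fj (big_pred1 j)// => i; rewrite (inj_eq projection_inj) /=.
  by case: eqP => [->|_]; rewrite ?andbF// -fj Pf.
rewrite big_pred0// => i; apply/negP => /andP[_ /eqP fi]; move: fc.
by rewrite -fi codom_f.
Qed.

Lemma uniform_projections_ge0 f : 0 <= mu f.
Proof. by rewrite /mu /uniform_projections; case: ifP => // _; rewrite invr_ge0. Qed.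

Lemma uniform_projections_sum1 : \sum_f mu f = 1.
Proof.
rewrite sum_uniform_projections sumr_const card_ord -(mulr_natl n%:R^-1).
by rewrite divff// pnatr_eq0 -lt0n.
Qed.

Lemma uniform_point_prob (k : nat) (alpha : boolfun k) x :
  point_prob alpha mu 0 x = #|[set j | x j]%SET|%:R / n%:R.
Proof.
rewrite /point_prob /growth_prob /= sum_uniform_projections.
rewrite (eq_bigl [in [set j | x j]%SET]) ?sumr_const ?mulr_natl// => j.
by rewrite ffunE inE.
Qed.

Lemma uniform_iid_prob_ge k (E : pred {ffun 'I_k -> boolfun n}) (B : 'I_k -> {set 'I_n}) :
  (forall J : {ffun 'I_k -> 'I_n}, (forall j, J j \in B j) -> E [ffun j => projection (J j)]) ->
  \prod_(j < k) (#|B j|%:R / n%:R) <= iid_prob mu E :> R.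
Proof.
move=> hE.
rewrite (eq_iid_prob (w' := fun v => \sum_(j | projection j == v) n%:R^-1) (E' := E))//; last first.
  by move=> f; rewrite -(sum_uniform_projections (pred1 f)) big_pred1_eq.
rewrite -(iid_prob_push (fun _ : 'I_n => n%:R^-1)) /iid_prob.
rewrite (eq_bigr (fun j => \sum_(i in B j) n%:R^-1)); last first.
  by move=> j _; rewrite sumr_const mulr_natl.
rewrite bigA_distr_big_dep big_mkcond [leRHS]big_mkcond /=.
apply: ler_sum => J _; have p0 : 0 <= \prod_(j < k) (n%:R^-1 : R).
  by apply: prodr_ge0 => j _; rewrite invr_ge0.
case: ifPn => [/familyP h|_]; first by rewrite hE.
by case: ifP.
Qed.

End UniformProjections.

Lemma card_ord_ltn n d : (d <= n)%N -> #|[set j : 'I_n | (j < d)%N]%SET| = d.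
Proof.
move=> dn; rewrite -sum1dep_card -(big_ord_widen _ (fun=> 1%N) dn).
by rewrite sum1_card card_ord.
Qed.

Lemma card_ord_geq n d : (d <= n)%N -> #|[set j : 'I_n | (d <= j)%N]%SET| = (n - d)%N.
Proof.
move=> dn; rewrite cardsCs card_ord -[in RHS](card_ord_ltn dn); congr (n - _)%N.
by apply: eq_card => j; rewrite !inE -ltnNge.
Qed.

Section EdgePoints.
Variables n o m : nat.
Hypothesis om : (o + m + m <= n)%N.

(** Ones below [o], zeros from [o + m + m] on, and in between one edge of the complete bipartite
    graph on two blocks of [m] coordinates. Among these assignments, the conjunction of two
    coordinates singles out one edge. *)
Definition edge (a b : nat) : {ffun 'I_n -> bool} :=
  [ffun j : 'I_n => [|| (j < o)%N, j == o + a :> nat | j == o + b :> nat]].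

Definition edges := [seq edge a b | a <- iota 0 m, b <- iota m m].

Definition edge_range a b := (a < m)%N && (m <= b < m + m)%N.

Lemma mem_edges x : x \in edges -> exists a b, edge_range a b /\ x = edge a b.
Proof.
move=> /allpairsP[[a b] /= [ha hb ->]]; exists a, b; split=> //.
by move: ha hb; rewrite !mem_iota /edge_range => /andP[_ ->] ->.
Qed.

Lemma edge_inj a b a' b' : edge_range a b -> edge_range a' b' ->
  edge a b = edge a' b' -> a = a' /\ b = b'.
Proof.
rewrite /edge_range => /andP[am /andP[mb bm]] /andP[am' /andP[mb' bm']] /ffunP e.
have ha : (o + a < n)%N by lia.
have hb : (o + b < n)%N by lia.
have := e (Ordinal ha); have := e (Ordinal hb).
by rewrite !ffunE /= !eqxx !orbT => /esym h1 /esym h2; lia.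
Qed.

Lemma edges_uniq : uniq edges.
Proof.
apply: allpairs_uniq; rewrite ?iota_uniq// => -[a b] [a' b'] /=.
move=> /allpairsP[[c d] /= [hc hd [-> ->]]] /allpairsP[[c' d'] /= [hc' hd' [-> ->]]] e.
have r u v : u \in iota 0 m -> v \in iota m m -> edge_range u v.
  by rewrite !mem_iota /edge_range => /andP[_ ->] ->.
by have [-> ->] := edge_inj (r _ _ hc hd) (r _ _ hc' hd') e.
Qed.

Lemma size_edges : size edges = (m * m)%N.
Proof. by rewrite size_allpairs !size_iota. Qed.

Lemma edge_weight a b : edge_range a b -> #|[set j | edge a b j]%SET| = (o + 2)%N.
Proof.
rewrite /edge_range => /andP[am /andP[mb bm]].
have ha : (o + a < n)%N by lia.
have hb : (o + b < n)%N by lia.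
have -> : [set j | edge a b j]%SET
   = (Ordinal ha |: (Ordinal hb |: [set j : 'I_n | (j < o)%N]))%SET.
  by apply/setP => j; rewrite !inE ffunE -!val_eqE /= orbC orbA orbAC -orbA; case: (j < o)%N;
      rewrite ?orbT ?orbF.
rewrite !cardsU1 !inE -val_eqE /= card_ord_ltn; last by lia.
have -> : (o + a < o)%N = false by lia.
have -> : (o + b < o)%N = false by lia.
have -> : (o + a == o + b)%N = false by lia.
by rewrite /=; lia.
Qed.

End EdgePoints.

Section SlicePoints.
Context {R : realType}.
Variables (k n : nat) (alpha : boolfun k).
Hypothesis alpha_mono : monotone_boolfun alpha.
Hypothesis n0 : (0 < n)%N.
Hypothesis alpha0 : alpha [ffun=> false] = false.
Hypothesis alpha_sing : forall j, alpha (single j) = false.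
Hypothesis alpha1 : alpha [ffun=> true] = true.
Variables o m : nat.
Hypothesis om : (o + m + m <= n)%N.
Let mu := @uniform_projections R n.

(** A minimal true set has two elements, as [alpha] is false on singletons. With ones on the rest of
    [T] and zeros off [T], [alpha] acts as the conjunction of the inputs [j1] and [j2]. *)
Lemma minimal_true_set : exists (T : {set 'I_k}) (j1 j2 : 'I_k), [/\ j1 != j2, j1 \in T, j2 \in T,
  alpha [ffun j => j \in T] = true & forall y : {ffun 'I_k -> bool},
   (forall j, y j -> j \in T) -> (y j1 = false \/ y j2 = false) -> alpha y = false].
Proof.
pose P (T : {set 'I_k}) : bool := alpha [ffun j => j \in T].
have PT : P [set: 'I_k]%SET 
  by rewrite /P (_ : finfun _ = [ffun=> true]) ?alpha1//; apply/ffunP => j; rewrite !ffunE inE.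
have [T /minsetP[hT minT] _] := minset_exists PT.
have [j1 j1T] : exists j, j \in T.
  apply/set0Pn/eqP => T0; move: hT; rewrite /P T0 (_ : finfun _ = [ffun=> false]) ?alpha0//.
  by apply/ffunP => j; rewrite !ffunE inE.
have [j2 j21 j2T] : exists2 j, j != j1 & j \in T.
  apply: contrapT => nx; move: hT; rewrite /P => hT.
  have := alpha_sing j1; rewrite (alpha_mono _ hT)// => j; rewrite !ffunE => jT.
  by apply: contrapT => /negP jj; apply: nx; exists j.
have sub j0 : j0 \in T -> forall y : {ffun 'I_k -> bool}, (forall j, y j -> j \in T) ->
    y j0 = false -> alpha y = false.
  move=> j0T y yT y0; apply/negP => ay.
  have h : P (T :\ j0)%SET.
    apply: (alpha_mono _ ay) => j yj; rewrite ffunE !inE yT// andbT.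
    by apply/eqP => jj; move: yj; rewrite jj y0.
  have := minT _ h (subD1set _ _) => /setP /(_ j0).
  by rewrite !inE eqxx j0T.
exists T, j1, j2; split=> //; first by rewrite eq_sym.
by move=> y yT [|]; apply: sub.
Qed.

Variable eta : R.
Hypothesis eta01 : 0 < eta <= 1.
Hypothesis o_large : eta * n%:R <= o%:R.
Hypothesis z_large : eta * n%:R <= (n - (o + m + m))%:R.

Let nR : 0 < n%:R :> R. Proof. by rewrite ltr0n. Qed.

Lemma edges_zero_prob :
  eta ^+ k <= growth_prob alpha mu 1 (fun g => all (fun x => ~~ g x) (edges n o m)).
Proof.
rewrite growth_probS; apply: le_trans (uniform_iid_prob_ge (B := fun=> [set j : 'I_n | (o + m +
    m <= j)%N]%SET) _).
  rewrite -[k in eta ^+ k]card_ord -prodr_const; apply: ler_prod => j _.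
  by rewrite (ltW (andP eta01).1) /= ler_pdivlMr// card_ord_geq.
move=> J hJ; apply/allP => x /mem_edges[a [b [hab ->]]].
rewrite ffunE (_ : finfun _ = [ffun=> false]) ?alpha0//; apply/ffunP => j; rewrite !ffunE.
have := hJ j; rewrite inE; move: hab; rewrite /edge_range => /andP[am /andP[mb bm]] h.
by apply/negbTE; rewrite !negb_or; move: am mb bm h; clear; lia.
Qed.

Lemma edge_prob a b : edge_range m a b -> eta ^+ k / n%:R ^+ 2
  <= growth_prob alpha mu 1 (fun g => g (edge n o a b) && all (fun x => (x == edge n o a b) ||
      ~~ g x) (edges n o m)).
Proof.
move=> hab; have [T [j1 [j2 [j12 j1T j2T aT hT]]]] := minimal_true_set.
have [ha hb] : (o + a < n)%N /\ (o + b < n)%N by move: hab om; rewrite /edge_range; clear; lia.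
(* [j1] and [j2] read the two ends of the edge, with probability [1 / n] each; every other input
   reads a coordinate constant on [edges], with probability at least [eta]. *)
pose B j : {set 'I_n} := if j == j1 then [set Ordinal ha]%SET else if j == j2 then [set Ordinal
    hb]%SET
  else if j \in T then [set j : 'I_n | (j < o)%N]%SET else [set j : 'I_n | (o + m + m <= j)%N]%SET.
rewrite growth_probS; apply: le_trans (uniform_iid_prob_ge (B := B) _).
  pose c (j : 'I_k) : R := if (j == j1) || (j == j2) then n%:R^-1 else 1.
  have -> : eta ^+ k / n%:R ^+ 2 = \prod_(j < k) (eta * c j).
    rewrite big_split /= prodr_const card_ord; congr (_ * _).
    rewrite (bigD1 j1)//= (bigD1 j2)/=; last by rewrite eq_sym.
    rewrite big1 ?mulr1; last by move=> j /andP[/negbTE h1 /negbTE h2]; rewrite /c h1 h2.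
    by rewrite /c !eqxx orbT /= -expr2 exprVn.
  have /andP[e0 e1] := eta01.
  apply: ler_prod => j _; rewrite /c /B; apply/andP; split.
    by rewrite mulr_ge0 ?(ltW e0)//; case: ifP => // _; rewrite invr_ge0.
  case: (j == j1) => /=; first by rewrite cards1 mul1r ler_piMl// invr_ge0.
  case: (j == j2) => /=; first by rewrite cards1 mul1r ler_piMl// invr_ge0.
  rewrite mulr1 ler_pdivlMr//; case: (j \in T); last by rewrite card_ord_geq.
  by rewrite card_ord_ltn//; move: om; clear; lia.
move=> J hJ.
have val a' b' : edge_range m a' b' -> forall j, edge n o a' b' (J j) =
    if j == j1 then a == a' else if j == j2 then b == b' else j \in T.
  move=> hab' j; have := hJ j; rewrite /B ffunE; move: hab hab'; rewrite /edge_range.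
  move=> h h'; case: (j == j1).
    by rewrite inE => /eqP -> /=; move: h h'; clear; lia.
  case: (j == j2); first by rewrite inE => /eqP -> /=; move: h h'; clear; lia.
  by case: (j \in T); rewrite inE; [move=> ->|move: h h'; clear; lia].
have pJ y j : [ffun j0 => [ffun j' => projection (J j')] j0 y] j = y (J j) by rewrite !ffunE.
apply/andP; split.
  rewrite ffunE (_ : finfun _ = [ffun j => j \in T]) ?aT//; apply/ffunP => j.
  rewrite pJ [RHS]ffunE val// !eqxx; case: eqP => [->|_]; first by rewrite j1T.
  by case: eqP => [->|_]; rewrite ?j2T.
apply/allP => x /mem_edges[a' [b' [hab' ->]]].
have [->|ne] := eqVneq; first by [].
rewrite ffunE /= (hT [ffun j => [ffun j' => projection (J j')] j (edge n o a' b')])//.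
  move=> j; rewrite pJ val//; case: eqP => [->|_]; first by rewrite j1T.
  by case: eqP => [->|_]; rewrite ?j2T.
rewrite !pJ !val// eqxx (eq_sym j2) (negbTE j12) eqxx.
have [aa|_] := eqVneq a a'; last by left.
by right; apply/eqP => bb; move: ne; rewrite aa bb eqxx.
Qed.

End SlicePoints.

Lemma contraction_step (R : realType) (u q e a b z t : R) : 0 <= 1 - u <= 1 -> 0 <= t -> 0 <= q ->
  e <= q -> b <= z + t * (2 * q) -> a <= (1 - u) * b + 2 * e ->
  a <= (1 - u) * z + (t + 1) * (2 * q).
Proof.
move=> /andP[u0 u1] t0 q0 eq hb ha.
have h1 : (1 - u) * b <= (1 - u) * (z + t * (2 * q)) by rewrite ler_wpM2l.
have h2 : (1 - u) * (t * (2 * q)) <= t * (2 * q) by rewrite ler_piMl// !mulr_ge0.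
by lra.
Qed.

Section Slice.
Context {R : realType}.
Variables (k : nat) (alpha : boolfun k) (s : R).
Hypothesis alpha_mono : monotone_boolfun alpha.
Hypothesis s01 : 0 < s < 1.
Hypothesis nproj : forall j, alpha <> projection j.
Hypothesis fs : ext (connective alpha) (nseq k s) = s.
Variable N : nat.
Hypothesis N0 : (0 < N)%N.
Hypothesis Nh : N%:R^-1 <= 4 / 3 * 2^-1 ^+ k :> R.

Let alpha0 := alpha_false alpha_mono s01 fs nproj.
Let alpha1 := alpha_true alpha_mono s01 fs nproj.
Let V := s * (1 - s).
Let V0 : 0 < V := variance_gt0 s01.

Lemma expRN_le_half (j : nat) : expR (- j%:R) <= 2^-1 ^+ j :> R.
Proof.
rewrite expRN exprVn lef_pV2 ?posrE ?expR_gt0 ?exprn_gt0//.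
rewrite -[j%:R]mulr1 expRM_natl; apply: lerXn2r; rewrite ?nnegrE ?expR_ge0//.
by have := expR_ge1Dx (1 : R).
Qed.

(** Two kinds of level-1 functions vanish on [l] and differ at [x]: those false on all edges and
    those true at [x] only. The product of their probabilities is the deficit given by
    [variance_cond_prob]. *)
Lemma edge_low_variance n o m (eta : R) x l M : (0 < n)%N -> (n <= 2 ^ M)%N ->
  (o + m + m <= n)%N -> 0 < eta <= 1 -> eta * n%:R <= o%:R ->
  eta * n%:R <= (n - (o + m + m))%:R -> (o + 2)%:R = s * n%:R ->
  x \in edges n o m -> x \notin l -> {subset l <= edges n o m} ->
  low_variance alpha (@uniform_projections R n) s 1 x l
    (V * (1 - eta ^+ (2 * k) / V * 2^-1 ^+ (2 * M))).
Proof.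
move=> n0 nM om eta01 oe ze os xE xl lE; set mu := @uniform_projections R n.
have mu0 : forall g, 0 <= mu g := @uniform_projections_ge0 R n.
have mu1 : \sum_g mu g = 1 := uniform_projections_sum1 n0.
have nR : 0 < n%:R :> R by rewrite ltr0n.
have [a [b [hab xab]]] := mem_edges xE.
have xs : point_prob alpha mu 1 x = s.
  rewrite (point_prob_fixed mu1 fs)// uniform_point_prob// xab (edge_weight om hab) os.
  by rewrite mulfK// gt_eqF.
exists (boolfun n), (growth mu alpha 1), (cond_prob alpha mu 1 (sset l) x), (restr (sset l)).
split; first exact: represents_cond_prob.
  by have := biased_cond_prob alpha mu0 mu1 1 (sset l) x; rewrite xs.
have := @variance_cond_prob R k n alpha mu mu0 mu1 1 (sset l) x
  (fun g => g x && all (fun x' => (x' == x) || ~~ g x') (edges n o m))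
  (fun g => all (fun x' => ~~ g x') (edges n o m)) [ffun=> false].
rewrite xs => h; apply: le_trans (h _ _) _.
- move=> g /andP[gx /allP ga]; split=> //; apply/ffunP => x'; rewrite !ffunE inE.
  case: (boolP (x' \in l)) => //= x'l; have := ga _ (lE _ x'l).
  by case: eqP => [x'x|_ /negbTE //]; rewrite -x'x x'l in xl.
- move=> g /allP ga; split; last exact: ga.
  apply/ffunP => x'; rewrite !ffunE inE.
  by case: (boolP (x' \in l)) => //= x'l; apply/negbTE/ga/lE.
have -> : V * (1 - eta ^+ (2 * k) / V * 2^-1 ^+ (2 * M)) = V - eta ^+ (2 * k) * 2^-1 ^+ (2 * M).
  by rewrite mulrBr mulr1 mulrA; congr (_ - _ * _); rewrite mulrC divfK// gt_eqF.
rewrite lerD2l lerN2.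
have h1 := edge_prob alpha_mono n0 alpha0 (alpha_single alpha_mono s01 fs nproj) alpha1 om eta01
    oe ze hab.
have h2 := edges_zero_prob n0 alpha0 om eta01 ze.
rewrite -xab in h1.
have e0 : 0 <= eta ^+ k by rewrite exprn_ge0// ltW//; case/andP: eta01.
apply: (@le_trans _ _ (eta ^+ k / n%:R ^+ 2 * eta ^+ k)); last first.
  by apply: ler_pM => //; rewrite divr_ge0// sqr_ge0.
rewrite mul2n -addnn exprD [leRHS]mulrAC ler_wpM2l ?mulr_ge0//.
rewrite exprVn lef_pV2 ?posrE ?exprn_gt0//.
by rewrite mulnC exprM lerXn2r ?nnegrE ?exprn_ge0// -natrX ler_nat.
Qed.

(** Each revealed edge costs a factor [1 - u], up to a tiny error; as [m * m] is quadratic in [n],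
    the product is far below [2 ^ -n]. *)
Lemma slice_bound : exists n1 c : nat, forall n w M : nat, (n1 <= n)%N -> (0 < n)%N ->
  (n <= 2 ^ M)%N -> w%:R = s * n%:R -> forall i, (N * (3 * M) + c <= i)%N ->
  forall g, growth (@uniform_projections R n) alpha i g <= 2^-1 ^+ (n + 3).
Proof.
have k3 := arity_gt2 alpha_mono s01 fs nproj.
move: (s01) => /andP[s0 s1].
pose u := Num.min s (1 - s) / 2.
have m0 : 0 < Num.min s (1 - s) by rewrite lt_min s0 subr_gt0.
have u0 : 0 < u by rewrite divr_gt0.
have us : 2 * u <= s by rewrite /u mulrC divfK// ge_min lexx.
have us' : 2 * u <= 1 - s by rewrite /u mulrC divfK// ge_min lexx orbT.
have u1 : u <= 1 by lra.
have [w /andP[w0 wu] hw] :=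
  low_subexp_rate alpha_mono s01 nproj fs N0 Nh (divr_gt0 u0 (ltr0n R 2)).
have wu2 : 2 * w <= u by lra.
pose C := u ^+ (2 * k) / V.
have uV : u <= V by rewrite /V; have [|] := leP s (1 - s); nra.
have C0 : 0 < C by rewrite divr_gt0// exprn_gt0.
have C1 : C <= 1.
  rewrite ler_pdivrMr// mul1r (le_trans _ uV)// -[leRHS]expr1.
  by apply: ler_wiXn2l => //; rewrite ?(ltW u0)//; move: k3; clear; lia.
(* With [K] at least [24 / u * n], the error exponent [K * u / 2] is at least [12 * n]. *)
have [c hc] := hw C (24 / u) C0.
have u1' : 0 <= 1 - u < 1 by apply/andP; split; lra.
have half0 : (0 : R) < 2^-1 by rewrite invr_gt0.
have [d hd] := exists_pow_le u1' half0.
have t1 : 0 <= 80 * d%:R / u ^+ 2 by apply: divr_ge0 (sqr_ge0 _); rewrite mulr_ge0.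
have t2 : 0 <= 4 / u by rewrite divr_ge0// ltW.
(* The first term yields [m >= u * n / 4]; the second then yields
   [m * m >= 5 * d * n >= d * (n + 4)], where [d] factors [1 - u] are worth one half. *)
pose n1 := (Num.bound (4 / u + 80 * d%:R / u ^+ 2)).+1.
have n1_ge : 4 / u + 80 * d%:R / u ^+ 2 <= n1%:R.
  apply: le_trans (ltW (archi_boundP _)) _; last by rewrite ler_nat.
  exact: addr_ge0.
exists n1, (c.+1) => n ww M nn1 n0 nM ws i hi g.
set mu := @uniform_projections R n.
have mu0 : forall g, 0 <= mu g := @uniform_projections_ge0 R n.
have mu1 : \sum_g mu g = 1 := uniform_projections_sum1 n0.
have nR : 0 < n%:R :> R by rewrite ltr0n.
have nbig : 4 / u + 80 * d%:R / u ^+ 2 <= n%:R by rewrite (le_trans n1_ge)// ler_nat.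
have un4 : 4 <= u * n%:R.
  have : 4 / u <= n%:R by apply: le_trans nbig; rewrite lerDl.
  by rewrite ler_pdivrMr// mulrC.
have und : 80 * d%:R <= u ^+ 2 * n%:R.
  have : 80 * d%:R / u ^+ 2 <= n%:R by apply: le_trans nbig; rewrite lerDr.
  by rewrite ler_pdivrMr ?exprn_gt0// [n%:R * _]mulrC.
have ww2 : (2 <= ww)%N by rewrite -(ler_nat R) ws; nra.
have wwn : (ww <= n)%N by rewrite -(ler_nat R) ws ler_piMl// ltW.
(* Each block takes at most a quarter of the remaining coordinates, so at least half of them stay
   constant zeros. *)
pose o := (ww - 2)%N; pose m := ((n - ww) %/ 4)%N.
have oR : o%:R = s * n%:R - 2 :> R by rewrite natrB// ws.
have hm1 : (4 * m <= n - ww)%N by rewrite mulnC leq_divM.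
have hm2 : (n - ww <= 4 * m + 3)%N.
  by rewrite {1}(divn_eq (n - ww) 4) mulnC leq_add2l -ltnS ltn_mod.
have om : (o + m + m <= n)%N by rewrite /o; move: hm1 ww2 wwn; clear; lia.
have oe : u * n%:R <= o%:R by rewrite oR; nra.
have ze : u * n%:R <= (n - (o + m + m))%:R.
  have : (n - ww <= 2 * (n - (o + m + m)))%N.
    by rewrite /o; move: hm1 ww2 wwn; clear; lia.
  by rewrite -(ler_nat R) natrB// natrM ws; nra.
have os : (o + 2)%:R = s * n%:R by rewrite subnK.
have mR : u * n%:R / 4 <= m%:R.
  by move: hm2; rewrite -(ler_nat R) natrB// natrD natrM ws; nra.
have m2 : (d * (n + 4) <= m * m)%N.
  rewrite -(ler_nat R) !natrM natrD.
  have n1R : 1 <= n%:R :> R by rewrite ler1n.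
  have h1 : (u * n%:R / 4) * (u * n%:R / 4) <= m%:R * m%:R.
    by apply: ler_pM => //; rewrite divr_ge0// mulr_ge0// ltW.
  have h2 : 80 * d%:R * n%:R <= u ^+ 2 * n%:R * n%:R by rewrite ler_pM2r.
  have h3 : d%:R * 4 <= d%:R * (4 * n%:R) :> R by rewrite ler_wpM2l// ler_peMr.
  lra.
pose q : R := 2^-1 ^+ (12 * n).
have chain l : uniq l -> {subset l <= edges n o m} ->
    growth_prob alpha mu i (agree g l) <= (1 - u) ^+ size l + (size l)%:R * (2 * q).
  elim: l => [|x l IH] /=; first by rewrite expr0 mul0r addr0 growth_prob_le1.
  move=> /andP[xl lu] lE.
  have xE : x \in edges n o m by apply: lE; rewrite mem_head.
  have lE' : {subset l <= edges n o m} by move=> z zl; apply: lE; rewrite in_cons zl orbT.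
  have u01 : 0 < u <= 1 by rewrite u0.
  have hv := edge_low_variance n0 nM om u01 oe ze os xE xl lE'.
  have C2 : C * 2^-1 ^+ (2 * M) <= 1.
    by rewrite (le_trans _ C1)// ler_piMr ?(ltW C0)// exprn_ile1 ?invr_ge0 ?invf_le1 ?ler1n.
  have hi' : (1 + N * (3 * M) + c <= i)%N by move: hi; clear; lia.
  have [K KD hK] := hc n mu 1%N x l M hv C2 i hi'.
  have n2M : n%:R <= 2 ^+ M :> R by rewrite -natrX ler_nat.
  have KD' : 24 / u * n%:R <= K.
    by apply: le_trans KD; rewrite ler_wpM2l// divr_ge0// ltW.
  have K0 : 0 < K by apply: lt_le_trans KD'; rewrite mulr_gt0// divr_gt0.
  have hq : expR (- (K * u / 2)) <= q.
    apply: le_trans (expRN_le_half _); rewrite ler_expR lerN2 ler_pdivlMr// -ler_pdivrMr//.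
    suff -> : (12 * n)%:R * 2 / u = 24 / u * n%:R by [].
    by rewrite natrM; ring.
  rewrite exprS -[(size l).+1%:R]natr1; apply: contraction_step hq (IH lu lE') _ => //.
  - by case/andP: u1' => -> /ltW ->.
  - by rewrite exprn_ge0.
  - exact: (represents_agree_le s01 g mu0 mu1 K0 us us' w0 wu2 hK).
have := chain _ (edges_uniq om) (fun x h => h); rewrite size_edges => hP.
have hg : growth mu alpha i g <= growth_prob alpha mu i (agree g (edges n o m)).
  have -> : growth mu alpha i g = growth_prob alpha mu i (pred1 g).
    by rewrite /growth_prob big_pred1_eq.
  apply: growth_prob_sub => // g' /eqP ->.
  by apply/allP.
apply: le_trans hg _; apply: le_trans hP _.
have -> : 2^-1 ^+ (n + 3) = 2^-1 ^+ (n + 4) + 2^-1 ^+ (n + 4) :> R.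
  by rewrite [in RHS]addnS exprS; lra.
apply: lerD.
  apply: (@le_trans _ _ ((1 - u) ^+ (d * (n + 4)))).
    by case/andP: u1' => ? /ltW ?; apply: ler_wiXn2l.
  rewrite exprM; apply: lerXn2r; rewrite ?nnegrE ?exprn_ge0 ?invr_ge0//.
  by case/andP: u1'.
have mn : (m * m <= 2 ^ (2 * n))%N.
  have m_n : (m <= 2 ^ n)%N.
    apply: (@leq_trans n); first by move: om; clear; lia.
    by rewrite ltnW// ltn_expl.
  by rewrite mul2n -addnn expnD leq_mul.
apply: (@le_trans _ _ (2 ^+ (2 * n) * (2 * q))).
  rewrite ler_wpM2r ?mulr_ge0 ?exprn_ge0 ?invr_ge0//.
  by rewrite -natrX ler_nat.
have -> : 2 ^+ (2 * n) * (2 * q) = 2^-1 ^+ (10 * n - 1) :> R.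
  rewrite /q (_ : 12 * n = 2 * n + (1 + (10 * n - 1)))%N; last by move: n0; clear; lia.
  rewrite 2!exprD expr1 !exprVn; field.
  by rewrite !expf_neq0.
by apply: ler_wiXn2l; rewrite ?invr_ge0 ?invf_le1 ?ler1n//; move: n0; clear; lia.
Qed.

End Slice.

(** * The rate of convergence *)

Lemma growth_projection (R : realType) (k n : nat) (mu : boolfun n -> R) (j : 'I_k) i f :
  \sum_f mu f = 1 -> growth mu (projection j) i f = mu f.
Proof.
move=> mu1; elim: i f => [//|i IH] f /=.
rewrite (eq_iid_prob (w' := mu) (E' := fun g => g j == f))//; last first.
  by move=> g; congr (_ == _); apply/ffunP => x; rewrite !ffunE.
transitivity (\prod_(i < k) \sum_(h | (i == j) ==> (h == f)) mu h).
  rewrite bigA_distr_big_dep /iid_prob; apply: eq_bigl => g.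
  apply/eqP/familyP => [gf i'|/(_ j)]; first by apply/implyP => /eqP ->; apply/eqP.
  by move=> /implyP/(_ (eqxx _))/eqP.
rewrite (bigD1 j)//= eqxx (big_pred1 f)// big1 ?mulr1//.
by move=> i' /negbTE ->.
Qed.

Section Rate.
Local Open Scope classical_set_scope.
Context {R : realType}.

(** The closed bound passes to the limit, so [a i] and [limn a] are both within a quarter of
    [2 ^- n] of [v]. *)
Lemma dist_limn_lt (a : nat -> R) (v : R) n I : cvgn a ->
  (forall i, (I <= i)%N -> `|a i - v| <= 2^-1 ^+ (n + 2)) ->
  forall i, (I <= i)%N -> `|a i - limn a| < 2 ^- n.
Proof.
move=> ca hv i hi.
have h0 : (0 : R) < 2^-1 ^+ n by rewrite exprn_gt0.
have hl : `|v - limn a| <= 2^-1 ^+ (n + 2).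
  have hc : (fun i => `|v - a i|) @ \oo --> `|v - limn a|.
    by apply: cvg_norm; apply: cvgB => //; exact: cvg_cst.
  rewrite -(cvg_lim _ hc)//; apply: limr_le; first by apply/cvg_ex; exists `|v - limn a|.
  by exists I => // j /= hj; rewrite distrC; apply: hv.
have -> : a i - limn a = (a i - v) + (v - limn a) by ring.
rewrite -exprVn; apply: (le_lt_trans (ler_normD _ _)).
move: (hv i hi) hl; rewrite exprD expr2; lra.
Qed.

Variables (k : nat) (alpha : boolfun k) (s : R).
Hypothesis alpha_mono : monotone_boolfun alpha.
Hypothesis s01 : 0 < s < 1.
Hypothesis nproj : forall j, alpha <> projection j.
Hypothesis fs : ext (connective alpha) (nseq k s) = s.

Let k3 : (2 < k)%N := arity_gt2 alpha_mono s01 fs nproj.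
(** Chosen so that [N^-1] is [4 / 3 * 2 ^ -k] and [N * k] is three quarters of [k * 2 ^ k]. *)
Let N := (3 * 2 ^ (k - 2))%N.

Let N0 : (0 < N)%N. Proof. by rewrite muln_gt0 expn_gt0. Qed.

Let Nh : N%:R^-1 = 4 / 3 * 2^-1 ^+ k :> R.
Proof.
have P0 : 2 ^+ (k - 2) != 0 :> R by rewrite expf_neq0.
by rewrite /N natrM natrX -[k in RHS](subnK (ltnW k3)) exprD exprVn; field.
Qed.

Let Nh_lt : N%:R^-1 < 3 / 2 * 2^-1 ^+ k :> R.
Proof. by rewrite Nh ltr_pM2r ?exprn_gt0//; lra. Qed.

Let Nh_le : N%:R^-1 <= 4 / 3 * 2^-1 ^+ k :> R.
Proof. by rewrite Nh. Qed.

Lemma growth_limn_lt_generic : exists c : nat, forall n M, (0 < n)%N -> (n <= 2 ^ M)%N ->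
  (forall w : nat, (w <= n)%N -> w%:R / n%:R != s) ->
  let mu := @uniform_projections R n in
  forall f i, (N * (k * M) + M + c <= i)%N ->
    `|growth mu alpha i f - growth_lim mu alpha f| < 2 ^- n.
Proof.
have [c hc] := orbit_rate alpha_mono s01 nproj fs N0 Nh_lt.
exists c => n M n0 nM hw mu f i hi.
have mu0 : forall g, 0 <= mu g := @uniform_projections_ge0 R n.
have mu1 : \sum_g mu g = 1 := uniform_projections_sum1 n0.
have half0 : (0 : R) < 2^-1 by rewrite invr_gt0.
pose thr : boolfun n := [ffun x => s < point_prob alpha mu 0 x]%R.
(* A factor [2 ^ n] is lost in the union bound over assignments; what remains is the accuracy
   [dist_limn_lt] asks for. *)
pose e : R := 2^-1 ^+ (2 * n + 2).
have point x j : (N * (k * M) + M + c <= j)%N ->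
    growth_prob alpha mu j (fun g => g x != thr x) <= e.
  move=> hj.
  have wn : (#|[set i | x i]%SET| <= n)%N by rewrite -[n in leqRHS]card_ord max_card.
  have := hc n _ M (point_prob alpha mu ^~ x) n0 wn nM
    (point_prob_orbit alpha mu1 x) (uniform_point_prob alpha x) _ j hj.
  rewrite /= uniform_point_prob// => /(_ (hw _ wn)) h.
  have he : 2^-1 ^+ (2 ^ M.+2) <= e.
    apply: ler_wiXn2l; [exact: ltW|by rewrite invf_le1// ler1n|].
    by rewrite !expnS; move: nM n0; clear; lia.
  apply: le_trans he; apply: le_trans h.
  rewrite -(uniform_point_prob alpha) ffunE; set b := (_ < _)%R.
  have -> : growth_prob alpha mu j (fun g => g x != b)
      = if b then 1 - point_prob alpha mu j x else point_prob alpha mu j x.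
    rewrite /point_prob; case: b; last by apply: eq_bigl => g; rewrite eqbF_neg negbK.
    rewrite -(growth_probC alpha mu1 j (fun g => g x)) addrC addKr.
    by apply: eq_bigl => g; rewrite /= eqb_id.
  by case: b; rewrite ?subr0 ?ler_norm// distrC ler_norm.
apply: (@dist_limn_lt (fun i => growth mu alpha i f) (f == thr)%:R n _ _ _ i hi).
  exact: (growth_cvg mu0 mu1 alpha_mono s01 nproj fs).
move=> j hj; have gE g : growth mu alpha j g = growth_prob alpha mu j (pred1 g).
  by rewrite /growth_prob big_pred1_eq.
have [->|fthr] := eqVneq f thr; last first.
  have [x fx] : exists x, f x != thr x.
    by apply/existsP; apply: contraNT fthr; rewrite negb_exists => /forallP h;
      apply/eqP/ffunP => x; apply/eqP; have := h x; rewrite negbK.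
  rewrite subr0 ger0_norm ?growth_ge0// gE.
  apply: (@le_trans _ _ e).
    by apply: le_trans (point x j hj); apply: growth_prob_sub => // g /eqP ->.
  apply: ler_wiXn2l; [exact: ltW|by rewrite invf_le1// ler1n|].
  by clear; lia.
rewrite distrC ger0_norm ?subr_ge0 ?gE ?growth_prob_le1//.
have -> : 1 - growth_prob alpha mu j (pred1 thr) = growth_prob alpha mu j (predC (pred1 thr)).
  by apply/eqP; rewrite subr_eq addrC growth_probC.
apply: (@le_trans _ _ (\sum_(x : {ffun 'I_n -> bool}) growth_prob alpha mu j (fun g => g x !=
    thr x))).
  rewrite /growth_prob; under [leRHS]eq_bigr do rewrite big_mkcond.
  rewrite exchange_big /= big_mkcond; apply: ler_sum => g _.
  have g0 := growth_ge0 alpha mu0 j g.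
  case: ifPn => [gt|_]; last by apply: sumr_ge0 => x _; case: ifP.
  have [x gx] : exists x, g x != thr x.
    by apply/existsP; apply: contraNT gt; rewrite negb_exists => /forallP h;
      apply/eqP/ffunP => x; apply/eqP; have := h x; rewrite negbK.
  rewrite (bigD1 x)//= gx lerDl; apply: sumr_ge0 => y _; by case: ifP.
apply: (@le_trans _ _ (\sum_(x : {ffun 'I_n -> bool}) e)); first by apply: ler_sum => x _;
    apply: point.
rewrite sumr_const card_ffun card_bool card_ord -(mulr_natl e).
have -> : 2^-1 ^+ (n + 2) = (2 ^ n)%:R * e.
  rewrite /e natrX (_ : 2 * n + 2 = n + (n + 2))%N; last by clear; lia.
  by rewrite [in RHS]exprD mulrA -exprMn divff ?expr1n ?mul1r// pnatr_eq0.
exact: lexx.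
Qed.

Lemma growth_limn_lt_slice : exists n1 c : nat, forall n w M, (n1 <= n)%N -> (0 < n)%N ->
  (n <= 2 ^ M)%N -> w%:R = s * n%:R ->
  let mu := @uniform_projections R n in
  forall f i, (N * (k * M) + M + c <= i)%N ->
    `|growth mu alpha i f - growth_lim mu alpha f| < 2 ^- n.
Proof.
have [n1 [c hc]] := slice_bound alpha_mono s01 nproj fs N0 Nh_le.
exists n1, c => n w M nn1 n0 nM ws mu f i hi.
have mu0 : forall g, 0 <= mu g := @uniform_projections_ge0 R n.
have mu1 : \sum_g mu g = 1 := uniform_projections_sum1 n0.
apply: (@dist_limn_lt (fun i => growth mu alpha i f) 0 n _ _ _ i hi).
  exact: (growth_cvg mu0 mu1 alpha_mono s01 nproj fs).
move=> j hj; rewrite subr0 ger0_norm ?growth_ge0//.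
apply: le_trans (hc n w M nn1 n0 nM ws j _ f) _.
  apply: leq_trans hj; rewrite leq_add2r; apply: leq_trans (leq_addr _ _).
  by rewrite leq_mul2l leq_mul2r k3 !orbT.
by apply: ler_wiXn2l; [rewrite invr_ge0|rewrite invf_le1// ler1n|rewrite leq_add2l].
Qed.

Lemma growth_limn_lt_eventually n : (0 < n)%N -> let mu := @uniform_projections R n in
  exists c : nat, forall f i, (c <= i)%N ->
    `|growth mu alpha i f - growth_lim mu alpha f| < 2 ^- n.
Proof.
move=> n0 mu.
have mu0 : forall g, 0 <= mu g := @uniform_projections_ge0 R n.
have mu1 : \sum_g mu g = 1 := uniform_projections_sum1 n0.
have e0 : (0 : R) < 2 ^- n by rewrite invr_gt0 exprn_gt0.
have h f : exists c : nat, forall i, (c <= i)%N ->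
    `|growth mu alpha i f - growth_lim mu alpha f| < 2 ^- n.
  have /cvgrPdist_lt /(_ _ e0)[c _ hc] := growth_cvg mu0 mu1 alpha_mono s01 nproj fs (g := f).
  by exists c => i ci; rewrite distrC; apply: hc.
have [c hc] := fin_all_exists h.
exists (\max_f c f)%N => f i hi; apply: hc; apply: leq_trans hi.
exact: leq_bigmax.
Qed.

Lemma growth_limn_lt : exists c : nat, forall n M, (0 < n)%N -> (n <= 2 ^ M)%N ->
  let mu := @uniform_projections R n in
  forall f i, (k * 2 ^ k * M + c <= i)%N ->
    `|growth mu alpha i f - growth_lim mu alpha f| < 2 ^- n.
Proof.
have [c1 h1] := growth_limn_lt_generic.
have [n1 [c2 h2]] := growth_limn_lt_slice.
have [c3 h3] : exists c : nat, forall n, (0 < n)%N -> (n < n1)%N ->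
    let mu := @uniform_projections R n in forall f i, (c <= i)%N ->
    `|growth mu alpha i f - growth_lim mu alpha f| < 2 ^- n.
  elim: n1 {h2} => [|m [c hc]]; first by exists 0%N.
  have [->|m0] := eqVneq m 0%N; first by exists 0%N => n n0; rewrite ltnS leqNgt n0.
  have [c' hc'] : exists c : nat, forall f i, (c <= i)%N ->
      `|growth (@uniform_projections R m) alpha i f - growth_lim (@uniform_projections R m)
          alpha f| < 2 ^- m.
    by apply: growth_limn_lt_eventually; rewrite lt0n.
  exists (maxn c c') => n n0; rewrite ltnS leq_eqVlt => /orP[/eqP ->|nm] mu f i.
    by rewrite geq_max => /andP[_]; apply: hc'.
  by rewrite geq_max => /andP[+ _]; apply: hc.
(* The remaining quarter [k * 2 ^ (k - 2)] pays for the [M] squarings. *)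
have rounds M : (N * (k * M) + M <= k * 2 ^ k * M)%N.
  have -> : (k * 2 ^ k = N * k + k * 2 ^ (k - 2))%N.
    rewrite /N -[in LHS](subnK (ltnW k3)) expnD subnK ?(ltnW k3)//.
    by move: (2 ^ _)%N => P; clear; lia.
  by rewrite mulnDl -mulnA leq_add2l leq_pmull// muln_gt0 expn_gt0 (ltnW (ltnW k3)).
exists (c1 + c2 + c3)%N => n M n0 nM mu f i hi.
have hi1 : (N * (k * M) + M + c1 <= i)%N by have := rounds M; move: hi; clear; lia.
have hi2 : (N * (k * M) + M + c2 <= i)%N by have := rounds M; move: hi; clear; lia.
have hi3 : (c3 <= i)%N by move: hi; clear; lia.
have [[w ws]|hw] := pselect (exists w : nat, w%:R = s * n%:R); last first.
  apply: (h1 n M) => // w wn; apply/eqP => ws; apply: hw; exists w.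
  by rewrite -ws divfK// pnatr_eq0 -lt0n.
have [nn1|nn1] := ltnP n n1; first exact: (h3 n).
exact: (h2 n w M).
Qed.

End Rate.

Theorem theorem5p11 (R : realType) (k : nat) (alpha : boolfun k)
    (alpha_monotone : monotone_boolfun alpha)
    (alpha_fixpoint : exists s : R, [/\ 0 < s, s < 1 & characteristic_poly alpha s = s]) :
  exists c : R, forall n : nat, (0 < n)%N ->
    forall f : boolfun n,
      cvgn (fun i => growth (@uniform_projections R n) alpha i f) /\
      forall i : nat,
        k%:R * 2 ^+ k * log2 (n%:R : R) + c <= i%:R ->
        `|growth (@uniform_projections R n) alpha i f
          - growth_lim (@uniform_projections R n) alpha f| < 2 ^- n.
Proof.
have [s [s0 s1]] := alpha_fixpoint; rewrite characteristic_poly_ext => fs.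
have s01 : 0 < s < 1 by rewrite s0.
have [[j alphaE]|nproj] := pselect (exists j, alpha = projection j).
  exists 0 => n n0 f; rewrite /growth_lim alphaE.
  have -> : (fun i => growth (@uniform_projections R n) (projection j) i f)
      = (fun=> uniform_projections R f).
    by apply/funext => i; rewrite growth_projection// uniform_projections_sum1.
  split=> [|i _]; first exact: is_cvg_cst.
  rewrite growth_projection ?uniform_projections_sum1// lim_cst//.
  by rewrite subrr normr0 invr_gt0 exprn_gt0.
have {}nproj j : alpha <> projection j by move=> E; apply: nproj; exists j.
have [c hc] := growth_limn_lt alpha_monotone s01 nproj fs.
(* The summand [k * 2 ^ k] absorbs the rounding of [log2 n] up to the integer [up_log 2 n]. *)
exists ((k * 2 ^ k + c)%:R) => n n0 f; split.
  exact: (growth_cvg (@uniform_projections_ge0 R n) (uniform_projections_sum1 n0)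
    alpha_monotone s01 nproj fs).
move=> i hi; apply: (hc n (up_log 2 n)) => //; first exact: up_logP.
rewrite -(ler_nat R); apply: le_trans hi.
have ln20 : 0 < ln (2 : R) by rewrite ln_gt0// ltr1n.
have logM : (up_log 2 n)%:R <= log2 (n%:R : R) + 1.
  have [n1|n1] := leqP n 1.
    have -> : n = 1%N by apply/eqP; rewrite eqn_leq n1.
    by rewrite up_log1 /log2 ln1 mul0r add0r.
  have M0 : (0 < up_log 2 n)%N by rewrite up_log_gt0.
  have h := up_log_gtn (isT : (1 < 2)%N) n1.
  rewrite -lerBlDr -[1]/(1%:R) -natrB// subn1 /log2 ler_pdivlMr//.
  rewrite mulr_natl -lnXn// ler_ln ?posrE ?exprn_gt0 ?ltr0n//.
  by rewrite -natrX ler_nat ltnW.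
rewrite !natrD !natrM natrX.
have : k%:R * 2 ^+ k * (up_log 2 n)%:R <= k%:R * 2 ^+ k * (log2 (n%:R : R) + 1).
  by rewrite ler_wpM2l// mulr_ge0// exprn_ge0.
lra.
Qed.
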